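(* Consider the network wave problem $$\begin{cases} \ddot u_j(t,x)=(c_ju_j')'(t,x), & t\in\mathbb{R},\ x\in(0,1),\ j=1,\dots,m,\\ u_j(t,\mathsf{v}_i)=u_\ell(t,\mathsf{v}_i), & t\in\mathbb{R},\ j,\ell\in\Gamma(\mathsf{v}_i),\ i=1,\dots,n,\\ \sum_{j=1}^m\phi_{ij}\mu_jc_j(\mathsf{v}_i)u_j'(t,\mathsf{v}_i)=0, & t\in\mathbb{R},\ i=1,\dots,n,\\ u_j(0,x)=\mathsf{f}_j(x),\quad \dot u_j(0,x)=\mathsf{g}_j(x), & x\in(0,1),\ j=1,\dots,m. \end{cases}$$ This problem is well-posed, i.e., for all $\mathsf{f}\in V$ and $\mathsf{g}\in X_2$ it admits a unique mild solution, which depends continuously on the initial data. If further $c_j\in C^\infty[0,1]$ for $j=1,\dots,m$ and the initial data satisfy $\mathsf{f},\mathsf{g}\in (C_c^\infty(0,1))^m$, then the solution is of class $(C^\infty[0,1])^m$ (that is, $u(t,\cdot)\in (C^\infty[0,1])^m$ for all $t\in\mathbb{R}$).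
   Context: $G$ is a finite connected simple graph (no loops, no multiple edges) with vertices $\mathsf{v}_1,\dots,\mathsf{v}_n$ and edges $\mathsf{e}_1,\dots,\mathsf{e}_m$, in which every vertex has degree at least 2. Each edge is parameterized on $[0,1]$, with endpoints $\mathsf{e}_j(0)$ and $\mathsf{e}_j(1)$. The $n\times m$ matrices $\Phi^{\pm}=(\phi^{\pm}_{ij})$ are: $\phi^+_{ij}=1$ if $\mathsf{e}_j(0)=\mathsf{v}_i$ and $0$ otherwise; $\phi^-_{ij}=1$ if $\mathsf{e}_j(1)=\mathsf{v}_i$ and $0$ otherwise; $\Phi=(\phi_{ij}):=\Phi^+-\Phi^-$. $\Gamma(\mathsf{v}_i)$ is the set of $j$ such that $\mathsf{e}_j(0)=\mathsf{v}_i$ or $\mathsf{e}_j(1)=\mathsf{v}_i$. For a function $h_j$ on edge $\mathsf{e}_j$, $h_j(\mathsf{v}_i)$ denotes $h_j(0)$ if $\mathsf{e}_j(0)=\mathsf{v}_i$ and $h_j(1)$ if $\mathsf{e}_j(1)=\mathsf{v}_i$; $u_j'(t,\mathsf{v}_i)=c_j(\mathsf{v}_i):=0$ if $j\notin\Gamma(\mathsf{v}_i)$. Primes denote $x$-derivatives. The constants $\mu_1,\dots,\mu_m$ are strictly positive; the weights $c_j\in H^1(0,1)$ are real-valued and (for the continuous representative) strictly positive on $[0,1]$. The weighted incidence matrices $\Phi_w^\pm=(\omega_{ij}^\pm)$ are: $\omega^+_{ij}=\mu_jc_j(0)$ if $\mathsf{e}_j(0)=\mathsf{v}_i$ and $0$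 otherwise; $\omega^-_{ij}=\mu_jc_j(1)$ if $\mathsf{e}_j(1)=\mathsf{v}_i$ and $0$ otherwise. $X_2:=\prod_{j=1}^m L^2(0,1;\mu_j dx)$ (complex-valued) with its natural inner product $\sum_j\int_0^1 f_j\overline{g_j}\mu_jdx$. For $f=(f_1,\dots,f_m)^\top$, $f(0)=(f_1(0),\dots,f_m(0))^\top$, and similarly $f(1),f'(0),f'(1)$. $V:=\{f\in (H^1(0,1))^m:\exists d\in\mathbb{C}^n \text{ s.t. } (\Phi^+)^\top d=f(0),\ (\Phi^-)^\top d=f(1)\}$, with the $H^1$-norm. On $X_2$ let $Af=((c_1f_1')',\dots,(c_mf_m')')^\top$ with $D(A)=\{f\in (H^2(0,1))^m\cap V:\Phi_w^+f'(0)=\Phi_w^-f'(1)\}$. The problem is identified with the abstract Cauchy problem $\ddot u(t)=Au(t)$, $t\in\mathbb{R}$, $u(0)=\mathsf{f}$, $\dot u(0)=\mathsf{g}$ in $X_2$. A mild solution is $u\in C(\mathbb{R};X_2)$ such that for all $t\in\mathbb{R}$, $\int_0^t(t-s)u(s)ds\in D(A)$ and $u(t)=\mathsf{f}+t\mathsf{g}+A\int_0^t(t-s)u(s)ds$. Continuous dependence means that for each $T>0$ the map $(\mathsf{f},\mathsf{g})\mapsto u$ is continuous from $V\times X_2$ to $C([-T,T];X_2)$. *)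

(* Defs.v *)
From HB Require Import structures.
From mathcomp Require Import all_boot all_order all_algebra.
From mathcomp Require Import complex.
From mathcomp Require Import all_classical all_reals all_analysis.
Set Implicit Arguments.
Unset Strict Implicit.
Unset Printing Implicit Defensive.
Import Order.TTheory GRing.Theory Num.Theory.
Import numFieldNormedType.Exports.
Local Open Scope classical_set_scope.
Local Open Scope ring_scope.
Local Open Scope complex_scope.

(* Vertices are 'I_n and edges are 'I_m; edge j runs from [e0 j], its endpoint
   at x = 0, to [e1 j], its endpoint at x = 1. *)
Record graph (n m : nat) := Graph { e0 : 'I_m -> 'I_n; e1 : 'I_m -> 'I_n }.

Section Graphs.
Variables (n m : nat) (G : graph n m).

Definition incident (i : 'I_n) (j : 'I_m) : bool := (e0 G j == i) || (e1 G j == i).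

Definition simple_graph : Prop :=
  (forall j, e0 G j != e1 G j) /\
  (forall j l, (e0 G j = e0 G l /\ e1 G j = e1 G l) \/
               (e0 G j = e1 G l /\ e1 G j = e0 G l) -> j = l).

Definition adjacent : rel 'I_n :=
  fun i k => [exists j, (i != k) && incident i j && incident k j].

Definition connected_graph : Prop :=
  (0 < n)%N /\ forall i k, connect adjacent i k.

Definition degree (i : 'I_n) : nat := #|[pred j | incident i j]|.

End Graphs.

(* Elements of Lebesgue and Sobolev spaces on (0,1) are represented by functions
   on R of which only the restriction to ]0,1[ matters; equality in these spaces
   is [ae01]. *)
Section RealSobolev.
Variable R : realType.
Implicit Types f g phi : R -> R.

Definition leb : {measure set (measurableTypeR R) -> \bar R} := lebesgue_measure.

Definition int01 f : R := Rintegral leb `]0, 1[ f.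

Definition ae01 (T : Type) (f g : R -> T) : Prop :=
  {ae leb, forall x, x \in `]0, 1[ -> f x = g x}.

Definition L2 f : Prop :=
  measurable_fun (`]0, 1[ : set (measurableTypeR R)) f /\
  leb.-integrable `]0, 1[ (fun x => (f x ^+ 2)%:E).

(* C_c^oo(0,1), each function being extended by 0 to R *)
Definition test_fun phi : Prop :=
  (forall k x, derivable (derive1n k phi) x 1) /\
  (exists a b, [/\ 0 < a, b < 1 & forall x, x \notin `[a, b] -> phi x = 0]).

Definition weak_derivative f g : Prop :=
  L2 g /\ forall phi, test_fun phi ->
    int01 (fun x => f x * derive1 phi x) = - int01 (fun x => g x * phi x).

(* junk value 0 when f has no weak derivative in L^2(0,1) *)
Definition wderiv f : R -> R := xget (cst 0) [set g | weak_derivative f g].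

Definition H1 f : Prop := L2 f /\ exists g, weak_derivative f g.

Definition H2 f : Prop := H1 f /\ H1 (wderiv f).

(* the representative of f that is continuous on [0,1], unique on [0,1];
   junk value f when there is none *)
Definition crep f : R -> R :=
  xget f [set g : R -> R | {within `[0, 1], continuous g} /\ ae01 f g].

(* C^oo[0,1]: all derivatives exist on ]0,1[ and extend continuously to [0,1] *)
Definition smooth01 f : Prop :=
  {within `[0, 1], continuous f} /\
  forall k, (forall x, x \in `]0, 1[ -> derivable (derive1n k f) x 1) /\
    (exists g : R -> R, {within `[0, 1], continuous g} /\
       forall x, x \in `]0, 1[ -> g x = derive1n k f x).

End RealSobolev.

Section ComplexSobolev.
Variable R : realType.
Implicit Types f g : R -> R[i].

Definition reim_prop (P : (R -> R) -> Prop) f : Prop :=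
  P (fun x => complex.Re (f x)) /\ P (fun x => complex.Im (f x)).

Definition reim_map (F : (R -> R) -> (R -> R)) f : R -> R[i] :=
  fun x => F (fun y => complex.Re (f y)) x +i* F (fun y => complex.Im (f y)) x.

Definition cint01 f : R[i] :=
  int01 (fun x => complex.Re (f x)) +i* int01 (fun x => complex.Im (f x)).

Definition cL2 : (R -> R[i]) -> Prop := reim_prop (@L2 R).
Definition cH1 : (R -> R[i]) -> Prop := reim_prop (@H1 R).
Definition cH2 : (R -> R[i]) -> Prop := reim_prop (@H2 R).
Definition ctest_fun : (R -> R[i]) -> Prop := reim_prop (@test_fun R).
Definition csmooth01 : (R -> R[i]) -> Prop := reim_prop (@smooth01 R).
Definition cwderiv : (R -> R[i]) -> (R -> R[i]) := reim_map (@wderiv R).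
Definition ccrep : (R -> R[i]) -> (R -> R[i]) := reim_map (@crep R).

End ComplexSobolev.

Section Network.
Variables (R : realType) (n m : nat).

Definition edge_fun := 'I_m -> R -> R[i].

Implicit Types (f g h w : edge_fun) (mu : 'I_m -> R) (c : 'I_m -> R -> R)
  (G : graph n m).

Definition Phi_plus G : 'M[R[i]]_(n, m) := \matrix_(i, j) (e0 G j == i)%:R.
Definition Phi_minus G : 'M[R[i]]_(n, m) := \matrix_(i, j) (e1 G j == i)%:R.

Definition Phi_w_plus G mu c : 'M[R[i]]_(n, m) :=
  \matrix_(i, j) if e0 G j == i then (mu j * c j 0)%:C else 0.
Definition Phi_w_minus G mu c : 'M[R[i]]_(n, m) :=
  \matrix_(i, j) if e1 G j == i then (mu j * c j 1)%:C else 0.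

Definition trace f (x : R) : 'cV[R[i]]_m := \col_j ccrep (f j) x.

Definition deriv_x f : edge_fun := fun j => cwderiv (f j).

Definition X2_eq f g : Prop := forall j, ae01 (f j) (g j).

Definition X2 f : Prop := forall j, cL2 (f j).

Definition X2_dot mu f g : R[i] :=
  \sum_j cint01 (fun x => f j x * (g j x)^* * (mu j)%:C).

Definition X2_norm mu f : R := Num.sqrt (complex.Re (X2_dot mu f f)).

Definition X2_sub f g : edge_fun := fun j x => f j x - g j x.

Definition V G f : Prop :=
  (forall j, cH1 (f j)) /\
  exists d : 'cV[R[i]]_n,
    (Phi_plus G)^T *m d = trace f 0 /\ (Phi_minus G)^T *m d = trace f 1.

Definition V_norm f : R :=
  Num.sqrt (X2_norm (fun=> 1) f ^+ 2 + X2_norm (fun=> 1) (deriv_x f) ^+ 2).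

Definition domA G mu c f : Prop :=
  [/\ forall j, cH2 (f j), V G f &
      Phi_w_plus G mu c *m trace (deriv_x f) 0 =
      Phi_w_minus G mu c *m trace (deriv_x f) 1].

Definition opA c f : edge_fun :=
  fun j => cwderiv (fun x => (c j x)%:C * cwderiv (f j) x).

Definition X2_continuous mu (u : R -> edge_fun) : Prop :=
  (forall t, X2 (u t)) /\
  forall t, X2_norm mu (X2_sub (u s) (u t)) @[s --> t] --> (0 : R).

(* X_2-valued Riemann integral over [a,b], a <= b. The partition points are
   a :: s and the tag of the k-th subinterval is xi k. *)
Definition is_X2_integral_le mu (v : R -> edge_fun) (a b : R) w : Prop :=
  X2 w /\
  forall eps : R, 0 < eps -> exists2 delta : R, 0 < delta &
    forall (s : seq R) (xi : nat -> R), itv_partition a b s ->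
      (forall k, (k < size s)%N ->
        [/\ nth b s k - nth b (a :: s) k < delta,
            nth b (a :: s) k <= xi k & xi k <= nth b s k]) ->
      X2_norm mu (X2_sub
        (fun j x => \sum_(k < size s)
           (nth b s k - nth b (a :: s) k)%:C * v (xi k) j x) w) < eps.

(* with the convention that the integral from a to b is minus the integral from
   b to a *)
Definition is_X2_integral mu (v : R -> edge_fun) (a b : R) w : Prop :=
  if a <= b then is_X2_integral_le mu v a b w
  else is_X2_integral_le mu v b a (fun j x => - w j x).

Definition mild_solution G mu c f g (u : R -> edge_fun) : Prop :=
  X2_continuous mu u /\
  forall t : R, exists w,
    [/\ is_X2_integral mu (fun s j x => (t - s)%:C * u s j x) 0 t w,
        domA G mu c w &
        X2_eq (u t) (fun j x => f j x + t%:C * g j x + opA c w j x)].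

(* the norm of C([-T,T]; X_2) *)
Definition CX2_norm mu (T : R) (u : R -> edge_fun) : \bar R :=
  ereal_sup [set (X2_norm mu (u t))%:E | t in `[- T, T]].

End Network.

(* Main.v *)
Require Import Defs.
From HB Require Import structures.
From mathcomp Require Import all_boot all_order all_algebra.
From mathcomp Require Import complex.
From mathcomp Require Import ring lra.
From mathcomp Require Import all_classical all_reals all_analysis.
From mathcomp Require Import measurable_realfun.
Set Implicit Arguments.
Unset Strict Implicit.
Unset Printing Implicit Defensive.
Import Order.TTheory GRing.Theory Num.Theory.
Import numFieldNormedType.Exports.
Local Open Scope classical_set_scope.
Local Open Scope ring_scope.

(** Real and imaginary parts solve the same problem, with real data, so that
    everything happens in the real space of square-integrable families of functions
    on the edges ([mild_part], [mild_join]).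

    On that space the operator [A w = (c w')'] of the network has the constants as its
    kernel, because the graph is connected, and [- A] can be inverted explicitly on
    families of mean zero. Integrating [- (c w')' = f - mean f] twice along each edge
    leaves one constant of the flux per edge and the values of [w] at the vertices. The
    values at the two ends of an edge determine the former, and Kirchhoff's condition
    turns into a weighted Laplace equation on the graph for the latter, solvable
    because the total mass of [f - mean f] is zero ([lap_solP], [res_netdom]). Green's
    formula shows that the resulting resolvent [K] is symmetric and nonnegative, and it
    is bounded ([green_res], [resX_bnd]). With [P] the projection on the constants, the
    relation [A w = h] amounts to [P h = 0] and [w - P w + K h = 0] ([netdom_resX],
    [domA_netdom], [netdom_domA]), so that being a mild solution is a condition on
    [K] and [P] alone.

    The wave equation is then solved in an abstract Hilbert space. Dividing [K] by a
    bound of its norm gives a positive contraction [C], for which [- A] is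
    [om ^ 2 / C]. A polynomial in [C] is bounded by its supremum on [0, 1]
    ([act_bound]), since a polynomial that is nonnegative there acts nonnegatively
    ([act_pos_ge0]). The function [cos (om t / sqrt r)] oscillates wildly at 0, but
    there are polynomials, bounded on [0, 1], whose distance to it is uniformly small after
    multiplication by [r] ([cos_approx]); the factor [r] is supplied by the range of [C], whose closure is the orthogonal
    complement of the kernel ([ker_orth_clo]). This gives an operator [Cos t] on that
    complement, with [|Cos t f| <= |f|], and its primitive [Sin t]. The scalar
    identity behind the second primitive of the cosine, applied to Riemann sums,
    shows that the second primitive of [Cos t f] is [- om ^ -2 C (Cos t f - f)]
    ([Cos_second]), which is the mild equation. Hence
    [u t = P f + t P g + Cos t (f - P f) + Sin t (g - P g)] is a mild solution
    ([wave_mild]). It is the only one by conservation of energy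
    ([second_primitive_unique]), and it depends continuously on the data because of
    the bounds of [Cos t] and [Sin t].

    As for regularity, [Cos t] and [Sin t] commute with [C]. Test functions with smooth
    weights are, up to constants, in the range of every power of [K], because [A] maps
    families vanishing near the vertices to such families ([Cinf0_range]). So the
    solution is in the range of every power of [K] up to constants
    ([net_mild_range]), and [K] gains two derivatives ([res_Cn]).

    The functions in [H1] are handled through their absolutely continuous
    representatives, the primitives of square-integrable functions. That a weak
    derivative comes from such a representative ([weak_derivative_abscont]) is the
    lemma of du Bois-Reymond, proved by testing against bumps. *)

(** * Integration on the unit interval *)
Section Integration.
Variable R : realType.
Implicit Types (f g h : R -> R) (a b x y : R).

Local Notation mR := (measurableTypeR R).
Local Notation I01 := (`]0, 1[%classic : set mR).

Definition meas01 f := measurable_fun I01 (f : mR -> R).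
Definition int1 f : Prop := (leb R).-integrable I01 (fun x : mR => (f x)%:E).

Lemma measurable_I01 : measurable I01.
Proof. exact: measurable_itv. Qed.
Hint Resolve measurable_I01 : core.

Lemma leb_I01 : leb R I01 = 1%:E.
Proof.
have := lebesgue_measure_itv (`]0, 1[ : interval R).
by rewrite /= lte_fin ltr01 oppr0 adde0.
Qed.

#[global] Instance leb_ae_filter : Filter (nbhs (almost_everywhere (leb R))).
Proof. exact: ae_filter_ringOfSetsType. Qed.

Lemma ae01_refl (T : Type) (f : R -> T) : ae01 f f.
Proof. by apply: aeW. Qed.

Lemma ae01_sym (T : Type) (f g : R -> T) : ae01 f g -> ae01 g f.
Proof. by apply: filterS => x fg /fg. Qed.

Lemma ae01_trans (T : Type) (f g h : R -> T) : ae01 f g -> ae01 g h -> ae01 f h.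
Proof. by apply: filterS2 => x fg gh xI; rewrite fg// gh. Qed.

Lemma ae01_in (T : Type) (f g : R -> T) :
  (forall x, 0 < x < 1 -> f x = g x) -> ae01 f g.
Proof. by move=> fg; apply: aeW => x; rewrite in_itv/=; exact: fg. Qed.

Lemma ae01_map2 (T U W : Type) (op : T -> U -> W) (f f' : R -> T)
    (g g' : R -> U) : ae01 f f' -> ae01 g g' ->
  ae01 (fun x => op (f x) (g x)) (fun x => op (f' x) (g' x)).
Proof. by apply: filterS2 => x fg gh xI; rewrite fg// gh. Qed.

Lemma ae01_map (T W : Type) (op : T -> W) (f f' : R -> T) : ae01 f f' ->
  ae01 (fun x => op (f x)) (fun x => op (f' x)).
Proof. by apply: filterS => x fg xI; rewrite fg. Qed.

Lemma meas01D f g : meas01 f -> meas01 g -> meas01 (fun x => f x + g x).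
Proof. exact: measurable_funD. Qed.

Lemma meas01M f g : meas01 f -> meas01 g -> meas01 (fun x => f x * g x).
Proof. exact: measurable_funM. Qed.

Lemma meas01_cst a : meas01 (fun _ => a).
Proof. exact: measurable_cst. Qed.

Lemma meas01_in f g : (forall x, 0 < x < 1 -> f x = g x) -> meas01 f -> meas01 g.
Proof.
move=> fg; apply: eq_measurable_fun => x; rewrite inE/= in_itv/=; exact: fg.
Qed.

Lemma int1_meas f : int1 f -> meas01 f.
Proof. by move=> /measurable_int/measurable_EFinP. Qed.

Lemma int1_in f g : (forall x, 0 < x < 1 -> f x = g x) -> int1 f -> int1 g.
Proof.
move=> fg; apply: eq_integrable => // x; rewrite inE/= in_itv/= => x01.
by rewrite fg.
Qed.

Lemma int1_le f g : meas01 f -> (forall x, 0 < x < 1 -> `|f x| <= `|g x|) ->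
  int1 g -> int1 f.
Proof.
move=> mf fg; apply: le_integrable => //; exact/measurable_EFinP.
Qed.

Lemma int1D f g : int1 f -> int1 g -> int1 (fun x => f x + g x).
Proof. by move=> fi gi; exact: (integrableD measurable_I01 fi gi). Qed.

Lemma int1Z a f : int1 f -> int1 (fun x => a * f x).
Proof. by move=> fi; exact: (integrableZl measurable_I01 a fi). Qed.

Lemma int1N f : int1 f -> int1 (fun x => - f x).
Proof. by move=> /(int1Z (-1)); apply: int1_in => x _; rewrite mulN1r. Qed.

Lemma int1_norm f : int1 f -> int1 (fun x => `|f x|).
Proof. by move=> fi; exact: (integrable_norm fi). Qed.

Lemma int1_cst a : int1 (fun _ => a).
Proof.
apply: measurable_bounded_integrable => //; first by rewrite leb_I01 ltry.
by exists `|a|; split => // b ab y _; apply: ltW.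
Qed.

Lemma int1_bnd f (M : R) : meas01 f -> (forall x, 0 < x < 1 -> `|f x| <= M) -> int1 f.
Proof.
move=> mf fM; apply: (int1_le mf _ (int1_cst M)) => x /fM /le_trans; apply.
exact: ler_norm.
Qed.

Lemma int1_ae f g : meas01 g -> ae01 f g -> int1 f -> int1 g.
Proof.
move=> mg fg fi; apply/integrableP; split; first exact/measurable_EFinP.
move/integrableP: (fi) => [mf]; congr (_ < _)%E; apply: ae_eq_integral => //.
- exact: measurableT_comp.
- by apply: measurableT_comp => //; exact/measurable_EFinP.
by apply: filterS fg => x fg xI; rewrite /= fg.
Qed.

Lemma int1_bndM f g (M : R) : meas01 f -> (forall x, 0 < x < 1 -> `|f x| <= M) ->
  int1 g -> int1 (fun x => f x * g x).
Proof.
move=> mf fM ig; apply: (@int1_le _ (fun x => M * g x)).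
- by apply: meas01M => //; exact: int1_meas.
- move=> x x01; rewrite !normrM ler_wpM2r//.
  by apply: le_trans (fM _ x01) _; exact: ler_norm.
- exact: int1Z.
Qed.

Lemma int01D f g : int1 f -> int1 g ->
  int01 (fun x => f x + g x) = int01 f + int01 g.
Proof. exact: RintegralD. Qed.

Lemma int01B f g : int1 f -> int1 g ->
  int01 (fun x => f x - g x) = int01 f - int01 g.
Proof. exact: RintegralB. Qed.

Lemma int01Z a f : int1 f -> int01 (fun x => a * f x) = a * int01 f.
Proof. by move=> fi; apply: RintegralZl. Qed.

Lemma int01N f : int1 f -> int01 (fun x => - f x) = - int01 f.
Proof.
by move=> fi; rewrite -mulN1r -int01Z//; congr int01; apply/funext => x; rewrite mulN1r.
Qed.

Lemma int01_cst a : int01 (fun _ => a) = a.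
Proof. by rewrite /int01 Rintegral_cst// leb_I01 mulr1. Qed.

Lemma int01_in f g : (forall x, 0 < x < 1 -> f x = g x) -> int01 f = int01 g.
Proof.
by move=> fg; apply: eq_Rintegral => x; rewrite inE/= in_itv/=; exact: fg.
Qed.

Lemma int01_ae f g : meas01 f -> meas01 g -> ae01 f g -> int01 f = int01 g.
Proof.
move=> mf mg fg; congr fine; apply: ae_eq_integral => //.
- exact/measurable_EFinP.
- exact/measurable_EFinP.
by apply: filterS fg => x fg xI; rewrite fg.
Qed.

Lemma int01_le f g : int1 f -> int1 g -> (forall x, 0 < x < 1 -> f x <= g x) ->
  int01 f <= int01 g.
Proof.
by move=> fi gi fg; apply: le_Rintegral => // x; rewrite /= in_itv/=; exact: fg.
Qed.

Lemma int01_ge0 f : (forall x, 0 < x < 1 -> 0 <= f x) -> 0 <= int01 f.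
Proof. by move=> f0; apply: Rintegral_ge0 => x; rewrite /= in_itv/=; exact: f0. Qed.

Lemma int01_norm f : int1 f -> `|int01 f| <= int01 (fun x => `|f x|).
Proof. exact: le_normr_Rintegral. Qed.

Lemma int01_eq0 f : int1 f -> (forall x, 0 < x < 1 -> 0 <= f x) ->
  int01 f = 0 -> ae01 f (fun=> 0).
Proof.
move=> fi f0 If; have mf : measurable_fun I01 (EFin \o f : mR -> \bar R).
  by apply/measurable_EFinP; exact: int1_meas.
have [+ _] := ae_eq_integral_abs (leb R) measurable_I01 mf.
have -> : (\int[leb R]_(x in I01) `|(EFin \o f) x| = (int01 f)%:E)%E.
  rewrite /int01 /Rintegral fineK; last exact: integrable_fin_num.
  apply: eq_integral => x; rewrite inE/= in_itv/= => /f0 fx0.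
  by rewrite ger0_norm.
rewrite If => /(_ erefl); apply: filterS => x H xI.
by have := H xI => -[].
Qed.

(** ** Square-integrable functions *)

Lemma L2_meas f : L2 f -> meas01 f. Proof. by case. Qed.

Lemma L2_sqr f : L2 f -> int1 (fun x => f x ^+ 2). Proof. by case. Qed.

Lemma L2M f g : L2 f -> L2 g -> int1 (fun x => f x * g x).
Proof.
move=> Lf Lg; apply: (@int1_le _ (fun x => f x ^+ 2 + g x ^+ 2)).
- by apply: meas01M; exact: L2_meas.
- move=> x _; rewrite (ger0_norm (addr_ge0 _ _)) ?sqr_ge0// normrM.
  rewrite -(real_normK (num_real (f x))) -(real_normK (num_real (g x))).
  by have := sqr_ge0 (`|f x| - `|g x|); have := mulr_ge0 (normr_ge0 (f x)) (normr_ge0 (g x)); nra.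
- by apply: int1D; exact: L2_sqr.
Qed.

Lemma L2_in f g : (forall x, 0 < x < 1 -> f x = g x) -> L2 f -> L2 g.
Proof.
move=> fg [mf sf]; split; first exact: meas01_in fg mf.
by apply: int1_in sf => x /fg ->.
Qed.

Lemma L2_ae f g : meas01 g -> ae01 f g -> L2 f -> L2 g.
Proof.
move=> mg fg [mf sf]; split => //; apply: int1_ae sf; first exact: meas01M.
exact: (ae01_map (fun y : R => y ^+ 2) fg).
Qed.

Lemma L2_bnd f (M : R) : meas01 f -> (forall x, 0 < x < 1 -> `|f x| <= M) -> L2 f.
Proof.
move=> mf fM; split => //; apply: (@int1_bnd _ (M ^+ 2)); first exact: meas01M.
by move=> x /fM fxM; rewrite normrX; apply: lerXn2r => //; rewrite ?nnegrE ?(le_trans _ fxM).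
Qed.

Lemma L2_cst a : L2 (fun=> a).
Proof. exact: (@L2_bnd _ `|a| (meas01_cst a)). Qed.

Lemma L2_int1 f : L2 f -> int1 f.
Proof.
by move=> Lf; apply: int1_in (L2M Lf (L2_cst 1)) => x _; rewrite mulr1.
Qed.

Lemma L2Z a f : L2 f -> L2 (fun x => a * f x).
Proof.
move=> [mf sf]; split; first by apply: meas01M => //; exact: meas01_cst.
by apply: int1_in (int1Z (a ^+ 2) sf) => x _; rewrite exprMn.
Qed.

Lemma L2N f : L2 f -> L2 (fun x => - f x).
Proof. by move=> /(L2Z (-1)); apply: L2_in => x _; rewrite mulN1r. Qed.

Lemma L2D f g : L2 f -> L2 g -> L2 (fun x => f x + g x).
Proof.
move=> Lf Lg; split; first by apply: meas01D; exact: L2_meas.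
apply: int1_in (int1D (L2_sqr Lf) (int1D (int1Z 2 (L2M Lf Lg)) (L2_sqr Lg))).
by move=> x _; ring.
Qed.

Lemma L2B f g : L2 f -> L2 g -> L2 (fun x => f x - g x).
Proof. by move=> Lf Lg; apply: L2D => //; exact: L2N. Qed.

Lemma L2_bndM f g (M : R) : meas01 f -> (forall x, 0 < x < 1 -> `|f x| <= M) ->
  L2 g -> L2 (fun x => f x * g x).
Proof.
move=> mf fM [mg sg]; split; first exact: meas01M.
apply: int1_in (@int1_bndM _ _ (M ^+ 2) (meas01M mf mf) _ sg).
  by move=> x _ /=; ring.
move=> x /fM fxM; rewrite normrM expr2; apply: ler_pM => //.
Qed.

Lemma L2_sum (I : Type) (s : seq I) (P : pred I) (F : I -> R -> R) :
  (forall i, L2 (F i)) -> L2 (fun x => \sum_(i <- s | P i) F i x).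
Proof.
move=> iF; elim: s => [|i s IH].
  by apply: L2_in (L2_cst 0) => x _; rewrite big_nil.
case Pi : (P i).
  by apply: L2_in (L2D (iF i) IH) => x _; rewrite big_cons Pi.
by apply: L2_in IH => x _; rewrite big_cons Pi.
Qed.

Lemma cont01_meas f : {within `[0, 1], continuous f} -> meas01 f.
Proof.
move=> cf; apply: subspace_continuous_measurable_fun => //.
by apply: continuous_subspaceW cf => x; rewrite /= !in_itv/= => /andP[/ltW -> /ltW].
Qed.

Lemma cont01_bnd f : {within `[0, 1], continuous f} ->
  exists2 M : R, 0 < M & forall x, 0 <= x <= 1 -> `|f x| <= M.
Proof.
move=> cf; have cnf : {within `[0, 1], continuous (fun x => `|f x|)}.
  by move=> x; apply: continuous_comp; [exact: cf|exact: norm_continuous].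
have [c _ fc] := EVT_max ler01 cnf.
exists (`|f c| + 1) => [|x x01]; first by rewrite ltr_wpDl.
by apply: ler_wpDr => //; apply: fc; rewrite in_itv.
Qed.

Lemma cont01_L2 f : {within `[0, 1], continuous f} -> L2 f.
Proof.
move=> cf; have [M _ fM] := cont01_bnd cf.
by apply: (@L2_bnd _ M (cont01_meas cf)) => x /andP[/ltW x0 /ltW x1]; rewrite fM ?x0.
Qed.

Lemma cont01_L2M f g : {within `[0, 1], continuous f} -> L2 g ->
  L2 (fun x => f x * g x).
Proof.
move=> cf; have [M _ fM] := cont01_bnd cf.
by apply: (@L2_bndM _ _ M (cont01_meas cf)) => x /andP[/ltW x0 /ltW x1]; rewrite fM ?x0.
Qed.

(** The Cauchy-Schwarz inequality, from the sign of the discriminant. *)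
Lemma int01_CS f g : L2 f -> L2 g ->
  int01 (fun x => f x * g x) ^+ 2 <=
  int01 (fun x => f x ^+ 2) * int01 (fun x => g x ^+ 2).
Proof.
move=> Lf Lg; set p := int01 (fun x => _ * _); set a := int01 _; set b := int01 _.
have H t : 0 <= a + t * (2 * p) + t ^+ 2 * b.
  have <- : int01 (fun x => (f x + t * g x) ^+ 2) = a + t * (2 * p) + t ^+ 2 * b.
    have i1 := L2_sqr Lf; have i2 := int1Z (2 * t) (L2M Lf Lg).
    have i3 := int1Z (t ^+ 2) (L2_sqr Lg).
    transitivity (int01 (fun x =>
        f x ^+ 2 + ((2 * t) * (f x * g x) + t ^+ 2 * g x ^+ 2))).
      by apply: int01_in => x _; ring.
    rewrite (int01D i1 (int1D i2 i3)) (int01D i2 i3).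
    rewrite (int01Z (2 * t) (L2M Lf Lg)) (int01Z (t ^+ 2) (L2_sqr Lg)).
    by rewrite -/a -/b -/p; ring.
  by apply: int01_ge0 => x _; exact: sqr_ge0.
have b0 : 0 <= b by apply: int01_ge0 => x _; exact: sqr_ge0.
move: b0; rewrite le_eqVlt => /predU1P[b0|b0]; last first.
  have := H (- p / b); rewrite expr_div_n sqrrN.
  have -> : a + - p / b * (2 * p) + p ^+ 2 / b ^+ 2 * b = a - p ^+ 2 / b.
    by field; exact: lt0r_neq0.
  by rewrite subr_ge0 ler_pdivrMr.
rewrite -b0 mulr0; have [->|p0] := eqVneq p 0; first by rewrite expr0n.
have := H (- (a + 1) / (2 * p)); rewrite -b0 mulr0 addr0.
have -> : a + - (a + 1) / (2 * p) * (2 * p) = - 1 by field.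
by rewrite ler0N1.
Qed.

End Integration.

#[local] Hint Resolve measurable_I01 : core.

(** * Absolutely continuous functions on the unit interval *)
Section AbsolutelyContinuous.
Variable R : realType.
Implicit Types (f g h F G : R -> R) (a b x y : R).

Local Notation mR := (measurableTypeR R).
Local Notation I01 := (`]0, 1[%classic : set mR).

Definition prim h x := int01 (fun y => h y * (y < x)%R%:R).

Lemma meas01_lt x : meas01 (fun y : R => (y < x)%R%:R : R).
Proof.
have -> : (fun y : R => (y < x)%R%:R : R) = \1_(`]-oo, x[ : set mR).
  by apply/funext => y; rewrite indicE mem_setE in_itv.
exact: measurable_indic.
Qed.

Lemma meas01_gt x : meas01 (fun y : R => (x < y)%R%:R : R).
Proof.
have -> : (fun y : R => (x < y)%R%:R : R) = \1_(`]x, +oo[ : set mR).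
  by apply/funext => y; rewrite indicE mem_setE in_itv/= andbT.
exact: measurable_indic.
Qed.

Lemma normr_bool (b : bool) : `|b%:R : R| <= 1.
Proof. by case: b; rewrite ?normr1 ?normr0. Qed.

Lemma int1_lt h x : int1 h -> int1 (fun y => h y * (y < x)%R%:R).
Proof.
move=> ih; apply: int1_in (int1_bndM (meas01_lt x) (fun y _ => normr_bool (y < x)) ih).
by move=> y _; rewrite mulrC.
Qed.

Lemma int1_gt h x : int1 h -> int1 (fun y => h y * (x < y)%R%:R).
Proof.
move=> ih; apply: int1_in (int1_bndM (meas01_gt x) (fun y _ => normr_bool (x < y)) ih).
by move=> y _; rewrite mulrC.
Qed.

Lemma L2_lt h x : L2 h -> L2 (fun y => h y * (y < x)%R%:R).
Proof.
move=> ih; apply: L2_in (L2_bndM (meas01_lt x) (fun y _ => normr_bool (y < x)) ih).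
by move=> y _; rewrite mulrC.
Qed.

Lemma primD f g x : int1 f -> int1 g ->
  prim (fun y => f y + g y) x = prim f x + prim g x.
Proof.
move=> fi gi; rewrite /prim -int01D; [|exact: int1_lt|exact: int1_lt].
by apply: int01_in => y _; rewrite mulrDl.
Qed.

Lemma primZ a f x : int1 f -> prim (fun y => a * f y) x = a * prim f x.
Proof.
move=> fi; rewrite /prim -int01Z; last exact: int1_lt.
by apply: int01_in => y _; rewrite mulrA.
Qed.

Lemma primN f x : int1 f -> prim (fun y => - f y) x = - prim f x.
Proof.
move=> fi; rewrite -mulN1r -primZ//; congr prim; apply/funext => y.
by rewrite mulN1r.
Qed.

Lemma primB f g x : int1 f -> int1 g ->
  prim (fun y => f y - g y) x = prim f x - prim g x.
Proof. by move=> fi gi; rewrite primD ?primN//; exact: int1N. Qed.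

Lemma prim_in f g x : (forall y, 0 < y < 1 -> y < x -> f y = g y) -> prim f x = prim g x.
Proof.
move=> fg; apply: int01_in => y y01; have [yx|_] := boolP (y < x).
  by rewrite fg.
by rewrite !mulr0.
Qed.

Lemma prim_ae f g x : meas01 f -> meas01 g -> ae01 f g -> prim f x = prim g x.
Proof.
move=> mf mg fg; apply: int01_ae; [| |].
- by apply: meas01M => //; exact: meas01_lt.
- by apply: meas01M => //; exact: meas01_lt.
- exact: (ae01_map2 (fun u v : R => u * v) fg (ae01_refl _)).
Qed.

Lemma prim0 h : prim h 0 = 0.
Proof.
rewrite -[RHS]int01_cst; apply: int01_in => y /andP[y0 _].
by rewrite ltNge ltW// mulr0.
Qed.

Lemma prim1 h : prim h 1 = int01 h.
Proof. by apply: int01_in => y /andP[_ y1]; rewrite y1 mulr1. Qed.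

Lemma prim_norm h x : int1 h -> `|prim h x| <= int01 (fun y => `|h y|).
Proof.
move=> ih; apply: le_trans (int01_norm (int1_lt x ih)) _.
apply: int01_le; [exact/int1_norm/int1_lt|exact: int1_norm|move=> y _].
by rewrite normrM ler_piMr ?normr_bool.
Qed.

Lemma prim_cst a x : 0 <= x <= 1 -> prim (fun=> a) x = a * x.
Proof.
move=> /andP[x0 x1]; have Ex : fine (leb R (`]0, x[%classic : set mR)) = x.
  have := lebesgue_measure_itv (`]0, x[ : interval R); rewrite /= lte_fin oppr0 adde0.
  move=> ->; case: ltP => //= x0'; apply/eqP; by rewrite eq_le x0 x0'.
rewrite -[in RHS]Ex.
have mI : measurable (`]0, x[%classic : set mR) by exact: measurable_itv.
rewrite -(Rintegral_cst _ mI).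
rewrite /prim /int01 [LHS]Rintegral_mkcond [RHS]Rintegral_mkcond.
apply: eq_Rintegral => y _; rewrite !patchE !mem_setE !in_itv/=.
case: (0 < y) => //=; have [yx|yx] := ltP y x; last by rewrite mulr0; case: ifP.
by rewrite mulr1 (lt_le_trans yx x1).
Qed.

(** The Cauchy-Schwarz inequality against the indicator of [[x, y[]; this modulus of
    continuity controls primitives up to the end points. *)
Lemma prim_holder h x y : L2 h -> 0 <= x <= 1 -> 0 <= y <= 1 ->
  (prim h y - prim h x) ^+ 2 <= int01 (fun z => h z ^+ 2) * `|y - x|.
Proof.
move=> Lh; wlog xy : x y / x <= y => [H x01 y01|x01 y01].
  have [xy|/ltW yx] := leP x y; first exact: H.
  by rewrite -sqrrN opprB distrC; exact: H.
pose k (z : R) : R := (z < y)%R%:R - (z < x)%R%:R.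
have Lk : L2 k.
  apply: (@L2_bnd _ _ 2); first apply: meas01D; [exact: meas01_lt| |move=> z _].
    apply: meas01_in (meas01M (meas01_cst (-1)) (meas01_lt x)) => z _.
    by rewrite mulN1r.
  by rewrite (le_trans (ler_normB _ _))// -[2]/(1 + 1) lerD// normr_bool.
have -> : prim h y - prim h x = int01 (fun z => h z * k z).
  rewrite -int01B; [|exact/int1_lt/L2_int1|exact/int1_lt/L2_int1].
  by apply: int01_in => z _; rewrite mulrBr.
apply: le_trans (int01_CS Lh Lk) _; rewrite ler_wpM2l//.
  by apply: int01_ge0 => z _; exact: sqr_ge0.
rewrite ger0_norm ?subr_ge0// -[y]mul1r -[x]mul1r -!prim_cst//.
rewrite -int01B; [|exact/int1_lt/int1_cst|exact/int1_lt/int1_cst].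
rewrite le_eqVlt; apply/orP; left; apply/eqP/int01_in => z _; rewrite !mul1r /k.
have [zx|xz] := ltP z x; first by rewrite (lt_le_trans zx xy) subrr expr0n.
by rewrite subr0; case: (z < y); rewrite ?expr1n ?expr0n.
Qed.

Lemma holder_cont01 F C :
  (forall x y, 0 <= x <= 1 -> 0 <= y <= 1 -> (F y - F x) ^+ 2 <= C * `|y - x|) ->
  {within `[0, 1], continuous F}.
Proof.
move=> HF; have C0 : 0 <= C.
  have := HF 0 1; rewrite !lexx ler01 subr0 normr1 mulr1 => /(_ isT isT).
  by apply: le_trans; exact: sqr_ge0.
apply/continuous_within_itvP => //.
have key x : 0 <= x <= 1 -> forall e : R, 0 < e -> exists2 d : R, 0 < d &
    forall y, 0 <= y <= 1 -> `|x - y| < d -> `|F x - F y| <= e.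
  move=> x01 e e0; exists (e ^+ 2 / (C + 1)).
    by rewrite divr_gt0// ?exprn_gt0// ltr_wpDl.
  move=> y y01 xyd; have := HF _ _ y01 x01.
  rewrite ltr_pdivlMr in xyd; last by rewrite ltr_wpDl.
  move=> H; rewrite -(@ler_pXn2r _ 2) ?nnegrE//; last exact: ltW.
  rewrite real_normK ?num_real//; apply: le_trans H _.
  by have := normr_ge0 (x - y); nra.
split.
- move=> x; rewrite in_itv/= => /andP[x0 x1]; apply/cvgrPdist_le => e e0.
  have [|d d0 H] := key x _ e e0; first by rewrite !ltW.
  near=> y; apply: H.
    apply/andP; split; apply/ltW; near: y.
      exact: lt_nbhsr.
    exact: lt_nbhsl.
  by near: y; apply: cvgr_dist_lt.
- apply/cvgrPdist_le => e e0; have [|d d0 H] := key 0 _ e e0; first by rewrite lexx ler01.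
  near=> y; apply: H.
    apply/andP; split; apply/ltW; near: y; first exact: nbhs_right_gt.
    exact: nbhs_right_lt.
  rewrite sub0r normrN gtr0_norm; first by near: y; exact: nbhs_right_lt.
  by near: y; exact: nbhs_right_gt.
- apply/cvgrPdist_le => e e0; have [|d d0 H] := key 1 _ e e0; first by rewrite lexx ler01.
  near=> y; apply: H.
    apply/andP; split; apply/ltW; near: y; last exact: nbhs_left_lt.
    exact: nbhs_left_gt.
  rewrite gtr0_norm; last by rewrite subr_gt0; near: y; exact: nbhs_left_lt.
  rewrite ltrBlDr addrC -ltrBlDr; near: y; apply: nbhs_left_gt.
  by rewrite ltrBlDr ltrDl.
Unshelve. all: by end_near. Qed.

Lemma prim_cont h : L2 h -> {within `[0, 1], continuous (prim h)}.
Proof. by move=> Lh; apply: holder_cont01 => x y x01 y01; exact: prim_holder. Qed.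

Definition abscont F f := L2 f /\ forall x, 0 <= x <= 1 -> F x = F 0 + prim f x.

Lemma AC_L2 F f : abscont F f -> L2 f. Proof. by case. Qed.

Lemma AC_cont F f : abscont F f -> {within `[0, 1], continuous F}.
Proof.
move=> [Lf HF]; apply: holder_cont01 => x y x01 y01.
by rewrite (HF _ x01) (HF _ y01) opprD addrACA subrr add0r; exact: prim_holder.
Qed.

Lemma AC_prim h : L2 h -> abscont (prim h) h.
Proof. by move=> Lh; split=> // x _; rewrite prim0 add0r. Qed.

Lemma AC_cst a : abscont (fun=> a) (fun=> 0).
Proof.
split=> [|x x01]; first exact: L2_cst.
by rewrite prim_cst// mul0r addr0.
Qed.

Lemma ACD F f G g : abscont F f -> abscont G g ->
  abscont (fun x => F x + G x) (fun x => f x + g x).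
Proof.
move=> [Lf HF] [Lg HG]; split=> [|x x01]; first exact: L2D.
rewrite primD; [|exact: L2_int1|exact: L2_int1].
by rewrite (HF _ x01) (HG _ x01) addrACA.
Qed.

Lemma ACN F f : abscont F f -> abscont (fun x => - F x) (fun x => - f x).
Proof.
move=> [Lf HF]; split=> [|x x01]; first exact: L2N.
by rewrite primN ?(HF _ x01) ?opprD//; exact: L2_int1.
Qed.

Lemma ACB F f G g : abscont F f -> abscont G g ->
  abscont (fun x => F x - G x) (fun x => f x - g x).
Proof. by move=> HF HG; exact: ACD HF (ACN HG). Qed.

Lemma AC_eq F G f : (forall x, 0 <= x <= 1 -> F x = G x) -> abscont F f -> abscont G f.
Proof.
move=> FG [Lf HF]; split=> // x x01.
by rewrite -(FG x)// -(FG 0) ?lexx ?ler01// HF.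
Qed.

Lemma AC_ae F f g : meas01 g -> ae01 f g -> abscont F f -> abscont F g.
Proof.
move=> mg fg [Lf HF]; split=> [|x x01]; first exact: L2_ae mg fg Lf.
by rewrite HF//; congr (_ + _); apply: prim_ae => //; exact: L2_meas.
Qed.

Lemma ae01_neq y : {ae leb R, forall x, x != y}.
Proof.
exists [set y]; split; [exact: measurable_set1|exact: lebesgue_measure_set1|].
by move=> x /= /negP; rewrite negbK => /eqP.
Qed.

Lemma int01_gt f y : int1 f ->
  int01 (fun x => f x * (y < x)%R%:R) = int01 f - prim f y.
Proof.
move=> fi; rewrite -int01B//; last exact: int1_lt.
apply: int01_ae.
- by apply: int1_meas; exact: int1_gt.
- by apply: int1_meas; apply: int1D => //; apply: int1N; exact: int1_lt.
apply: filterS (ae01_neq y) => x xy _; case: ltgtP xy => //= _ _.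
  by rewrite mulr1 mulr0 subr0.
by rewrite mulr0 mulr1 subrr.
Qed.

Lemma int01E f : int1 f ->
  (\int[leb R]_(x in setT) ((f \_ I01) x)%:E = (int01 f)%:E)%E.
Proof.
move=> fi; rewrite /int01 /Rintegral fineK; last exact: integrable_fin_num.
by rewrite [RHS]integral_mkcond; apply: eq_integral => x _; rewrite restrict_EFin.
Qed.

Let tri f g (z : mR * mR) : R :=
  (f \_ I01) z.1 * ((g \_ I01) z.2 * (z.2 < z.1)%R%:R).

Let tri_iint f g : L2 f -> L2 g ->
  (\int[leb R]_x \int[leb R]_y (tri f g (x, y))%:E
   = (int01 (fun x => f x * prim g x)%R)%:E)%E.
Proof.
move=> Lf Lg; rewrite -int01E; last first.
  apply: int1_in (L2_int1 (cont01_L2M (prim_cont Lg) Lf)) => x _.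
  by rewrite mulrC.
apply: eq_integral => x _.
have -> : (((fun x => f x * prim g x) \_ I01) x = (f \_ I01) x * prim g x)%R.
  by rewrite !patchE; case: ifP => // _; rewrite mul0r.
rewrite -(int01Z _ (int1_lt x (L2_int1 Lg))) -int01E; last first.
  exact: int1Z (int1_lt x (L2_int1 Lg)).
apply: eq_integral => y _; congr EFin; rewrite /tri /= !patchE.
by case: (y \in I01) => //; rewrite mul0r mulr0.
Qed.

(** Fubini over the triangle [y < x]: this is the whole content of integration
    by parts for absolutely continuous functions. *)
Lemma int01_triangle f g : L2 f -> L2 g ->
  int01 (fun x => f x * prim g x) =
  int01 (fun y => g y * (int01 f - prim f y)).
Proof.
move=> Lf Lg; have mD := @measurable_I01 R.
have mres h : L2 h -> measurable_fun setT (h \_ I01 : mR -> R).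
  by move=> Lh; apply/(measurable_restrictT _ mD); exact: L2_meas.
have mT : measurable [set z : mR * mR | (z.2 < z.1)%R].
  have m1 : measurable_fun setT (EFin \o (fun z : mR * mR => z.1 : R)).
    by apply/measurable_EFinP; exact: measurable_fst.
  have m2 : measurable_fun setT (EFin \o (fun z : mR * mR => z.2 : R)).
    by apply/measurable_EFinP; exact: measurable_snd.
  have := measurable_lte measurableT m2 m1; rewrite setTI.
  by under eq_set do rewrite lte_fin.
have mtri u v : L2 u -> L2 v -> measurable_fun setT (EFin \o tri u v).
  move=> Lu Lv; apply/measurable_EFinP; apply: measurable_funM.
    exact: (measurableT_comp (mres _ Lu) measurable_fst).
  apply: measurable_funM.
    exact: (measurableT_comp (mres _ Lv) measurable_snd).
  have -> : (fun z : mR * mR => (z.2 < z.1)%R%:R : R)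
      = \1_([set z : mR * mR | (z.2 < z.1)%R]).
    by apply/funext => z; rewrite indicE mem_setE.
  exact: measurable_indic.
have Labs u : L2 u -> L2 (fun x => `|u x|).
  move=> [mu su]; split; first exact: measurableT_comp.
  by apply: int1_in su => x _; rewrite real_normK ?num_real.
have it : ((leb R) \x (leb R))%E.-integrable setT (EFin \o tri f g).
  apply/(@integrable12ltyP _ _ _ _ _ (@lebesgue_measure R) (@lebesgue_measure R)).
    exact: mtri.
  rewrite (_ : (\int[_]_x _)%E = (int01 (fun x => `|f x| * prim (fun y => `|g y|) x)%R)%:E).
    exact: ltry.
  rewrite -(tri_iint (Labs _ Lf) (Labs _ Lg)); apply: eq_integral => x _.
  apply: eq_integral => y _; congr EFin; rewrite /tri /= !patchE !normrM.
  rewrite (ger0_norm (ler0n _ _)).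
  by case: ifP => _; case: ifP => _; rewrite ?normr0.
have := @Fubini _ _ _ _ _ (@lebesgue_measure R) (@lebesgue_measure R) _ it.
have -> : (\int[lebesgue_measure]_x \int[lebesgue_measure]_y (EFin \o tri f g) (x, y)
  = (int01 (fun x => f x * prim g x)%R)%:E)%E by exact: tri_iint.
have ig : int1 (fun y => g y * (int01 f - prim f y)).
  apply: L2_int1; apply: L2_in (cont01_L2M (AC_cont (ACB (AC_cst (int01 f))
    (AC_prim Lf))) Lg) => y _; exact: mulrC.
have -> : (\int[lebesgue_measure]_y \int[lebesgue_measure]_x (EFin \o tri f g) (x, y)
  = (int01 (fun y => g y * (int01 f - prim f y))%R)%:E)%E.
  rewrite -int01E//; apply: eq_integral => y _.
  have -> : (((fun y => g y * (int01 f - prim f y)) \_ I01) y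
      = (g \_ I01) y * (int01 f - prim f y))%R.
    by rewrite !patchE; case: ifP => // _; rewrite mul0r.
  rewrite -int01_gt; last exact: L2_int1.
  rewrite -(int01Z _ (int1_gt y (L2_int1 Lf))) -int01E; last first.
    exact: int1Z (int1_gt y (L2_int1 Lf)).
  apply: eq_integral => x _; congr EFin; rewrite /tri /= !patchE.
  by case: (x \in I01) => //; rewrite ?mul0r// mulrCA.
by case.
Qed.

Lemma int01_by_parts f g : L2 f -> L2 g ->
  int01 (fun x => f x * prim g x + prim f x * g x) = int01 f * int01 g.
Proof.
move=> Lf Lg.
have ifg : int1 (fun x => f x * prim g x).
  apply: int1_in (L2_int1 (cont01_L2M (prim_cont Lg) Lf)) => x _; exact: mulrC.
have igf : int1 (fun x => prim f x * g x).
  exact: (L2_int1 (cont01_L2M (prim_cont Lf) Lg)).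
rewrite int01D// int01_triangle// -[RHS](subrK (int01 (fun x => prim f x * g x))).
congr (_ + _); rewrite -int01Z -?int01B//; [|exact/int1Z/L2_int1|exact: L2_int1].
by apply: int01_in => x _; ring.
Qed.

Lemma ACM F f G g : abscont F f -> abscont G g ->
  abscont (fun x => F x * G x) (fun x => f x * G x + F x * g x).
Proof.
move=> HF HG; have [Lf EF] := HF; have [Lg EG] := HG; split.
  apply: L2D; last exact: cont01_L2M (AC_cont HF) Lg.
  by apply: L2_in (cont01_L2M (AC_cont HG) Lf) => x _; rewrite mulrC.
move=> x x01.
have Lfg : L2 (fun y => f y * prim g y + prim f y * g y).
  apply: L2D; last exact: (cont01_L2M (prim_cont Lf) Lg).
  by apply: L2_in (cont01_L2M (prim_cont Lg) Lf) => y _; rewrite mulrC.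
have -> : prim (fun y => f y * G y + F y * g y) x =
    G 0 * prim f x + F 0 * prim g x + prim f x * prim g x.
  rewrite -[prim f x * _]int01_by_parts; [|exact: L2_lt|exact: L2_lt].
  rewrite -!primZ -?primD; try exact: L2_int1; [|exact/int1Z/L2_int1|exact/int1Z/L2_int1].
  have -> : int01 (fun y => f y * (y < x)%R%:R * prim (fun z => g z * (z < x)%R%:R) y +
      prim (fun z => f z * (z < x)%R%:R) y * (g y * (y < x)%R%:R)) =
      prim (fun y => f y * prim g y + prim f y * g y) x.
    apply: int01_in => y _; have [yx|] := boolP (y < x); last by rewrite !mulr0 mul0r addr0.
    have E h : prim (fun z => h z * (z < x)%R%:R) y = prim h y.
      by apply: prim_in => z _ zy; rewrite (lt_trans zy yx) mulr1.
    by rewrite !E; ring.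
  rewrite -primD; [|exact/L2_int1/L2D/L2Z/Lg/L2Z|exact: L2_int1].
  apply: prim_in => y /andP[/ltW y0 /ltW y1] _.
  by rewrite (EF y) ?y0// (EG y) ?y0//; ring.
by rewrite (EF x)// (EG x)//; ring.
Qed.

End AbsolutelyContinuous.

#[local] Hint Resolve measurable_I01 : core.

(** * Calculus with primitives, and smooth functions *)
Section Calculus01.
Variable R : realType.
Implicit Types (f g h F G : R -> R) (a b x y : R).

Local Notation mR := (measurableTypeR R).
Local Notation I01 := (`]0, 1[%classic : set mR).

Lemma abscont_ext F G f g : (forall x, F x = G x) -> (forall x, f x = g x) ->
  abscont F f -> abscont G g.
Proof. by move=> /funext -> /funext ->. Qed.

Lemma AC_prim_pow h n : L2 h ->
  abscont (fun y => prim h y ^+ n.+1) (fun y => n.+1%:R * (h y * prim h y ^+ n)).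
Proof.
move=> Lh; elim: n => [|n IH].
  by apply: abscont_ext (AC_prim Lh) => y; rewrite ?expr1// expr0 mulr1 mul1r.
apply: abscont_ext (ACM (AC_prim Lh) IH) => y; first by rewrite -exprS.
by rewrite !exprS -[n.+2]addn1 natrD; ring.
Qed.

Lemma prim_pow h n x : L2 h -> 0 <= x <= 1 ->
  prim (fun y => h y * prim h y ^+ n) x = prim h x ^+ n.+1 / n.+1%:R.
Proof.
move=> Lh x01; have H := AC_prim_pow n Lh.
have iH : int1 (fun y => h y * prim h y ^+ n).
  apply: int1_in (int1Z (n.+1%:R^-1) (L2_int1 (AC_L2 H))) => y _.
  by rewrite mulKf// pnatr_eq0.
have [_ /(_ x x01)] := H; rewrite prim0 expr0n add0r primZ// => ->.
by rewrite mulrC mulKf// pnatr_eq0.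
Qed.

(** Gronwall's lemma: iterating [|z| <= int k |z|] gives
    [|z| <= M (int |k|)^n / n!] for every [n]. *)
Lemma gronwall01 (z k : R -> R) : {within `[0, 1], continuous z} -> L2 k ->
  (forall x, 0 <= x <= 1 -> z x = prim (fun y => k y * z y) x) ->
  forall x, 0 <= x <= 1 -> z x = 0.
Proof.
move=> cz Lk Hz; pose K : R -> R := fun y => `|k y|.
have LK : L2 K.
  have [mk sk] := Lk; split; first exact: measurableT_comp.
  by apply: int1_in sk => x _; rewrite real_normK ?num_real.
have [M M0 zM] := cont01_bnd cz.
have key n x : 0 <= x <= 1 -> `|z x| <= M * (prim K x ^+ n / n`!%:R).
  elim: n x => [|n IH] x x01; first by rewrite expr0 fact0 invr1 !mulr1 zM.
  rewrite Hz//; have ikz : int1 (fun y => k y * z y).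
    by apply: L2_int1; apply: L2_in (cont01_L2M cz Lk) => y _; rewrite mulrC.
  apply: le_trans (int01_norm (int1_lt x ikz)) _.
  have cKn : {within `[0, 1], continuous (fun y => prim K y ^+ n)}.
    by case: (n) => [|p]; [exact: AC_cont (AC_cst 1)|exact: AC_cont (AC_prim_pow p LK)].
  have iKn : int1 (fun y => K y * prim K y ^+ n).
    by apply: L2_int1; apply: L2_in (cont01_L2M cKn LK) => y _; rewrite mulrC.
  have -> : M * (prim K x ^+ n.+1 / (n.+1)`!%:R) =
      prim (fun y => M / n`!%:R * (K y * prim K y ^+ n)) x.
    rewrite primZ// prim_pow// factS natrM.
    by rewrite invfM; ring.
  apply: int01_le; [exact/int1_norm/int1_lt|exact/int1_lt/int1Z|].
  move=> y /andP[y0 y1]; rewrite !normrM (ger0_norm (ler0n _ _)) ler_wpM2r//.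
  have y01 : 0 <= y <= 1 by rewrite !ltW.
  have H := IH y y01.
  rewrite -/(K y); have := ler_wpM2l (normr_ge0 (k y)) H; rewrite -/(K y).
  by move=> /le_trans; apply; rewrite le_eqVlt; apply/orP; left; apply/eqP; ring.
move=> x x01; apply/eqP; rewrite -normr_le0.
have cv : (fun n => M * (prim K x ^+ n / n`!%:R)) @ \oo --> M * 0.
  by apply: cvgMr; exact: pi_irrational.exp_fact.
rewrite mulr0 in cv; rewrite -(cvg_lim _ cv)//.
apply: limr_ge; first by apply/cvg_ex; exists 0.
by apply: nearW => n; exact: key.
Qed.

Lemma cont01_inv F : {within `[0, 1], continuous F} ->
  (forall x, 0 <= x <= 1 -> 0 < F x) -> {within `[0, 1], continuous (fun x => (F x)^-1)}.
Proof.
move=> cF F0; apply/continuous_within_itvP => //.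
have /continuous_within_itvP [//|c1 c2 c3] := cF.
split.
- move=> x x01; apply: cvgV; last exact: c1.
  move: x01; rewrite in_itv/= => /andP[/ltW x0 /ltW x1].
  by rewrite gt_eqF// F0// x0.
- by apply: cvgV => //; rewrite gt_eqF// F0// lexx ler01.
- by apply: cvgV => //; rewrite gt_eqF// F0// lexx ler01.
Qed.

(** Let [D] be the primitive of the expected derivative with [D 0 = 1 / F 0]. Then
    [z = F D - 1] solves the linear equation [z' = (f / F) z] with [z 0 = 0], and vanishes
    by Gronwall's lemma. *)
Lemma AC_inv F f : abscont F f -> (forall x, 0 <= x <= 1 -> 0 < F x) ->
  abscont (fun x => (F x)^-1) (fun x => - (f x * (F x)^-1 ^+ 2)).
Proof.
move=> HF F0; have cV := cont01_inv (AC_cont HF) F0.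
have Lf := AC_L2 HF.
have Ld : L2 (fun x => - (f x * (F x)^-1 ^+ 2)).
  apply: L2N; apply: L2_in (cont01_L2M cV (cont01_L2M cV Lf)) => x _; ring.
pose D x := (F 0)^-1 + prim (fun x => - (f x * (F x)^-1 ^+ 2)) x.
have HD : abscont D (fun x => - (f x * (F x)^-1 ^+ 2)).
  by apply: abscont_ext (ACD (AC_cst (F 0)^-1) (AC_prim Ld)) => x //; exact: add0r.
have Fn0 x : 0 <= x <= 1 -> F x != 0 by move=> /F0 /lt0r_neq0.
apply: (AC_eq _ HD) => x x01.
have Hz := ACB (ACM HF HD) (AC_cst 1).
apply: (mulfI (Fn0 _ x01)); rewrite divff ?Fn0//; apply/eqP; rewrite -subr_eq0.
apply/eqP; move: x x01; apply: (gronwall01 (AC_cont Hz) (cont01_L2M cV Lf)) => x x01.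
have D0 : D 0 = (F 0)^-1 by rewrite /D prim0 addr0.
have [_ ->] := Hz => //; rewrite D0 divff ?subrr ?add0r; last first.
  by rewrite Fn0// lexx ler01.
apply: prim_in => y /andP[/ltW y0 /ltW y1] _; rewrite subr0.
by field; rewrite Fn0// y0.
Qed.

(** ** The fundamental theorem of calculus *)

Lemma primE f x : int1 f -> 0 <= x <= 1 ->
  prim f x = Rintegral (leb R) `]0, x]%classic f.
Proof.
move=> fi /andP[x0 x1].
have fix_ : (leb R).-integrable (`]0, x[%classic : set mR) (EFin \o f).
  apply: integrableS fi => // y; rewrite /= !in_itv/= => /andP[-> /=] yx.
  exact: lt_le_trans yx x1.
rewrite -(Rintegral_itv_bndo_bndc fix_).
rewrite /prim /int01 [LHS]Rintegral_mkcond [RHS]Rintegral_mkcond.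
apply: eq_Rintegral => y _; rewrite !patchE !mem_setE !in_itv/=.
case: (0 < y) => //=; have [yx|yx] := ltP y x; last by rewrite mulr0; case: ifP.
by rewrite mulr1 (lt_le_trans yx x1).
Qed.

(** A primitive is differentiable in the usual sense where its density is continuous; this
    links absolute continuity with classical derivatives in one direction, and
    [is_derive_abscont] in the other. *)
Lemma AC_is_derive F f x : abscont F f -> 0 < x < 1 -> {for x, continuous f} ->
  is_derive x 1 F (f x).
Proof.
move=> [Lf HF] /andP[x0 x1] cf.
pose u := (x + 1) / 2; have xu : x < u by rewrite /u midf_lt.
have u1 : u < 1 by rewrite /u midf_lt.
have iu : lebesgue_measure.-integrable `]0, u]%classic (EFin \o f).
  apply: integrableS (L2_int1 Lf) => // y; rewrite /= !in_itv/= => /andP[-> /=] yu.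
  exact: le_lt_trans yu u1.
have [dI dE] := continuous_FTC1 xu iu x0 cf.
have HI : is_derive x 1 (fun y => Rintegral lebesgue_measure `]0, y]%classic f) (f x).
  by apply: DeriveDef; [exact: dI|rewrite -derive1E; exact: dE].
have := is_deriveD (is_derive_cst (F 0) x 1) HI; rewrite add0r.
apply: near_eq_is_derive; near=> y.
have y01 : 0 <= y <= 1.
  by apply/andP; split; apply/ltW; near: y; [exact: lt_nbhsr|exact: lt_nbhsl].
by rewrite [RHS](HF y y01) (primE (L2_int1 Lf) y01).
Unshelve. all: by end_near. Qed.

Lemma is_derive_abscont F f : {within `[0, 1], continuous F} ->
  {within `[0, 1], continuous f} ->
  (forall x, 0 < x < 1 -> is_derive x 1 F (f x)) -> abscont F f.
Proof.
move=> cF cf dF; split=> [|x /andP[x0 x1]]; first exact: cont01_L2.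
have [<-|xn0] := eqVneq 0 x; first by rewrite prim0 addr0.
have {xn0}x0 : 0 < x by rewrite lt_neqAle xn0.
have sub : (`[0, x]%classic : set R) `<=` `[0, 1]%classic.
  by move=> y; rewrite /= !in_itv/= => /andP[-> yx]; exact: le_trans yx x1.
have cfx : {within `[0, x], continuous f} by exact: continuous_subspaceW sub cf.
have cFx : {within `[0, x], continuous F} by exact: continuous_subspaceW sub cF.
have dFx y : y \in `]0, x[ -> is_derive y 1 F (f y).
  rewrite in_itv/= => /andP[y0 yx]; apply: dF; rewrite y0.
  exact: lt_le_trans yx x1.
have /continuous_within_itvP := cFx; move=> /(_ x0)[_ cF0 cFx'].
have dLR : derivable_oo_LRcontinuous F 0 x.
  by split => // y y0x; have [] := dFx y y0x.
have F'f : {in `]0, x[, derive1 F =1 f}.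
  by move=> y y0x; rewrite derive1E; exact: (@derive_val _ _ _ _ _ _ _ (dFx y y0x)).
have H := continuous_FTC2 x0 cfx dLR F'f.
have -> : prim f x = F x - F 0.
  rewrite primE; [|exact/L2_int1/cont01_L2|by rewrite ltW].
  rewrite Rintegral_itv_obnd_cbnd.
    by rewrite /Rintegral [X in fine X]H.
  apply: (@integrableS _ _ _ _ (`[0, x]%classic : set mR)) => //.
    by move=> y; rewrite /= !in_itv/= => /andP[/ltW -> ->].
  by apply: continuous_compact_integrable => //; exact: segment_compact.
by rewrite addrC subrK.
Qed.

(** A datatype rather than a bare quantification: smoothness stays folded when
    lemmas are applied. *)
Variant smooth f : Prop :=
  Smooth of forall k x, derivable (derive1n k f) x 1.

Lemma smooth_derivable f k x : smooth f -> derivable (derive1n k f) x 1.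
Proof. by case. Qed.

(** A class of everywhere derivable functions that contains the derivatives of
    its generators, up to sums and products, consists of smooth functions. *)
Inductive gen_alg (B : (R -> R) -> Prop) : (R -> R) -> Prop :=
| gen_base f : B f -> gen_alg B f
| gen_cst a : gen_alg B (fun=> a)
| gen_add f g : gen_alg B f -> gen_alg B g -> gen_alg B (fun x => f x + g x)
| gen_mul f g : gen_alg B f -> gen_alg B g -> gen_alg B (fun x => f x * g x).

Lemma gen_alg_smooth (B : (R -> R) -> Prop) :
  (forall f, B f -> exists2 f', gen_alg B f' & forall x, is_derive x 1 f (f' x)) ->
  forall f, gen_alg B f -> smooth f.
Proof.
move=> HB; have step f : gen_alg B f ->
    exists2 f', gen_alg B f' & forall x, is_derive x 1 f (f' x).
  elim=> {f}[f /HB //|a|f g Bf [f' Bf' df] Bg [g' Bg' dg]|f g Bf [f' Bf' df] Bg [g' Bg' dg]].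
  - by exists (fun=> 0); [exact: gen_cst|move=> x; exact: is_derive_cst].
  - exists (fun x => f' x + g' x); first exact: gen_add.
    by move=> x; exact: is_deriveD (df x) (dg x).
  - exists (fun x => f x * g' x + g x * f' x).
      by apply: gen_add; exact: gen_mul.
    by move=> x; exact: is_deriveM (df x) (dg x).
move=> f Bf; split=> k; have [f' [Bf' Hf']] : exists g, gen_alg B g /\ derive1n k f = g.
  elim: k => [|k [g [Bg Hg]]]; first by exists f.
  have [g' Bg' dg] := step _ Bg; exists g'; split => //.
  rewrite derive1nS Hg; apply/funext => x; rewrite derive1E.
  exact: (@derive_val _ _ _ _ _ _ _ (dg x)).
by rewrite Hf' => x; have [g' _ /(_ x)[]] := step _ Bf'.
Qed.

Lemma smooth_derive f : smooth f -> smooth (derive1 f).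
Proof.
by move=> [sf]; split=> k x; rewrite /derive1n -iterSr; exact: (sf k.+1).
Qed.

Lemma smooth_is_derive f x : smooth f -> is_derive x 1 f (derive1 f x).
Proof. by move=> /(@smooth_derivable _ 0 x) df; apply: DeriveDef; [exact: df|rewrite derive1E]. Qed.

Lemma gen_smooth f : gen_alg smooth f -> smooth f.
Proof.
apply: gen_alg_smooth => {}f sf; exists (derive1 f); last by move=> x; exact: smooth_is_derive.
by apply: gen_base; exact: smooth_derive.
Qed.

Lemma smoothD f g : smooth f -> smooth g -> smooth (fun x => f x + g x).
Proof. by move=> sf sg; apply: gen_smooth; apply: gen_add; exact: gen_base. Qed.

Lemma smoothM f g : smooth f -> smooth g -> smooth (fun x => f x * g x).
Proof. by move=> sf sg; apply: gen_smooth; apply: gen_mul; exact: gen_base. Qed.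

Lemma smooth_cst a : smooth (fun=> a).
Proof. by apply: gen_smooth; exact: gen_cst. Qed.

Lemma smooth_antiderivative f g : smooth g -> (forall x, is_derive x 1 f (g x)) ->
  smooth f.
Proof.
move=> sg df; apply: (@gen_alg_smooth (fun h => h = f \/ smooth h)).
  move=> h [->|sh]; first by exists g => //; apply: gen_base; right.
  exists (derive1 h); last by move=> x; exact: smooth_is_derive.
  by apply: gen_base; right; exact: smooth_derive.
by apply: gen_base; left.
Qed.

(** ** Flat functions and bumps *)

(** The functions [x ^ -n * exp (- e / x)], extended by 0 to [x <= 0], form a family
    stable under derivation up to linear combinations. *)
Definition flat (e : R) (n : nat) (x : R) : R :=
  if 0 < x then x^-1 ^+ n * expR (- (e / x)) else 0.

(** [s ^ N <= exp (N s)] with [N = n + 2] and [s = e / (N x)]: two powers of [x] are left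
    over, which is what differentiability at 0 requires. *)
Lemma flat_le (e : R) n x : 0 < e ->
  `|flat e n x| <= ((n.+2)%:R / e) ^+ n.+2 * x ^+ 2.
Proof.
move=> e0; rewrite /flat; have [x0|x0] := ltP 0 x; last first.
  by rewrite normr0 mulr_ge0// ?sqr_ge0// exprn_ge0// divr_ge0// ltW.
have y0 : 0 < (e / x) / (n.+2)%:R by rewrite !divr_gt0.
rewrite ger0_norm; last by rewrite mulr_ge0 ?expR_ge0// exprn_ge0// invr_ge0 ltW.
rewrite expRN ler_pdivrMr ?expR_gt0//.
have -> : expR (e / x) = expR ((e / x) / n.+2%:R) ^+ n.+2.
  by rewrite -expRM_natl [_%:R * _]mulrC divfK// pnatr_eq0.
have : ((e / x) / n.+2%:R) ^+ n.+2 <= expR ((e / x) / n.+2%:R) ^+ n.+2.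
  rewrite lerXn2r ?nnegrE ?expR_ge0 ?(ltW y0)//.
  by apply: le_trans (expR_ge1Dx _); rewrite lerDr.
move=> H; have c0 : 0 <= (n.+2%:R / e) ^+ n.+2 * x ^+ 2.
  by rewrite mulr_ge0 ?sqr_ge0// exprn_ge0// divr_ge0// ltW.
apply: le_trans (ler_wpM2l c0 H).
rewrite mulrAC -exprMn.
have -> : n.+2%:R / e * (e / x / n.+2%:R) = x^-1.
  have N0 : n.+2%:R != 0 :> R by rewrite pnatr_eq0.
  by move: (n.+2%:R : R) N0 => N N0; field; rewrite N0 !lt0r_neq0.
rewrite -[n.+2]addn2 exprD -mulrA -exprMn mulVf ?expr1n ?mulr1//.
exact: lt0r_neq0.
Qed.

Lemma is_derive_sqr_le f (C : R) : f 0 = 0 -> (forall x, `|f x| <= C * x ^+ 2) ->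
  is_derive (0 : R) 1 f 0.
Proof.
move=> f0 Hf; have C0 : 0 <= C.
  by have := Hf 1; rewrite expr1n mulr1; apply: le_trans.
have H : (fun h : R => h^-1 *: (f (h *: 1 + 0) - f 0)) @ 0^' --> (0 : R).
  apply/cvgr0Pnorm_le => eps eps0; near=> h.
  have h0 : h != 0 by near: h; exact: nbhs_dnbhs_neq.
  rewrite f0 subr0 addr0 scaler1 normrZ normfV ler_pdivrMl ?normr_gt0//.
  apply: le_trans (Hf h) _; rewrite -(real_normK (num_real h)) expr2 mulrCA.
  rewrite ler_wpM2l//.
  have hle : `|h| <= eps / (C + 1).
    by near: h; apply: dnbhs0_le; rewrite divr_gt0// ltr_wpDl.
  apply: le_trans (ler_wpM2l C0 hle) _; rewrite mulrA ler_pdivrMr ?ltr_wpDl//.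
  by rewrite mulrC ler_wpM2l ?(ltW eps0)// lerDl.
apply: DeriveDef; first by apply/cvg_ex; exists 0.
exact: cvg_lim H.
Unshelve. all: by end_near. Qed.

(** Away from 0 this is a computation; at 0 the function is [O(x ^ 2)] for every [n]. *)
Lemma is_derive_flat (e : R) n x : 0 < e ->
  is_derive x 1 (flat e n) (- (n%:R) * flat e n.+1 x + e * flat e n.+2 x).
Proof.
move=> e0; have [x0|x0|->] := ltgtP x 0.
- have E m : flat e m x = 0 by rewrite /flat ltNge ltW.
  rewrite !E !mulr0 addr0; apply: (@near_eq_is_derive _ _ _ (fun=> 0)).
    by near=> y; rewrite /flat ltNge ltW//; near: y; exact: lt_nbhsl.
- have xn0 := lt0r_neq0 x0.
  have dV : is_derive x 1 (fun y : R => y^-1) (- x ^- 2).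
    have := is_deriveV xn0 (is_derive_id x (1 : R)).
    by move/is_derive_eq; apply; rewrite [LHS]mulr1.
  have dexp : is_derive x 1 (fun y => expR (- (e / y))) (expR (- (e / x)) * (e * x ^- 2)).
    apply: (@is_derive1_comp _ expR (fun y => - (e / y))).
    have := is_deriveN (is_deriveZ e dV); move/is_derive_eq; apply.
    by rewrite [_ *: _]mulrN opprK.
  have dX : is_derive x 1 (fun y : R => y^-1 ^+ n) (- (n%:R) * x^-1 ^+ n.+1).
    have := is_deriveX n dV.
    have -> : ((fun y : R => y^-1) ^+ n) = (fun y : R => y^-1 ^+ n).
      by apply/funext => y; elim: n => [|m IH]; rewrite ?expr0// !exprS -IH.
    move/is_derive_eq; apply; case: n => [|m]; first by rewrite !mul0r scale0r oppr0 mul0r.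
    by rewrite [LHS]mulrN mulNr /= exprVn !exprVn; congr (- _); rewrite -!exprVn -mulrA -exprD addn2.
  have := is_deriveM dX dexp => H.
  apply: (@near_eq_is_derive _ _ _ (fun y => y^-1 ^+ n * expR (- (e / y)))).
    by near=> y; rewrite /flat ifT//; near: y; exact: lt_nbhsr.
  move: H; move/is_derive_eq; apply.
  have sE (a b : R) : a *: b = a * b by [].
  rewrite !sE /flat !x0 -[x ^- 2]exprVn.
  by rewrite !exprSr expr0; ring.
- have E m : flat e m 0 = 0 by rewrite /flat ltxx.
  rewrite !E !mulr0 addr0; apply: (is_derive_sqr_le (E n)) => y; exact: flat_le.
Unshelve. all: by end_near. Qed.

End Calculus01.

#[local] Hint Resolve measurable_I01 : core.

(** * Weak derivatives *)
Section WeakDerivatives.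
Variable R : realType.
Implicit Types (f g h F G phi psi : R -> R) (a b x y : R).

Local Notation mR := (measurableTypeR R).
Local Notation I01 := (`]0, 1[%classic : set mR).

Definition bump (e a b : R) (x : R) : R := flat e 0 (x - a) * flat e 0 (b - x).

Lemma flat_smooth (e : R) n a b : 0 < e -> smooth (fun x => flat e n (a * x + b)).
Proof.
move=> e0; apply: (@gen_alg_smooth _ (fun f => exists m, f = (fun x => flat e m (a * x + b)))).
  move=> _ [m ->].
  exists (fun x => (- (m%:R) * a) * flat e m.+1 (a * x + b) + (e * a) * flat e m.+2 (a * x + b)).
    apply: gen_add; apply: gen_mul; [exact: gen_cst| |exact: gen_cst| ].
      by apply: gen_base; exists m.+1.
    by apply: gen_base; exists m.+2.
  move=> x; have dl : is_derive x 1 (fun x => a * x + b) a.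
    have := is_deriveD (is_deriveZ a (is_derive_id x 1)) (is_derive_cst b x 1).
    by move/is_derive_eq; apply; rewrite addr0; exact: mulr1.
  have := @is_derive1_comp _ (flat e m) (fun x => a * x + b) x _ _ (is_derive_flat m _ e0) dl.
  by move/is_derive_eq; apply; ring.
by apply: gen_base; exists n.
Qed.

Lemma bump_smooth (e : R) a b : 0 < e -> smooth (bump e a b).
Proof.
move=> e0; have := smoothM (@flat_smooth e 0 1 (- a) e0) (@flat_smooth e 0 (-1) b e0).
congr smooth; apply/funext => x; rewrite /bump mul1r mulN1r.
by rewrite [- x + b]addrC.
Qed.

Lemma bump_out (e : R) a b x : x <= a \/ b <= x -> bump e a b x = 0.
Proof.
rewrite /bump /flat => -[xa|bx]; first by rewrite subr_gt0 ltNge xa mul0r.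
by rewrite [0 < b - x]subr_gt0 [x < b]ltNge bx mulr0.
Qed.

Lemma bump_in (e : R) a b x : a < x -> x < b ->
  bump e a b x = expR (- (e / (x - a))) * expR (- (e / (b - x))).
Proof. by move=> ax xb; rewrite /bump /flat !subr_gt0 ax xb !expr0 !mul1r. Qed.

Lemma bump_ge0 (e : R) a b x : 0 <= bump e a b x.
Proof.
rewrite /bump /flat; case: ifP => [x0|_]; last by rewrite mul0r.
case: ifP => [x1|_]; last by rewrite mulr0.
by rewrite !expr0 !mul1r mulr_ge0 ?expR_ge0.
Qed.

Lemma bump_le1 (e : R) a b x : 0 < e -> bump e a b x <= 1.
Proof.
move=> e0; rewrite /bump /flat; case: ifP => [x0|_]; last by rewrite mul0r.
case: ifP => [x1|_]; last by rewrite mulr0.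
rewrite !expr0 !mul1r mulr_ile1 ?expR_ge0//; rewrite -expR0 ler_expR oppr_le0.
  by rewrite divr_ge0 ?ltW.
by rewrite divr_ge0 ?ltW.
Qed.

Lemma test_fun_smooth phi : test_fun phi -> smooth phi.
Proof. by case=> sp _; exact: Smooth sp. Qed.

Lemma bump_test (e : R) a b : 0 < e -> 0 < a -> b < 1 -> test_fun (bump e a b).
Proof.
move=> e0 a0 b1; split; first by case: (bump_smooth a b e0).
exists a, b; split => // x; rewrite in_itv/= negb_and -!ltNge => /orP[xa|bx].
  by rewrite bump_out//; left; exact: ltW.
by rewrite bump_out//; right; exact: ltW.
Qed.

Lemma smooth_cont01 phi : smooth phi -> {within `[0, 1], continuous phi}.
Proof.
move=> sp; apply: continuous_subspaceT => x; apply: differentiable_continuous.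
by apply/derivable1_diffP; exact: (@smooth_derivable _ _ 0 x sp).
Qed.

Lemma smooth_abscont phi : smooth phi -> abscont phi (derive1 phi).
Proof.
move=> sp; apply: is_derive_abscont.
- exact: smooth_cont01.
- exact/smooth_cont01/smooth_derive.
- by move=> x _; exact: smooth_is_derive.
Qed.

Lemma test_fun0 phi x : test_fun phi -> (x <= 0) || (1 <= x) -> phi x = 0.
Proof.
move=> [_ [a [b [a0 b1 H]]]] x01; apply: H; rewrite in_itv/= negb_and -!ltNge.
by case/orP: x01 => [x0|x1]; [rewrite (le_lt_trans x0 a0)|rewrite (lt_le_trans b1 x1) orbT].
Qed.

(** Integration by parts; the boundary terms vanish with the test function. *)
Lemma abscont_weak_derivative F f : abscont F f -> weak_derivative F f.
Proof.
move=> HF; split; first exact: AC_L2 HF.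
move=> phi tphi; have Hp := smooth_abscont (test_fun_smooth tphi).
have [LH HH] := ACM HF Hp.
have := HH 1; rewrite lexx ler01 => /(_ isT).
rewrite !(test_fun0 tphi) ?lexx ?orbT// !mulr0 add0r prim1.
rewrite int01D; last 2 first.
- apply: L2_int1; apply: L2_in (cont01_L2M (AC_cont Hp) (AC_L2 HF)) => x _.
  exact: mulrC.
- exact/L2_int1/(cont01_L2M (AC_cont HF) (AC_L2 Hp)).
by move/eqP; rewrite eq_sym addrC addr_eq0 => /eqP.
Qed.

Lemma prim_le0 g x : x <= 0 -> prim g x = 0.
Proof.
move=> x0; rewrite -[RHS]int01_cst; apply: int01_in => y /andP[y0 _].
by rewrite ltNge (le_trans x0 (ltW y0)) mulr0.
Qed.

Lemma prim_ge1 g x : 1 <= x -> prim g x = int01 g.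
Proof.
by move=> x1; apply: int01_in => y /andP[_ y1]; rewrite (lt_le_trans y1 x1) mulr1.
Qed.

(** Lebesgue's differentiation theorem for [g] extended by zero to the line. *)
Lemma prim_eq0_ae g : L2 g -> (forall x, 0 <= x <= 1 -> prim g x = 0) ->
  ae01 g (fun=> 0).
Proof.
move=> Lg g0; pose gD : R -> R := g \_ I01.
have igD : lebesgue_measure.-integrable setT (EFin \o gD : mR -> \bar R).
  have : (leb R).-integrable (setT `&` I01) (fun x : mR => (g x)%:E).
    by rewrite setTI; exact: L2_int1.
  move/(integrable_restrict (leb R) (@measurable_I01 R) measurableT).
  by apply: eq_integrable => // x _; rewrite restrict_EFin.
have igy y : lebesgue_measure.-integrable (`]-oo, y]%classic : set mR) (EFin \o gD).
  by apply: integrableS igD.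
have lgD : locally_integrable [set: R] gD.
  split; [|exact: openT|].
    by move/integrableP : igD => [/measurable_EFinP].
  move=> K _ cK; have mK : measurable (K : set mR) by exact: compact_measurable.
  by have /integrableP[] := integrableS measurableT mK (@subsetT _ _) igD.
have := FTC1Ny igy lgD.
have -> : (fun x => Rintegral lebesgue_measure `]-oo, x]%classic gD) = (fun=> 0).
  apply/funext => y.
  have -> : Rintegral lebesgue_measure `]-oo, y]%classic gD = prim g y.
    transitivity (int01 (fun z => g z * (z <= y)%R%:R)).
      rewrite /int01 [LHS]Rintegral_mkcond [RHS]Rintegral_mkcond.
      apply: eq_Rintegral => z _; rewrite /gD !patchE !mem_setE in_itv/=.
      by case: ifP; case: ifP; rewrite ?mulr1 ?mulr0.
    apply: int01_ae.
    - apply: meas01M; first exact: L2_meas.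
      have -> : (fun z : R => (z <= y)%R%:R : R) = \1_(`]-oo, y] : set mR).
        by apply/funext => z; rewrite indicE mem_setE in_itv.
      exact: measurable_indic.
    - by apply: int1_meas; apply: int1_lt; exact: L2_int1.
    - by apply: filterS (ae01_neq y) => z zy _; rewrite lt_neqAle zy.
  have [y0|y0] := leP y 0; first exact: prim_le0.
  have [y1|y1] := leP y 1; first by rewrite g0// ltW.
  by rewrite prim_ge1 ?(ltW y1)// -prim1 g0// ler01 lexx.
move=> H; apply: filterS H => x [_ H] x01.
have := H; rewrite /gD patchE mem_setE x01 => <-.
by rewrite derive1_cst.
Qed.

(** The functions [bump e a b] tend to the indicator of [`]a, b[] as [e] tends to 0, so that
    the primitive of [g] takes equal values at [a] and [b]. It is thus constant inside
    the interval, and zero by its continuity at the end points. *)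
Lemma test_fun_eq0 g : L2 g ->
  (forall phi, test_fun phi -> int01 (fun x => g x * phi x) = 0) ->
  ae01 g (fun=> 0).
Proof.
move=> Lg Hg.
have key a b : 0 < a -> a < b -> b < 1 -> prim g b = prim g a.
  move=> a0 ab b1.
  pose e n : R := n.+1%:R^-1; have e0 n : 0 < e n by rewrite invr_gt0 ltr0n.
  pose ind (x : R) : R := ((a < x) && (x < b))%R%:R.
  have mind : meas01 ind.
    have -> : ind = \1_(`]a, b[ : set mR).
      by apply/funext => z; rewrite indicE mem_setE in_itv.
    exact: measurable_indic.
  have mb n : meas01 (bump (e n) a b).
    by apply: cont01_meas; apply: smooth_cont01; exact: bump_smooth.
  have cvg_bump x : bump (e n) a b x @[n --> \oo] --> ind x.
    rewrite /ind; have [ax|xa] := ltP a x; last first.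
      rewrite (_ : (fun n => bump (e n) a b x) = cst 0); first exact: cvg_cst.
      by apply/funext => n; rewrite bump_out//; left.
    have [xb|bx] := ltP x b; last first.
      rewrite (_ : (fun n => bump (e n) a b x) = cst 0); first exact: cvg_cst.
      by apply/funext => n; rewrite bump_out//; right.
    rewrite (_ : (fun n => bump (e n) a b x) = fun n =>
        expR (- (e n / (x - a))) * expR (- (e n / (b - x)))); last first.
      by apply/funext => n; rewrite bump_in.
    have E (c : R) : expR (- (e n / c)) @[n --> \oo] --> (1 : R).
      rewrite -expR0; apply: continuous_cvg; first exact: continuous_expR.
      rewrite -[X in _ --> X]oppr0; apply: cvgN; rewrite -(mul0r c^-1).
      by apply: cvgMl; exact: cvg_harmonic.
    by rewrite -[X in _ --> X](mulr1 1); apply: cvgM.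
  have Lb n : L2 (bump (e n) a b).
    by apply: cont01_L2; apply: smooth_cont01; exact: bump_smooth.
  have DCT := @dominated_convergence _ _ _ (leb R) I01 (@measurable_I01 R)
    (fun n x => (g x * bump (e n) a b x)%:E) (fun x => (g x * ind x)%:E)
    (fun x => `|g x|%:E).
  have {DCT}[|||||_ _ DCT] := DCT.
  - by move=> n; apply/measurable_EFinP; exact: meas01M (L2_meas Lg) (mb n).
  - by apply/measurable_EFinP; exact: meas01M (L2_meas Lg) mind.
  - apply: aeW => x _; apply: cvg_EFin; first by apply: nearW.
    by apply: cvgMr; exact: cvg_bump.
  - exact: int1_norm (L2_int1 Lg).
  - apply: aeW => x n _; rewrite lee_fin normrM ler_piMr//.
    by rewrite ger0_norm ?bump_ge0// bump_le1.
  have I0 : (\int[leb R]_(x in I01) (g x * ind x)%:E = 0)%E.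
    have := cvg_lim _ DCT; move=> <-//.
    apply: lim_near_cst => //; apply: nearW => n.
    have := integrable_fin_num (@measurable_I01 R) (L2M Lg (Lb n)).
    move=> /fineK E; transitivity (int01 (fun x => g x * bump (e n) a b x))%:E.
      exact: esym E.
    by rewrite Hg//; exact: bump_test.
  have {}I0 : int01 (fun x => g x * ind x) = 0 by rewrite /int01 /Rintegral I0.
  apply/eqP; rewrite -subr_eq0 -I0 /prim -int01B; [|exact/int1_lt/L2_int1..].
  apply/eqP/int01_ae.
  - by apply: int1_meas; apply: int1D; [|apply: int1N]; exact/int1_lt/L2_int1.
  - exact: meas01M (L2_meas Lg) mind.
  apply: filterS (ae01_neq a) => x xa _; rewrite -mulrBr /ind; congr (_ * _).
  move: xa; case: (ltgtP x a) => //= ax _; last by rewrite subr0.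
  by rewrite (lt_trans ax ab) subrr.
have [C C0 HC] : exists2 C : R, 0 <= C & forall x y, 0 <= x <= 1 -> 0 <= y <= 1 ->
    (prim g y - prim g x) ^+ 2 <= C * `|y - x|.
  exists (int01 (fun z => g z ^+ 2)); last by move=> x y; exact: prim_holder.
  by apply: int01_ge0 => x _; exact: sqr_ge0.
have small (t : R) : (forall y, 0 < y < 1 -> t ^+ 2 <= C * y) -> t = 0.
  move=> Ht; apply/eqP; rewrite -sqrf_eq0 eq_le sqr_ge0 andbT.
  apply/ler_addgt0Pl => d d0; rewrite addr0.
  pose y := Num.min (1 / 2) (d / (C + 1)).
  have y0 : 0 < y by rewrite lt_min !divr_gt0// ltr_wpDl.
  have y1 : y < 1 by rewrite gt_min; apply/orP; left; lra.
  apply: le_trans (Ht y _) _; first by rewrite y0.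
  have : y <= d / (C + 1) by rewrite ge_min lexx orbT.
  rewrite ler_pdivlMr ?ltr_wpDl// => H; apply: le_trans H; rewrite mulrC ler_wpM2l ?(ltW y0)//.
  by rewrite lerDl.
apply: prim_eq0_ae => // x /andP[x0 x1].
have in01 y : 0 < y < 1 -> prim g y = 0.
  move=> /andP[y0 y1]; apply: small => z /andP[z0 z1].
  pose w := Num.min (y / 2) z; have w0 : 0 < w by rewrite lt_min divr_gt0.
  have wy : w < y by rewrite gt_min; apply/orP; left; lra.
  have := HC 0 w; rewrite lexx ler01 (ltW w0) (ltW (lt_trans wy y1)) => /(_ isT isT).
  rewrite prim0 !subr0 -(key w y)// gtr0_norm// => /le_trans; apply.
  by rewrite ler_wpM2l// ge_min lexx orbT.
have [->|xn0] := eqVneq x 0; first exact: prim0.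
have {xn0}x0 : 0 < x by rewrite lt_neqAle eq_sym xn0.
have [->|xn1] := eqVneq x 1; last by apply: in01; rewrite x0 lt_neqAle xn1.
apply: small => y /andP[y0 y1]; have := HC (1 - y) 1.
rewrite !lexx ler01 subr_ge0 (ltW y1) gerBl (ltW y0) => /(_ isT isT).
rewrite (in01 (1 - y)) ?subr0; last by rewrite subr_gt0 y1 ltrBlDr ltrDl.
by rewrite subKr gtr0_norm.
Qed.

(** ** The lemma of du Bois-Reymond *)

Lemma test_funD phi psi : test_fun phi -> test_fun psi ->
  test_fun (fun x => phi x + psi x).
Proof.
move=> [sp [a [b [a0 b1 Hp]]]] [sq [c [d [c0 d1 Hq]]]]; split; first by case: (smoothD (Smooth sp) (Smooth sq)).
exists (Num.min a c), (Num.max b d); rewrite lt_min a0 c0 gt_max b1 d1; split => // x.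
rewrite in_itv/= negb_and -!ltNge lt_min gt_max => H.
rewrite Hp ?Hq ?addr0// in_itv/= negb_and -!ltNge.
  by case/orP: H => /andP[H1 H2]; rewrite ?H2 ?orbT.
by case/orP: H => /andP[H1 H2]; rewrite ?H1 ?orbT.
Qed.

Lemma test_funZ a phi : test_fun phi -> test_fun (fun x => a * phi x).
Proof.
move=> [sp [b [c [b0 c1 Hp]]]]; split; first by case: (smoothM (smooth_cst a) (Smooth sp)).
by exists b, c; split=> // x /Hp ->; rewrite mulr0.
Qed.

Lemma test_fun_L2 phi : test_fun phi -> L2 phi.
Proof. by move=> /test_fun_smooth sp; exact/cont01_L2/smooth_cont01. Qed.

(** The primitive vanishes to the left of the support, and equals [int01 phi] to its right. *)
Lemma test_fun_antiderivative phi : test_fun phi -> int01 phi = 0 ->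
  exists2 Phi, test_fun Phi & derive1 Phi = phi.
Proof.
move=> tphi I0; have [_ [a [b [a0 b1 Hp]]]] := tphi; have sp := test_fun_smooth tphi.
have Pa x : x <= a -> prim phi x = 0.
  move=> xa; rewrite -[RHS]int01_cst; apply: int01_in => y _.
  have [yx|_] := ltP y x; last by rewrite mulr0.
  by rewrite Hp ?mul0r// in_itv/= negb_and -ltNge (lt_le_trans yx xa).
have Pb x : b < x -> prim phi x = 0.
  move=> bx; rewrite -I0; apply: int01_in => y _.
  have [_|xy] := ltP y x; first by rewrite mulr1.
  by rewrite mulr0 Hp// in_itv/= negb_and -!ltNge (lt_le_trans bx xy) orbT.
have dP x : is_derive x 1 (prim phi) (phi x).
  have [x0|x0] := leP x 0.
    rewrite (test_fun0 tphi) ?x0//.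
    apply: (@near_eq_is_derive _ _ _ (fun=> 0)).
    by near=> y; rewrite Pa// ltW//; near: y; apply: lt_nbhsl; exact: le_lt_trans a0.
  have [x1|x1] := leP 1 x.
    rewrite (test_fun0 tphi) ?x1 ?orbT//.
    apply: (@near_eq_is_derive _ _ _ (fun=> 0)).
    by near=> y; rewrite Pb//; near: y; apply: lt_nbhsr; exact: lt_le_trans x1.
  apply: AC_is_derive (AC_prim (test_fun_L2 tphi)) _ _; first by rewrite x0.
  by apply: differentiable_continuous; apply/derivable1_diffP; exact: (@smooth_derivable _ _ 0 x sp).
exists (prim phi); last first.
  by apply/funext => x; rewrite derive1E; exact: (@derive_val _ _ _ _ _ _ _ (dP x)).
split; first by case: (smooth_antiderivative sp dP).
exists a, b; split => // x; rewrite in_itv/= negb_and -!ltNge => /orP[xa|bx].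
  by rewrite Pa// ltW.
by rewrite Pb.
Unshelve. all: by end_near. Qed.

Lemma test_fun_int1 : exists2 psi : R -> R, test_fun psi & int01 psi = 1.
Proof.
pose a : R := 4^-1; pose b : R := 3 / 4.
have a0 : 0 < a by rewrite /a; lra.
have ab : a < b by rewrite /a /b; lra.
have b1 : b < 1 by rewrite /b; lra.
pose p := bump 1 a b; have tp : test_fun p by exact: bump_test.
have Lp := test_fun_L2 tp.
have dP x : x \in `]a, b[ -> is_derive x 1 (prim p) (p x).
  rewrite in_itv/= => /andP[ax xb].
  apply: AC_is_derive (AC_prim Lp) _ _; first by rewrite (lt_trans a0 ax) (lt_trans xb b1).
  apply: differentiable_continuous; apply/derivable1_diffP.
  exact: (@smooth_derivable _ _ 0 x (test_fun_smooth tp)).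
have cP : {within `[a, b], continuous (prim p)}.
  apply: continuous_subspaceW (prim_cont Lp) => x; rewrite /= !in_itv/=.
  by move=> /andP[ax xb]; rewrite (le_trans (ltW a0) ax) (le_trans xb (ltW b1)).
have [c cab Hc] := MVT ab dP cP.
have p0 : 0 < prim p b - prim p a.
  rewrite Hc mulr_gt0 ?subr_gt0//; move: cab; rewrite in_itv/= => /andP[ac cb].
  by rewrite /p bump_in// mulr_gt0// expR_gt0.
have pa : prim p a = 0.
  rewrite -[RHS]int01_cst; apply: int01_in => y _.
  have [yx|_] := ltP y a; last by rewrite mulr0.
  by rewrite /p bump_out ?mul0r//; left; exact: ltW.
have Ip : 0 < int01 p.
  apply: lt_le_trans p0 _; rewrite pa subr0.
  apply: int01_le; [exact/int1_lt/L2_int1|exact: L2_int1|move=> y _].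
  by rewrite ler_piMr ?bump_ge0//; case: (y < b).
exists (fun x => (int01 p)^-1 * p x); first exact: test_funZ.
by rewrite int01Z ?mulVf ?lt0r_neq0//; exact: L2_int1.
Qed.

(** Fix a test function [psi] of integral 1. Any test function [phi] minus [int01 phi] times
    [psi] is the derivative of a test function, to which [f] is orthogonal; so [f] acts
    on [phi] as the constant [int01 (f psi)]. *)
Lemma weak_derivative0 f : L2 f -> weak_derivative f (fun=> 0) ->
  exists a, ae01 f (fun=> a).
Proof.
move=> Lf [_ Hf]; have [psi tpsi Ipsi] := test_fun_int1.
pose C := int01 (fun x => f x * psi x).
exists C; have Lg := L2B Lf (L2_cst C).
have H : ae01 (fun x => f x - C) (fun=> 0).
  apply: test_fun_eq0 => // phi tphi.
  have Lphi := test_fun_L2 tphi; have Lpsi := test_fun_L2 tpsi.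
  have tq := test_funD tphi (test_funZ (- int01 phi) tpsi).
  have Iq : int01 (fun x => phi x + - int01 phi * psi x) = 0.
    rewrite int01D; [|exact: L2_int1|exact/int1Z/L2_int1].
    by rewrite int01Z ?Ipsi ?mulr1 ?subrr//; exact: L2_int1.
  have [Phi tPhi dPhi] := test_fun_antiderivative tq Iq.
  have := Hf _ tPhi; rewrite dPhi.
  have -> : int01 (fun x => f x * (phi x + - int01 phi * psi x)) =
      int01 (fun x => f x * phi x) - int01 phi * C.
    rewrite -int01Z; last exact: L2M.
    rewrite -int01B; [|exact: L2M|exact/int1Z/L2M].
    by apply: int01_in => x _; ring.
  have -> : int01 (fun x => 0 * Phi x) = 0.
    by rewrite -[RHS]int01_cst; apply: int01_in => x _; rewrite mul0r.
  rewrite oppr0 => H0; rewrite -[RHS]H0 [_ * C]mulrC -int01Z; last exact: L2_int1.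
  rewrite -int01B; [|exact: L2M|exact/int1Z/L2_int1].
  by apply: int01_in => x _; ring.
by apply: filterS H => x H xI; apply/eqP; rewrite -subr_eq0 H.
Qed.

(** The difference of [f] and of a primitive of [g] has zero weak derivative, so it is
    constant. *)
Lemma weak_derivative_abscont f g : L2 f -> weak_derivative f g ->
  exists2 F, abscont F g & ae01 f F.
Proof.
move=> Lf [Lg Hg]; have HP := AC_prim Lg; have [_ HPg] := abscont_weak_derivative HP.
have LP := cont01_L2 (AC_cont HP).
have [|a Ha] := @weak_derivative0 (fun x => f x - prim g x) (L2B Lf LP).
  split=> [|phi tphi]; first exact: L2_cst.
  have Ldphi : L2 (derive1 phi).
    exact/cont01_L2/smooth_cont01/smooth_derive/test_fun_smooth.
  transitivity (int01 (fun x => f x * derive1 phi x - prim g x * derive1 phi x)).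
    by apply: int01_in => x _; ring.
  rewrite int01B ?Hg ?HPg ?subrr//; [|exact: L2M|exact: L2M].
  rewrite -[LHS]oppr0; congr (- _); rewrite -[LHS]int01_cst.
  by apply: int01_in => x _; rewrite mul0r.
exists (fun x => a + prim g x).
  by apply: abscont_ext (ACD (AC_cst a) HP) => x //; rewrite add0r.
by apply: filterS Ha => x Ha xI; rewrite -Ha// subrK.
Qed.

End WeakDerivatives.

#[local] Hint Resolve measurable_I01 : core.

(** * Continuous representatives and weak derivatives *)
Section SobolevFacts.
Variable R : realType.
Implicit Types (f g h F G phi psi : R -> R) (a b x y : R).

Lemma cont01_interior F x : {within `[0, 1], continuous F} -> 0 < x < 1 ->
  {for x, continuous F}.
Proof. by move=> /continuous_within_itvP[//|cF _ _] x01; apply: cF; rewrite in_itv. Qed.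

Lemma cont01_sub F G : {within `[0, 1], continuous F} ->
  {within `[0, 1], continuous G} -> {within `[0, 1], continuous (fun x => F x - G x)}.
Proof.
move=> /continuous_within_itvP[//|c1 c2 c3] /continuous_within_itvP[//|d1 d2 d3].
apply/continuous_within_itvP => //; split.
- by move=> x x01; apply: cvgB; [exact: c1|exact: d1].
- exact: cvgB.
- exact: cvgB.
Qed.

(** Inside the interval, [F] is the derivative of its own primitive, which is zero; the end
    points follow by continuity. In this way values at the vertices do not depend on the
    choice of a representative. *)
Lemma cont01_ae0 F : {within `[0, 1], continuous F} -> ae01 F (fun=> 0) ->
  forall x, 0 <= x <= 1 -> F x = 0.
Proof.
move=> cF F0; have LF := cont01_L2 cF.
have inn x : 0 < x < 1 -> F x = 0.
  move=> x01; have cx := cont01_interior cF x01.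
  have := AC_is_derive (AC_prim LF) x01 cx.
  have -> : prim F = fun=> 0.
    apply/funext => y; transitivity (prim (fun=> 0 : R) y).
      by apply: prim_ae => //; [exact: L2_meas|exact: meas01_cst].
    by rewrite -[RHS]int01_cst; apply: int01_in => z _; rewrite mul0r.
  by move=> /@derive_val <-; rewrite derive_cst.
have /continuous_within_itvP[//|c1 c2 c3] := cF.
move=> x /andP[x0 x1].
have [->|xn0] := eqVneq x 0.
  apply/esym/(cvg_unique _ _ c2) => //.
  apply: cvg_near_cst; near=> y; apply: inn; apply/andP; split.
    by near: y; exact: nbhs_right_gt.
  by near: y; exact: nbhs_right_lt.
have [->|xn1] := eqVneq x 1.
  apply/esym/(cvg_unique _ _ c3) => //.
  apply: cvg_near_cst; near=> y; apply: inn; apply/andP; split.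
    by near: y; exact: nbhs_left_gt.
  by near: y; exact: nbhs_left_lt.
by apply: inn; rewrite !lt_neqAle eq_sym xn0 x0 xn1.
Unshelve. all: by end_near. Qed.

Lemma cont01_ae_eq F G : {within `[0, 1], continuous F} ->
  {within `[0, 1], continuous G} -> ae01 F G ->
  forall x, 0 <= x <= 1 -> F x = G x.
Proof.
move=> cF cG FG x x01; apply/eqP; rewrite -subr_eq0; apply/eqP.
apply: (cont01_ae0 (cont01_sub cF cG)) x01.
by apply: filterS FG => y FG yI; rewrite FG// subrr.
Qed.

Lemma abscont_deriv_unique F f g : abscont F f -> abscont F g -> ae01 f g.
Proof.
move=> [Lf Hf] [Lg Hg].
have H : ae01 (fun x => f x - g x) (fun=> 0).
  apply: prim_eq0_ae => [|x x01]; first exact: L2B.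
  rewrite primB; [|exact: L2_int1|exact: L2_int1].
  by apply/eqP; rewrite subr_eq0 -(inj_eq (addrI (F 0))) -Hf// -Hg.
by apply: filterS H => x H xI; apply/eqP; rewrite -subr_eq0 H.
Qed.

Lemma ae01_meas_sub f g : L2 f -> ae01 f g -> forall phi, L2 phi -> meas01 g ->
  int01 (fun x => f x * phi x) = int01 (fun x => g x * phi x).
Proof.
move=> Lf fg phi Lphi mg; apply: int01_ae.
- by apply: meas01M; exact: L2_meas.
- by apply: meas01M => //; exact: L2_meas.
by apply: filterS fg => x fg xI; rewrite fg.
Qed.

Lemma weak_derivative_ae f F g : L2 f -> L2 F -> ae01 f F ->
  weak_derivative F g -> weak_derivative f g.
Proof.
move=> Lf LF fF [Lg Hg]; split=> // phi tphi; rewrite -Hg//.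
apply: ae01_meas_sub => //; last exact: L2_meas.
exact/cont01_L2/smooth_cont01/smooth_derive/test_fun_smooth.
Qed.

(** [sobolev f F f'] says that [f] is in [H1] with continuous representative [F]
    and weak derivative [f']. *)
Definition sobolev f F g := [/\ meas01 f, ae01 f F & abscont F g].

Lemma abscont_L2 F f : abscont F f -> L2 F.
Proof. by move=> HF; exact: cont01_L2 (AC_cont HF). Qed.

Lemma sobolev_L2 f F g : sobolev f F g -> L2 f.
Proof. by move=> [mf fF HF]; exact: L2_ae mf (ae01_sym fF) (abscont_L2 HF). Qed.

Lemma H1_sobolev f : H1 f -> exists F g, sobolev f F g.
Proof.
move=> [Lf [g Hg]]; have [F HF fF] := weak_derivative_abscont Lf Hg.
by exists F, g; split => //; exact: L2_meas.
Qed.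

Lemma sobolev_weak f F g : sobolev f F g -> weak_derivative f g.
Proof.
move=> Hf; have [mf fF HF] := Hf.
apply: weak_derivative_ae fF _; [exact: sobolev_L2 Hf|exact: abscont_L2 HF|].
exact: abscont_weak_derivative.
Qed.

Lemma sobolev_H1 f F g : sobolev f F g -> H1 f.
Proof.
by move=> Hf; split; [exact: sobolev_L2 Hf|exists g; exact: sobolev_weak Hf].
Qed.

Lemma sobolev_crep f F g : sobolev f F g -> forall x, 0 <= x <= 1 -> crep f x = F x.
Proof.
move=> [mf fF HF]; have cF := AC_cont HF.
have [] : [set g : R -> R | {within `[0, 1], continuous g} /\ ae01 f g] (crep f).
  by apply: xgetPex; exists F.
move=> cc fc; apply: cont01_ae_eq => //.
exact: ae01_trans (ae01_sym fc) fF.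
Qed.

Lemma sobolev_wderiv f F g : sobolev f F g ->
  weak_derivative f (wderiv f) /\ ae01 (wderiv f) g.
Proof.
move=> Hf; have W : weak_derivative f (wderiv f).
  by apply: (@xgetPex _ _ [set g | weak_derivative f g]); exists g; exact: sobolev_weak Hf.
split => //; have [G HG fG] := weak_derivative_abscont (sobolev_L2 Hf) W.
have [mf fF HF] := Hf.
apply: (abscont_deriv_unique _ HF); apply: (AC_eq _ HG) => x x01.
apply: cont01_ae_eq => //; [exact: AC_cont HG|exact: AC_cont HF|].
exact: ae01_trans (ae01_sym fG) fF.
Qed.

Lemma sobolev_wderiv_L2 f F g : sobolev f F g -> L2 (wderiv f).
Proof. by move=> /sobolev_wderiv[[]]. Qed.

End SobolevFacts.

#[local] Hint Resolve measurable_I01 : core.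

(** * Completeness of the space of square-integrable functions *)
Section Completeness.
Variable R : realType.
Implicit Types (f g h : R -> R) (x y : R).

Local Notation mR := (measurableTypeR R).
Local Notation I01 := (`]0, 1[%classic : set mR).

Definition nrm2 f := int01 (fun x => f x ^+ 2).

Lemma int_int01 f : int1 f -> (\int[leb R]_(x in I01) (f x)%:E = (int01 f)%:E)%E.
Proof. by move=> fi; rewrite /int01 /Rintegral fineK//; exact: integrable_fin_num. Qed.

(** Riesz-Fischer for a rapidly Cauchy sequence: the increments are summable
    almost everywhere by monotone convergence. *)
Lemma rapid_cauchy_ae_cvg (v : nat -> R -> R) : (forall k, L2 (v k)) ->
  (forall k, nrm2 (fun x => v k.+1 x - v k x) <= (4^-1) ^+ k) ->
  exists2 u : R -> R, meas01 u &
    {ae leb R, forall x, I01 x -> v k x @[k --> \oo] --> u x}.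
Proof.
move=> Lv Hv; pose d k x : R := `|v k.+1 x - v k x|.
have Ld k : L2 (fun x => v k.+1 x - v k x) by exact: L2B.
have id_ k : int1 (d k) by exact/int1_norm/L2_int1.
have d0 k x : (0 <= (d k x)%:E)%E by rewrite lee_fin /d.
have md k : measurable_fun I01 (fun x : mR => (d k x)%:E).
  by apply/measurable_EFinP; exact: int1_meas.
have Id k : int01 (d k) <= (2^-1) ^+ k.
  have := int01_CS (f := d k) (g := fun=> 1).
  have Ldk : L2 (d k).
    split; first exact: int1_meas.
    by apply: int1_in (L2_sqr (Ld k)) => x _; rewrite real_normK ?num_real.
  move=> /(_ Ldk (L2_cst 1)).
  have -> : int01 (fun x => d k x * 1) = int01 (d k).
    by apply: int01_in => x _; rewrite mulr1.
  have -> : int01 (fun x => 1 ^+ 2 : R) = 1.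
    by rewrite -[RHS]int01_cst; apply: int01_in => x _; rewrite expr1n.
  have -> : int01 (fun x => d k x ^+ 2) = nrm2 (fun x => v k.+1 x - v k x).
    by apply: int01_in => x _; rewrite real_normK ?num_real.
  rewrite mulr1 => /le_trans /(_ (Hv k)) H.
  rewrite -(@ler_pXn2r _ 2) ?nnegrE ?exprn_ge0 ?invr_ge0//; last first.
    by apply: int01_ge0 => x _; exact: normr_ge0.
  apply: le_trans H _; rewrite exprAC; rewrite (_ : (2^-1) ^+ 2 = 4^-1 :> R)//.
  by rewrite expr2 -invfM -natrM.
pose S x := (\sum_(0 <= k <oo) (d k x)%:E)%E.
have mS : measurable_fun I01 (S : mR -> \bar R).
  by apply: (@ge0_emeasurable_sum _ _ _ I01 (fun k x => (d k x)%:E) xpredT).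
have iS : (leb R).-integrable I01 S.
  apply/integrableP; split => //.
  have -> : (\int[leb R]_(x in I01) `|S x| = \sum_(0 <= k <oo) (int01 (d k))%:E)%E.
    transitivity (\int[leb R]_(x in I01) S x)%E.
      by apply: eq_integral => x _; rewrite gee0_abs// nneseries_ge0.
    rewrite integral_nneseries//; apply: eq_eseriesr => k _.
    exact: int_int01.
  apply: (@le_lt_trans _ _ 2%:E); last exact: ltry.
  apply: lime_le.
    by apply: is_cvg_nneseries => k _ _; rewrite lee_fin int01_ge0// => x _; exact: normr_ge0.
  apply: nearW => n; rewrite sumEFin lee_fin.
  have : \sum_(0 <= k < n) int01 (d k) <= 2 - 2 * (2^-1) ^+ n.
    elim: n => [|n IH]; first by rewrite big_nil expr0; lra.
    rewrite big_nat_recr//=; have := Id n; rewrite exprS; move: IH; lra.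
  move=> /le_trans; apply; rewrite gerBl mulr_ge0// exprn_ge0// invr_ge0//.
pose A : set mR := [set x | (S x < +oo)%E].
have mA : measurable (I01 `&` A).
  exact: (emeasurable_fun_infty_o (@measurable_I01 R) mS).
pose g k x : R := v k x * \1_(I01 `&` A) x.
have cvg_v x : A x -> cvgn (v^~ x).
  move=> Ax; have -> : v^~ x = (fun n => v 0%N x + series (telescope (v^~ x)) n).
    by apply/funext => n; rewrite -eq_sum_telescope.
  apply: is_cvgD; first exact: is_cvg_cst.
  apply: normed_cvg; apply: nondecreasing_is_cvgn.
    by apply: nondecreasing_series => n _ _; exact: normr_ge0.
  exists (fine (S x)) => _ [n _ <-].
  rewrite -lee_fin fineK; last first.
    by rewrite ge0_fin_numE// nneseries_ge0.
  rewrite /series/= -sumEFin.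
  by apply: (@nneseries_lim_ge _ (fun k => (d k x)%:E) xpredT 0 n).
pose u x := lim (g k x @[k --> \oo]).
have cvg_g x : g k x @[k --> \oo] --> u x.
  suff : cvgn (fun k => g k x) by [].
  rewrite /g indicE; case: (boolP (x \in I01 `&` A)) => [|_].
    rewrite inE => -[_ Ax]; under eq_fun do rewrite mulr1.
    exact: cvg_v.
  by under eq_fun do rewrite mulr0; exact: is_cvg_cst.
exists u.
  apply: (@measurable_fun_cvg _ _ _ I01 g) => [k|x _]; last exact: cvg_g.
  apply: measurable_funM; first exact: L2_meas.
  exact: measurable_indic.
have := integrable_ae (@measurable_I01 R) iS.
apply: filterS => x H xI; have := H xI.
rewrite fin_numE => /andP[_]; rewrite -ltey => Ax.
have := cvg_g x; rewrite /g indicE mem_set//; under eq_fun do rewrite mulr1.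
by [].
Qed.

(** The pointwise limit inherits the bounds on distances by Fatou's lemma; this gives at
    once its square-integrability and the convergence in mean. *)
Lemma rapid_cauchy_cvg (v : nat -> R -> R) : (forall k, L2 (v k)) ->
  (forall k l, (k <= l)%N -> nrm2 (fun x => v l x - v k x) <= (4^-1) ^+ k) ->
  exists2 u : R -> R, L2 u & forall (w : R -> R) (C : R), L2 w ->
    (exists K, forall k, (K <= k)%N -> nrm2 (fun x => w x - v k x) <= C) ->
    nrm2 (fun x => w x - u x) <= C.
Proof.
move=> Lv Hv; have [u mu cu] := rapid_cauchy_ae_cvg Lv (fun k => Hv k k.+1 (leqnSn k)).
have mwu w : L2 w -> meas01 (fun x => w x - u x).
  move=> Lw; apply: meas01D; first exact: L2_meas.
  by apply: meas01_in (meas01M (meas01_cst (-1)) mu) => x _; rewrite mulN1r.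
have mwu2 w : L2 w -> meas01 (fun x => (w x - u x) ^+ 2).
  by move=> Lw; exact: meas01M (mwu w Lw) (mwu w Lw).
have key (w : R -> R) (C : R) : L2 w ->
    (exists K, forall k, (K <= k)%N -> nrm2 (fun x => w x - v k x) <= C) ->
    (\int[leb R]_(x in I01) ((w x - u x) ^+ 2)%:E <= C%:E)%E.
  move=> Lw [K HK].
  pose F k x := ((w x - v (k + K)%N x) ^+ 2)%:E.
  have iF k : int1 (fun x => (w x - v (k + K)%N x) ^+ 2).
    exact: L2_sqr (L2B Lw (Lv _)).
  have mF k : measurable_fun I01 (F k : mR -> \bar R).
    by apply/measurable_EFinP; exact: int1_meas.
  have Fat := @fatou _ _ _ (leb R) I01 (@measurable_I01 R) F mF
    (fun k x _ => sqr_ge0 _).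
  apply: (@le_trans _ _ (\int[leb R]_(x in I01) limn_einf (F^~ x))%E).
    rewrite le_eqVlt; apply/orP; left; apply/eqP; apply: ae_eq_integral => //.
    - by apply/measurable_EFinP; exact: mwu2.
    - apply: (@emeasurable_fun_cvg _ _ _ I01 (fun k x => einfs (F^~ x) k)) => [k|x _].
        exact: measurable_fun_einfs.
      by rewrite limn_einf_lim; exact: is_cvg_einfs.
    apply: filterS cu => x cu xI; symmetry.
    apply: (cvg_limn_einf_sup _).1; apply: cvg_EFin; first exact: nearW.
    apply: (@cvg_comp _ _ _ (fun k => w x - v (k + K)%N x) (fun y : R => y ^+ 2)
      _ (nbhs (w x - u x))).
      apply: cvgB; first exact: cvg_cst.
      by rewrite (cvg_shiftn K (v^~ x)); exact: cu.
    exact: exprn_continuous.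
  apply: le_trans Fat _; rewrite limn_einf_lim; apply: lime_le; first exact: is_cvg_einfs.
  apply: nearW => n; apply: le_trans (_ : (\int[leb R]_(x in I01) F n x <= _)%E).
    by apply: ereal_inf_lbound; exists n => //=.
  by rewrite int_int01// lee_fin; apply: HK; exact: leq_addl.
have int_fin (w : R -> R) (C : R) : L2 w ->
    (\int[leb R]_(x in I01) ((w x - u x) ^+ 2)%:E <= C%:E)%E ->
    int1 (fun x => (w x - u x) ^+ 2).
  move=> Lw H; apply/integrableP; split; first by apply/measurable_EFinP; exact: mwu2.
  apply: le_lt_trans (ltry C); apply: le_trans H; rewrite le_eqVlt; apply/orP; left.
  by apply/eqP/eq_integral => x _; rewrite gee0_abs// lee_fin sqr_ge0.
exists u.
  have K0 : exists K, forall k, (K <= k)%N -> nrm2 (fun x => v 0%N x - v k x) <= 1.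
    exists 0%N => k _; have := Hv 0%N k (leq0n _); rewrite expr0; apply: le_trans.
    by rewrite le_eqVlt; apply/orP; left; apply/eqP/int01_in => x _; ring.
  have i0 := int_fin _ _ (Lv 0%N) (key _ _ (Lv 0%N) K0).
  have L0 : L2 (fun x => v 0%N x - u x) by split => //; exact: mwu.
  by apply: L2_in (L2B (Lv 0%N) L0) => x _; rewrite subKr.
move=> w C Lw HK; have H := key w C Lw HK.
by rewrite -lee_fin -int_int01//; exact: int_fin H.
Qed.

(** The space is complete: some subsequence is rapidly Cauchy. *)
Lemma L2_complete (v : nat -> R -> R) : (forall k, L2 (v k)) ->
  (forall e : R, 0 < e -> exists N, forall k l, (N <= k)%N -> (N <= l)%N ->
     nrm2 (fun x => v k x - v l x) <= e) ->
  exists2 u : R -> R, L2 u & forall e : R, 0 < e ->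
     exists N, forall k, (N <= k)%N -> nrm2 (fun x => v k x - u x) <= e.
Proof.
move=> Lv Hv; have e0 k : 0 < (4^-1 : R) ^+ k by rewrite exprn_gt0// invr_gt0.
have [N HN] := choice (fun k => Hv _ (e0 k)).
pose M k := (\sum_(i < k.+1) N i + k)%N.
have NM k : (N k <= M k)%N by rewrite /M big_ord_recr/= addnAC leq_addl.
have Mmono k l : (k <= l)%N -> (M k <= M l)%N.
  move=> /subnK <-; elim: (l - k)%N => [//|j IH]; apply: leq_trans IH _.
  by rewrite addSn /M [X in (_ <= X + _)%N]big_ord_recr/= leq_add// leq_addr.
have [|u Lu Hu] := @rapid_cauchy_cvg (fun k => v (M k)) (fun k => Lv (M k)).
  by move=> k l kl; apply: HN => //; apply: leq_trans (NM k) _ => //; exact: Mmono.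
exists u => // e /Hv[K HK]; exists K => k Kk; apply: Hu => //.
exists K => j Kj; apply: HK => //; apply: leq_trans Kj _; exact: leq_addl.
Qed.

End Completeness.

(** * Hilbert spaces up to null vectors *)

(** A real vector space with a positive semi-definite inner product, complete for
    the associated seminorm. The form is not assumed definite: this lets square-integrable
    functions be used without passing to classes modulo almost everywhere equality. *)
Record hilbert (R : realType) (E : lmodType R) := Hilbert {
  ip : E -> E -> R;
  ipC : forall x y, ip x y = ip y x;
  ipDl : forall x y z, ip (x + y) z = ip x z + ip y z;
  ipZl : forall a x z, ip (a *: x) z = a * ip x z;
  ip_ge0 : forall x, 0 <= ip x x;
  ip_complete : forall u : nat -> E,
    (forall e : R, 0 < e -> exists N, forall k l, (N <= k)%N -> (N <= l)%N ->
      ip (u k - u l) (u k - u l) <= e) ->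
    exists x, forall e : R, 0 < e -> exists N, forall k, (N <= k)%N ->
      ip (u k - x) (u k - x) <= e }.

Section HilbertTheory.
Variables (R : realType) (E : lmodType R) (H : hilbert E).
Implicit Types (x y z f g : E) (a b e r t : R) (p q : {poly R}).

Local Notation "<< x , y >>" := (ip H x y) (at level 0, format "<< x ,  y >>").

Lemma ipDr x y z : <<z, x + y>> = <<z, x>> + <<z, y>>.
Proof. by rewrite ipC ipDl !(ipC _ z). Qed.

Lemma ipZr a x z : <<z, a *: x>> = a * <<z, x>>.
Proof. by rewrite ipC ipZl (ipC _ z). Qed.

Lemma ipNl x z : <<- x, z>> = - <<x, z>>.
Proof. by rewrite -scaleN1r ipZl mulN1r. Qed.

Lemma ipNr x z : <<z, - x>> = - <<z, x>>.
Proof. by rewrite -scaleN1r ipZr mulN1r. Qed.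

Lemma ipBl x y z : <<x - y, z>> = <<x, z>> - <<y, z>>.
Proof. by rewrite ipDl ipNl. Qed.

Lemma ipBr x y z : <<z, x - y>> = <<z, x>> - <<z, y>>.
Proof. by rewrite ipDr ipNr. Qed.

Lemma ip0l z : <<0, z>> = 0.
Proof. by rewrite -(scale0r 0) ipZl mul0r. Qed.

Lemma ip_suml (I : Type) (s : seq I) (P : pred I) (F : I -> E) z :
  <<\sum_(i <- s | P i) F i, z>> = \sum_(i <- s | P i) <<F i, z>>.
Proof.
by elim/big_rec2 : _ => [|i a b _ <-]; [exact: ip0l|rewrite ipDl].
Qed.

Lemma form_CS (B : E -> E -> R) : (forall x y, B x y = B y x) ->
  (forall x y z, B (x + y) z = B x z + B y z) ->
  (forall a x z, B (a *: x) z = a * B x z) -> (forall x, 0 <= B x x) ->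
  forall x y, B x y ^+ 2 <= B x x * B y y.
Proof.
move=> BC BD BZ B0 x y.
have D t : 0 <= B x x + t * (2 * B x y) + t ^+ 2 * B y y.
  have := B0 (x + t *: y).
  by rewrite BD [B x _]BC [B (t *: y) _]BC !BD !BZ ![B _ (t *: y)]BC !BZ (BC y x); lra.
have := B0 y; rewrite le_eqVlt => /predU1P[b0|b0]; last first.
  have := D (- B x y / B y y); rewrite expr_div_n sqrrN.
  have -> : B x x + - B x y / B y y * (2 * B x y) + B x y ^+ 2 / B y y ^+ 2 * B y y
      = B x x - B x y ^+ 2 / B y y by field; exact: lt0r_neq0.
  by rewrite subr_ge0 ler_pdivrMr.
rewrite -b0 mulr0; have [->|p0] := eqVneq (B x y) 0; first by rewrite expr0n.
have := D (- (B x x + 1) / (2 * B x y)); rewrite -b0 mulr0 addr0.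
have -> : B x x + - (B x x + 1) / (2 * B x y) * (2 * B x y) = - 1 by field.
by rewrite ler0N1.
Qed.

Definition hnrm x : R := Num.sqrt <<x, x>>.

Local Notation nrm := hnrm.

Lemma nrm_ge0 x : 0 <= nrm x. Proof. exact: sqrtr_ge0. Qed.
Hint Resolve nrm_ge0 : core.

Lemma nrm_sqr x : nrm x ^+ 2 = <<x, x>>.
Proof. by rewrite sqr_sqrtr ?ip_ge0. Qed.

Lemma nrm_le x a : 0 <= a -> (nrm x <= a) = (<<x, x>> <= a ^+ 2).
Proof.
by move=> a0; rewrite -nrm_sqr -(@ler_pXn2r _ 2) ?nnegrE.
Qed.

Lemma ip_nrm x y : `|<<x, y>>| <= nrm x * nrm y.
Proof.
rewrite -(@ler_pXn2r _ 2) ?nnegrE ?mulr_ge0// real_normK ?num_real//.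
rewrite exprMn !nrm_sqr; apply: form_CS; [exact: ipC|exact: ipDl|exact: ipZl|exact: ip_ge0].
Qed.

Lemma ler_nrmD x y : nrm (x + y) <= nrm x + nrm y.
Proof.
rewrite nrm_le ?addr_ge0// ipDl !ipDr sqrrD !nrm_sqr (ipC _ y x).
have := ler_norm <<x, y>>; have := ip_nrm x y; lra.
Qed.

Lemma nrmZ a x : nrm (a *: x) = `|a| * nrm x.
Proof. by rewrite /nrm ipZl ipZr mulrA -expr2 sqrtrM ?sqr_ge0// sqrtr_sqr. Qed.

Lemma nrmN x : nrm (- x) = nrm x.
Proof. by rewrite -scaleN1r nrmZ normrN1 mul1r. Qed.

Lemma nrm0 : nrm 0 = 0. Proof. by rewrite /nrm ip0l sqrtr0. Qed.

Lemma nrmB x y : nrm (x - y) = nrm (y - x).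
Proof. by rewrite -nrmN opprB. Qed.

Lemma ler_nrmB x y : nrm (x - y) <= nrm x + nrm y.
Proof. by rewrite -(nrmN y); exact: ler_nrmD. Qed.

Lemma ler_nrm_trans x y z : nrm (x - z) <= nrm (x - y) + nrm (y - z).
Proof. by have := ler_nrmD (x - y) (y - z); rewrite addrA subrK. Qed.

Definition hnull x := nrm x = 0.

Local Notation null := hnull.

Lemma null_ip x z : null x -> <<x, z>> = 0.
Proof.
move=> x0; apply/eqP; rewrite -normr_le0; apply: le_trans (ip_nrm _ _) _.
by rewrite x0 mul0r.
Qed.

Lemma ip_null x : (forall z, <<x, z>> = 0) -> null x.
Proof. by move=> x0; rewrite /null /nrm x0 sqrtr0. Qed.

Lemma nrm_le0 x : nrm x <= 0 -> null x.
Proof. by move=> x0; apply/eqP; rewrite eq_le x0 nrm_ge0. Qed.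

Lemma null_small x : (forall e, 0 < e -> nrm x <= e) -> null x.
Proof. by move=> h; apply: nrm_le0; apply/ler_addgt0Pr => e /h; rewrite add0r. Qed.

Lemma null0 : null 0. Proof. exact: nrm0. Qed.

Lemma nullD x y : null x -> null y -> null (x + y).
Proof.
by move=> x0 y0; apply: nrm_le0; apply: le_trans (ler_nrmD _ _) _; rewrite x0 y0 addr0.
Qed.

Lemma nullZ a x : null x -> null (a *: x).
Proof. by move=> x0; rewrite /null nrmZ x0 mulr0. Qed.

Lemma nullN x : null x -> null (- x).
Proof. by rewrite /null nrmN. Qed.

Lemma nullB x y : null x -> null y -> null (x - y).
Proof. by move=> x0 y0; apply: nullD => //; exact: nullN. Qed.

(** ** Sequences *)

Definition htends (u : nat -> E) x :=
  forall e, 0 < e -> \forall n \near \oo, nrm (u n - x) <= e.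

Local Notation tends := htends.

Lemma cauchy_tends (u : nat -> E) :
  (forall e, 0 < e -> exists N, forall k l, (N <= k)%N -> (N <= l)%N ->
     nrm (u k - u l) <= e) -> exists x, tends u x.
Proof.
move=> Hu; have [|x Hx] := @ip_complete _ _ H u.
  move=> e e0; have [|N HN] := Hu (Num.sqrt e); first by rewrite sqrtr_gt0.
  exists N => k l Nk Nl; have := HN k l Nk Nl; rewrite nrm_le ?sqrtr_ge0//.
  by rewrite sqr_sqrtr ?(ltW e0).
exists x => e e0; have [|N HN] := Hx (e ^+ 2); first by rewrite exprn_gt0.
exists N => // n /= Nn; rewrite nrm_le ?(ltW e0)//; exact: HN.
Qed.

Lemma tends_unique u x y : tends u x -> tends u y -> null (x - y).
Proof.
move=> ux uy; apply: null_small => e e0.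
have e2 : 0 < e / 2 by rewrite divr_gt0.
near \oo => n; apply: le_trans (ler_nrm_trans x (u n) y) _.
rewrite nrmB (splitr e) lerD//; first by near: n; exact: ux.
by near: n; exact: uy.
Unshelve. all: by end_near. Qed.

Lemma tendsD u v x y : tends u x -> tends v y -> tends (fun n => u n + v n) (x + y).
Proof.
move=> ux vy e e0; have e2 : 0 < e / 2 by rewrite divr_gt0.
near=> n; rewrite opprD addrACA; apply: le_trans (ler_nrmD _ _) _.
rewrite (splitr e) lerD//; first by near: n; exact: ux.
by near: n; exact: vy.
Unshelve. all: by end_near. Qed.

Lemma tends_bnd (L : E -> E) (C : R) : (forall x y, L (x - y) = L x - L y) ->
  (forall x, nrm (L x) <= C * nrm x) ->
  forall u x, tends u x -> tends (fun n => L (u n)) (L x).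
Proof.
move=> LB LC u x ux e e0; pose D := `|C| + 1.
have D0 : 0 < D by rewrite ltr_wpDl.
have eD : 0 < e / D by rewrite divr_gt0.
near=> n; rewrite -LB; apply: le_trans (LC _) _.
apply: (@le_trans _ _ (D * nrm (u n - x))).
  by rewrite ler_wpM2r// (le_trans (ler_norm _))// lerDl.
by rewrite mulrC -ler_pdivlMr//; near: n; exact: ux.
Unshelve. all: by end_near. Qed.

Lemma tendsZ a u x : tends u x -> tends (fun n => a *: u n) (a *: x).
Proof.
apply: (@tends_bnd (fun x => a *: x) `|a|) => y; first by move=> z; rewrite scalerBr.
by rewrite nrmZ.
Qed.

Lemma tends_ext u v x : (forall n, u n = v n) -> tends u x -> tends v x.
Proof. by move=> /funext ->. Qed.

Lemma tends_null u x y : null (x - y) -> tends u x -> tends u y.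
Proof.
move=> xy ux e e0; near=> n; apply: le_trans (ler_nrm_trans _ x _) _.
by rewrite xy addr0; near: n; exact: ux.
Unshelve. all: by end_near. Qed.

Lemma tends_nrm_le u x (C : R) : tends u x -> (\forall n \near \oo, nrm (u n) <= C) ->
  nrm x <= C.
Proof.
move=> ux uC; apply/ler_addgt0Pr => e e0.
near \oo => n; rewrite -[x](subrK (u n)) addrC; apply: le_trans (ler_nrmD _ _) _.
rewrite lerD//; first by near: n.
by rewrite nrmB; near: n; exact: ux.
Unshelve. all: by end_near. Qed.

Lemma tends_ip u x z : tends u x -> <<u n, z>> @[n --> \oo] --> <<x, z>>.
Proof.
move=> ux; apply/cvgrPdist_le => e e0; near=> n.
rewrite -ipBl; apply: le_trans (ip_nrm _ _) _; rewrite nrmB.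
apply: (@le_trans _ _ (nrm (u n - x) * (nrm z + 1))); first by rewrite ler_wpM2l// lerDl.
rewrite -ler_pdivlMr ?ltr_wpDl//; near: n; apply: ux.
by rewrite divr_gt0// ltr_wpDl.
Unshelve. all: by end_near. Qed.

End HilbertTheory.
#[global] Hint Extern 0 (is_true (_ <= hnrm _ _)) => solve [exact: nrm_ge0] : core.

(** * Polynomial calculus of a positive contraction *)

Record pos_contraction (R : realType) (E : lmodType R) (H : hilbert E) (K : E -> E) :
    Prop := PosContraction {
  opD : forall x y, K (x + y) = K x + K y;
  opZ : forall a x, K (a *: x) = a *: K x;
  op_sym : forall x y, ip H (K x) y = ip H x (K y);
  op_ge0 : forall x, 0 <= ip H (K x) x;
  op_le1 : forall x, ip H (K x) x <= ip H x x }.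

Section PolynomialCalculus.
Variables (R : realType) (E : lmodType R) (H : hilbert E) (K : E -> E).
Hypothesis HK : pos_contraction H K.
Implicit Types (x y z f g : E) (a b e r t : R) (p q : {poly R}).

Local Notation "<< x , y >>" := (ip H x y) (at level 0, format "<< x ,  y >>").
Local Notation nrm := (hnrm H).

Definition act p y : E := \sum_(i < size p) p`_i *: iter i K y.

Lemma act_wide n p y : (size p <= n)%N -> act p y = \sum_(i < n) p`_i *: iter i K y.
Proof.
move=> pn; rewrite /act (big_ord_widen n (fun i => p`_i *: iter i K y) pn).
rewrite big_mkcond; apply: eq_bigr => i _; case: ltnP => // /(nth_default 0) ->.
by rewrite scale0r.
Qed.

Lemma opN x : K (- x) = - K x.
Proof. by rewrite -scaleN1r (opZ HK) scaleN1r. Qed.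

Lemma op0 : K 0 = 0.
Proof. by have := opZ HK 0 0; rewrite !scale0r. Qed.

Lemma op_sum (I : Type) (s : seq I) (F : I -> E) :
  K (\sum_(i <- s) F i) = \sum_(i <- s) K (F i).
Proof. by elim/big_rec2 : _ => [|i a b _ <-]; [exact: op0|rewrite (opD HK)]. Qed.

Lemma iter_opD n x y : iter n K (x + y) = iter n K x + iter n K y.
Proof. by elim: n => //= n ->; rewrite (opD HK). Qed.

Lemma iter_opZ n a x : iter n K (a *: x) = a *: iter n K x.
Proof. by elim: n => //= n ->; rewrite (opZ HK). Qed.

Lemma iter_sym n x y : <<iter n K x, y>> = <<x, iter n K y>>.
Proof. by elim: n y => //= n IH y; rewrite (op_sym HK) IH -iterSr. Qed.

Lemma actDl p q y : act (p + q) y = act p y + act q y.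
Proof.
pose n := maxn (size p) (size q).
rewrite (@act_wide n p) ?leq_maxl// (@act_wide n q) ?leq_maxr//.
rewrite (@act_wide n (p + q)) ?size_polyD// -big_split/=.
by apply: eq_bigr => i _; rewrite coefD scalerDl.
Qed.

Lemma actZl a p y : act (a *: p) y = a *: act p y.
Proof.
rewrite (@act_wide (size p)) ?size_scale_leq// /act scaler_sumr.
by apply: eq_bigr => i _; rewrite coefZ scalerA.
Qed.

Lemma actNl p y : act (- p) y = - act p y.
Proof. by rewrite -[- p]scaleN1r actZl scaleN1r. Qed.

Lemma actBl p q y : act (p - q) y = act p y - act q y.
Proof. by rewrite actDl actNl. Qed.

Lemma act0l y : act 0 y = 0.
Proof. by rewrite /act size_poly0 big_ord0. Qed.

Lemma act_suml (I : Type) (s : seq I) (F : I -> {poly R}) y :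
  act (\sum_(i <- s) F i) y = \sum_(i <- s) act (F i) y.
Proof. by elim/big_rec2 : _ => [|i a b _ <-]; [exact: act0l|rewrite actDl]. Qed.

Lemma actDr p x y : act p (x + y) = act p x + act p y.
Proof.
by rewrite /act -big_split; apply: eq_bigr => i _; rewrite iter_opD scalerDr.
Qed.

Lemma actZr p a y : act p (a *: y) = a *: act p y.
Proof.
by rewrite /act scaler_sumr; apply: eq_bigr => i _; rewrite iter_opZ !scalerA mulrC.
Qed.

Lemma actNr p y : act p (- y) = - act p y.
Proof. by rewrite -[- y]scaleN1r actZr scaleN1r. Qed.

Lemma actBr p x y : act p (x - y) = act p x - act p y.
Proof. by rewrite actDr actNr. Qed.

Lemma act_sym p x y : <<act p x, y>> = <<x, act p y>>.
Proof.
rewrite /act ip_suml [RHS]ipC ip_suml; apply: eq_bigr => i _.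
by rewrite !ipZl iter_sym ipC.
Qed.

Lemma actC a y : act a%:P y = a *: y.
Proof.
rewrite (@act_wide 1) ?size_polyC_leq1// big_ord1/= coefC/=.
by [].
Qed.

Lemma actMX p y : act (p * 'X) y = act p (K y).
Proof.
have [->|p0] := eqVneq p 0; first by rewrite mul0r !act0l.
rewrite /act size_mulX// big_ord_recl coefMX/= scale0r add0r.
by apply: eq_bigr => i _; rewrite coefMX/= -iterSr.
Qed.

Lemma actX y : act 'X y = K y.
Proof. by rewrite -['X]mul1r actMX -[1]/(1%:P) actC scale1r. Qed.

Lemma act_op p y : act p (K y) = K (act p y).
Proof.
by rewrite /act op_sum; apply: eq_bigr => i _; rewrite (opZ HK) -iterSr.
Qed.

Lemma actM p q y : act (p * q) y = act p (act q y).
Proof.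
elim/poly_ind: p y => [|p c IH] y; first by rewrite mul0r !act0l.
rewrite mulrDl !actDl mulrAC !actMX IH act_op; congr (_ + _).
by rewrite mul_polyC actZl actC.
Qed.

(** ** Positivity *)

Definition act_pos p := forall y, 0 <= <<act p y, y>>.

Lemma poly_neg_near p a : p.[a] < 0 ->
  exists2 d : R, 0 < d & forall x : R, `|a - x| < d -> p.[x] < 0.
Proof.
move=> pa; have := @continuous_horner _ p a; move/cvgrPdist_lt.
have npa : 0 < - p.[a] by rewrite oppr_gt0.
move=> /(_ _ npa)[/= d d0 Hd]; exists d => // x xd; have := Hd x xd.
have := ler_norm (- (p.[a] - p.[x])); rewrite normrN /=; lra.
Qed.

Lemma poly_ge0_closure p a : 0 <= a <= 1 ->
  (forall x : R, 0 <= x <= 1 -> x != a -> 0 <= p.[x]) -> 0 <= p.[a].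
Proof.
move=> /andP[a0 a1] pge; rewrite leNgt; apply/negP => pa.
have [d d0 Hd] := poly_neg_near pa.
suff [x [x01 xa xd]] : exists x : R, [/\ 0 <= x <= 1, x != a & `|a - x| < d].
  by have := Hd x xd; rewrite ltNge pge.
have [ah|ah] := leP a (1 / 2).
  pose h := Num.min (1 / 2) (d / 2).
  have h0 : 0 < h by rewrite lt_min !divr_gt0.
  have h1 : h <= 1 / 2 by rewrite ge_min lexx.
  have h2 : h <= d / 2 by rewrite ge_min lexx orbT.
  exists (a + h); split; first by apply/andP; split; lra.
    by rewrite gt_eqF// ltrDl.
  by rewrite opprD addrA subrr sub0r normrN gtr0_norm//; lra.
pose h := Num.min (1 / 2) (d / 2).
have h0 : 0 < h by rewrite lt_min !divr_gt0.
have h1 : h <= 1 / 2 by rewrite ge_min lexx.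
have h2 : h <= d / 2 by rewrite ge_min lexx orbT.
exists (a - h); split; first by apply/andP; split; lra.
  by rewrite lt_eqF// gtrBl.
by rewrite subKr gtr0_norm//; lra.
Qed.

(** Positivity of the four products is what survives multiplication by [X] or
    by [1 - X], since [X * X] and [(1 - X) * (1 - X)] are squares. *)
Let pos4 p := [/\ act_pos p, act_pos ('X * p), act_pos ((1 - 'X) * p) &
  act_pos ('X * (1 - 'X) * p)].

Let pos_sqr p q : act_pos p -> act_pos (q ^+ 2 * p).
Proof.
move=> pp y; rewrite (_ : q ^+ 2 * p = q * (p * q)); last by ring.
by rewrite !actM act_sym.
Qed.

Let pos_add p q : act_pos p -> act_pos q -> act_pos (p + q).
Proof. by move=> pp pq y; rewrite actDl ipDl addr_ge0. Qed.

Let pos4_add p q : pos4 p -> pos4 q -> pos4 (p + q).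
Proof.
by move=> [p1 p2 p3 p4] [q1 q2 q3 q4]; split; rewrite ?[_ * (p + q)]mulrDr; exact: pos_add.
Qed.

Let pos4_const a : 0 <= a -> pos4 a%:P.
Proof.
move=> a0.
have P0 : act_pos a%:P by move=> y; rewrite actC ipZl mulr_ge0// ip_ge0.
have PX : act_pos ('X * a%:P).
  move=> y; rewrite mulrC mul_polyC actZl actX ipZl mulr_ge0//; exact: op_ge0 HK y.
have P1 : act_pos ((1 - 'X) * a%:P).
  move=> y; rewrite mulrC mul_polyC actZl actBl actX -[1]/(1%:P) actC scale1r ipZl ipBl.
  by rewrite mulr_ge0// subr_ge0; exact: op_le1 HK y.
split => //.
rewrite (_ : 'X * (1 - 'X) * a%:P = (1 - 'X) ^+ 2 * ('X * a%:P) + 'X ^+ 2 * ((1 - 'X) * a%:P)).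
  by apply: pos_add; exact: pos_sqr.
by ring.
Qed.

Let pos4_sqr p q : pos4 p -> pos4 (q ^+ 2 * p).
Proof.
move=> [p1 p2 p3 p4]; split; rewrite ?[_ * (q ^+ 2 * p)]mulrCA; exact: pos_sqr.
Qed.

Let pos4_X p : pos4 p -> pos4 ('X * p).
Proof.
move=> [p1 p2 p3 p4]; split => //.
- by rewrite mulrA -expr2; exact: pos_sqr.
- by rewrite mulrA [_ * 'X]mulrC.
- rewrite (_ : 'X * (1 - 'X) * ('X * p) = 'X ^+ 2 * ((1 - 'X) * p)); first exact: pos_sqr.
  by ring.
Qed.

Let pos4_1X p : pos4 p -> pos4 ((1 - 'X) * p).
Proof.
move=> [p1 p2 p3 p4]; split => //.
- by rewrite mulrA.
- by rewrite mulrA -expr2; exact: pos_sqr.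
- rewrite (_ : 'X * (1 - 'X) * ((1 - 'X) * p) = (1 - 'X) ^+ 2 * ('X * p)); first exact: pos_sqr.
  by ring.
Qed.

(** A polynomial that is nonnegative on [0, 1] is the sum of its minimum and of a
    polynomial with a root at the minimizer; the root splits off as [X], [1 - X]
    or a square, which lowers the degree. *)
Lemma act_pos_ge0 p : (forall x : R, 0 <= x <= 1 -> 0 <= p.[x]) -> act_pos p.
Proof.
suff : forall n p, (size p <= n)%N -> (forall x : R, 0 <= x <= 1 -> 0 <= p.[x]) -> pos4 p.
  by move=> Hs pge; have [] := Hs (size p) p (leqnn _) pge.
elim=> [|n IH] {}p sp pge.
  move: sp; rewrite leqn0 size_poly_eq0 => /eqP ->.
  by rewrite -[0]/(0%:P); exact: pos4_const.
have [a a01 Ha] : exists2 a : R, 0 <= a <= 1 & forall x : R, 0 <= x <= 1 -> p.[a] <= p.[x].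
  have cp : {within `[0, 1], continuous (horner p)}.
    by apply: continuous_subspaceT => x; exact: continuous_horner.
  have [a + Ha] := EVT_min ler01 cp; rewrite in_itv/= => a01.
  by exists a => // x x01; apply: Ha; rewrite in_itv.
have pa0 := pge a a01.
have : root (p - p.[a]%:P) a by rewrite rootE !hornerE subrr.
move=> /factor_theorem[q Eq].
have qge (x : R) : 0 <= x <= 1 -> 0 <= q.[x] * (x - a).
  move=> x01; have := Ha x x01; rewrite -subr_ge0.
  by have := congr1 (horner^~ x) Eq; rewrite !hornerE => ->.
have sq : (size q <= n)%N.
  have [->|q0] := eqVneq q 0; first by rewrite size_poly0.
  have : (size (p - p.[a]%:P)%R <= n.+1)%N.
    apply: leq_trans (size_polyD _ _) _; rewrite geq_max sp size_polyN.
    by apply: leq_trans (size_polyC_leq1 _) _.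
  by rewrite Eq size_Mmonic ?monicXsubC// size_XsubC addn2/=.
rewrite -(subrK p.[a]%:P p) addrC; apply: pos4_add; first exact: pos4_const.
rewrite Eq.
have [a0|an0] := eqVneq a 0.
  rewrite a0 subr0 mulrC; apply: pos4_X; apply: IH => //.
  have pos (x : R) : 0 <= x <= 1 -> x != 0 -> 0 <= q.[x].
    move=> /andP[x0 x1] xn0; have := qge x; rewrite x0 x1 a0 subr0 => /(_ isT).
    by rewrite pmulr_lge0// lt_neqAle eq_sym xn0.
  move=> x x01; have [->|] := eqVneq x 0; last exact: pos.
  by apply: (poly_ge0_closure _ pos); rewrite lexx ler01.
have [a1|an1] := eqVneq a 1.
  rewrite a1 (_ : q * _ = (1 - 'X) * (- q)); last by rewrite polyC1; ring.
  apply: pos4_1X; apply: IH; first by rewrite size_polyN.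
  have pos (x : R) : 0 <= x <= 1 -> x != 1 -> 0 <= (- q).[x].
    move=> /andP[x0 x1] xn1; have := qge x; rewrite x0 x1 a1 => /(_ isT).
    rewrite hornerN -mulrNN opprB pmulr_lge0// subr_gt0 lt_neqAle xn1 x1//.
  move=> x x01; have [->|] := eqVneq x 1; last exact: pos.
  by apply: (poly_ge0_closure _ pos); rewrite lexx ler01.
have pos (x : R) : 0 <= x <= 1 -> a < x -> 0 <= q.[x].
  by move=> x01 ax; have := qge x x01; rewrite pmulr_lge0// subr_gt0.
have neg (x : R) : 0 <= x <= 1 -> x < a -> q.[x] <= 0.
  by move=> x01 xa; have := qge x x01; rewrite nmulr_lge0// subr_lt0.
have {an0 an1} a01' : 0 < a < 1.
  by move: a01 => /andP[a0 a1]; rewrite !lt_neqAle eq_sym an0 a0 an1.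
have [a0 a1] := andP a01'.
have qa : root q a.
  rewrite rootE eq_le; apply/andP; split; rewrite leNgt; apply/negP => qa.
    have [|d d0 Hd] := @poly_neg_near (- q) a; first by rewrite hornerN oppr_lt0.
    pose h := Num.min (a / 2) (d / 2).
    have h0 : 0 < h by rewrite lt_min !divr_gt0.
    have h1 : h <= a / 2 by rewrite ge_min lexx.
    have h2 : h <= d / 2 by rewrite ge_min lexx orbT.
    have hd : `|a - (a - h)| < d by rewrite subKr gtr0_norm//; lra.
    have := Hd _ hd; rewrite hornerN oppr_lt0 ltNge neg//; last by rewrite gtrBl.
    by apply/andP; split; lra.
  have [d d0 Hd] := poly_neg_near qa.
  pose h := Num.min ((1 - a) / 2) (d / 2).
  have h0 : 0 < h by rewrite lt_min !divr_gt0// subr_gt0.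
  have h1 : h <= (1 - a) / 2 by rewrite ge_min lexx.
  have h2 : h <= d / 2 by rewrite ge_min lexx orbT.
  have hd : `|a - (a + h)| < d.
    by rewrite opprD addrA subrr sub0r normrN gtr0_norm//; lra.
  have := Hd _ hd; rewrite ltNge pos//; last by rewrite ltrDl.
  by apply/andP; split; lra.
move: qa => /factor_theorem[s Es].
rewrite Es (_ : _ * _ * _ = ('X - a%:P) ^+ 2 * s); last by ring.
apply: pos4_sqr; apply: IH.
  have [->|s0] := eqVneq s 0; first by rewrite size_poly0.
  apply: leq_trans sq; rewrite Es size_Mmonic ?monicXsubC// size_XsubC addn2/=.
  exact: leqnSn.
have poss (x : R) : 0 <= x <= 1 -> x != a -> 0 <= s.[x].
  move=> x01 xa; have := qge x x01; rewrite Es !hornerE -mulrA -expr2 pmulr_lge0//.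
  by rewrite lt_neqAle sqr_ge0 eq_sym sqrf_eq0 subr_eq0 xa.
move=> x x01; have [->|] := eqVneq x a; last exact: poss.
exact: poly_ge0_closure poss.
Qed.

(** [q ^ 2 - p ^ 2] is nonnegative on [0, 1], so it acts nonnegatively: with positivity,
    this estimate takes the place of the spectral theorem. *)
Lemma act_bound p q : (forall x : R, 0 <= x <= 1 -> `|p.[x]| <= `|q.[x]|) ->
  forall y, nrm (act p y) <= nrm (act q y).
Proof.
move=> pq y; rewrite nrm_le// nrm_sqr -subr_ge0.
have -> : <<act q y, act q y>> - <<act p y, act p y>> = <<act (q ^+ 2 - p ^+ 2) y, y>>.
  by rewrite actBl ipBl !expr2 !actM !act_sym.
apply: act_pos_ge0 => x x01; rewrite hornerD hornerN !horner_exp subr_ge0.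
rewrite -(real_normK (num_real p.[x])) -(real_normK (num_real q.[x])).
by rewrite lerXn2r ?nnegrE//; exact: pq.
Qed.

End PolynomialCalculus.

(** * Polynomial approximation of [cos (t / sqrt r)] *)
Section CosApproximation.
Variable R : realType.
Implicit Types (x y r t e : R) (p q : {poly R}).

Lemma cos_lip x y : `|cos x - cos y| <= `|x - y|.
Proof.
wlog xy : x y / x <= y => [Hw|].
  have [|/ltW] := leP x y => /Hw //.
  by rewrite distrC [`|y - x|]distrC.
move: xy; rewrite le_eqVlt => /predU1P[->|xy]; first by rewrite !subrr normr0.
have [|c _ Hc] := @MVT _ cos (fun z => - sin z) x y xy.
  by apply: continuous_subspaceT => z; exact: continuous_cos.
by rewrite distrC Hc normrM normrN [`|x - y|]distrC ler_piMl// sin_max.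
Qed.

Definition cos_sum M x : R := \sum_(k < M) (-1) ^+ k * x ^+ (2 * k) / (2 * k)`!%:R.

Lemma cos_sum_cvg x : cos_sum^~ x @ \oo --> cos x.
Proof.
have := @cvg_cos_coeff' _ x; apply: cvg_trans; apply: near_eq_cvg.
apply: nearW => M; rewrite /series/= big_mkord /cos_sum; apply: eq_bigr => k _.
by rewrite mul2n /cos_coeff'/= ?exprnP.
Qed.

(** On [[- X, X]] the terms of the cosine series are bounded by those of a convergent
    series, part of the exponential series of [X]. *)
Lemma cos_sum_unif (X : R) e : 0 < e ->
  exists M, forall x, `|x| <= X -> `|cos_sum M x - cos x| <= e.
Proof.
move=> e0; have [X0|X0] := ltP X 0.
  by exists 0%N => x xX; have := normr_ge0 x; rewrite leNgt (le_lt_trans xX X0).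
pose a k : R := X ^+ (2 * k) / (2 * k)`!%:R.
have a0 k : 0 <= a k by rewrite divr_ge0// exprn_ge0.
have ca : cvgn (series a).
  apply: nondecreasing_is_cvgn; first by apply: nondecreasing_series => n _ _.
  exists (expR X) => _ [n _ <-].
  have ce := @is_cvg_series_exp_coeff _ X.
  have nde : nondecreasing_seq (series (exp_coeff X)).
    by apply: nondecreasing_series => k _ _; rewrite /exp_coeff/= divr_ge0// exprn_ge0.
  apply: le_trans (nondecreasing_cvgn_le nde ce (2 * n)%N).
  elim: n => [|n IH]; first by rewrite /series/= muln0 !big_nil.
  rewrite mulnS !addSn add0n !seriesSr addrAC lerD//.
  by rewrite -[leLHS]addr0 lerD// /exp_coeff/= divr_ge0// exprn_ge0.
move/cvgrPdist_le: (ca) => /(_ e e0)[M _ HM]; exists M => x xX.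
have key k : (M <= k)%N -> `|cos_sum M x - cos_sum k x| <= e.
  move=> Mk; apply: le_trans (HM M (leqnn M)).
  have mono n : series a n <= lim (series a @ \oo).
    by apply: nondecreasing_cvgn_le => //; apply: nondecreasing_series => i _ _.
  apply: (@le_trans _ _ (series a k - series a M)); last first.
    by rewrite ger0_norm ?subr_ge0// lerD2r.
  rewrite distrC -(subnK Mk); elim: (k - M)%N => [|j IH].
    by rewrite add0n !subrr normr0.
  rewrite addSn seriesSr /cos_sum big_ord_recr/= -/(cos_sum _ _).
  rewrite addrAC [leRHS]addrAC; apply: le_trans (ler_normD _ _) _; rewrite lerD//.
  rewrite normrM normfV (ger0_norm (ler0n _ _)) normrM normrX normrN1 expr1n mul1r.
  rewrite ler_wpM2r ?invr_ge0// normrX; apply: lerXn2r => //; rewrite nnegrE//.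
rewrite distrC.
have cv : (fun k => `|cos_sum k x - cos_sum M x|) @ \oo --> `|cos x - cos_sum M x|.
  by apply: cvg_norm; apply: cvgB; [exact: cos_sum_cvg|exact: cvg_cst].
rewrite -(cvg_lim _ cv)//; apply: limr_le; first by apply/cvg_ex; eexists; exact: cv.
by near=> k; rewrite distrC; apply: key; near: k; exact: nbhs_infty_ge.
Unshelve. all: by end_near. Qed.

Definition geom_poly N : {poly R} := \sum_(k < N) (1 - 'X) ^+ k.

Lemma geom_polyE N r : (geom_poly N).[r] = \sum_(k < N) (1 - r) ^+ k.
Proof.
by rewrite horner_sum; apply: eq_bigr => k _; rewrite horner_exp !hornerE.
Qed.

Lemma geom_poly_mulr N r : (geom_poly N).[r] * r = 1 - (1 - r) ^+ N.
Proof.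
rewrite geom_polyE -[RHS]opprB subrX1; set s := \sum_(_ < _) _; ring.
Qed.

Lemma geom_poly_mulX N : geom_poly N * 'X = 1 - (1 - 'X) ^+ N.
Proof.
rewrite /geom_poly -[RHS]opprB subrX1; set s := \sum_(_ < _) _; ring.
Qed.

(** [N + 1] times [r (1 - r) ^ N] is at most the geometric sum [r \sum (1 - r) ^ k <= 1]. *)
Lemma pow_small N r : 0 <= r <= 1 -> r * (1 - r) ^+ N <= N.+1%:R^-1.
Proof.
move=> /andP[r0 r1]; have s0 : 0 <= 1 - r by rewrite subr_ge0.
rewrite -[leRHS]mul1r ler_pdivlMr ?ltr0n//.
have : r * \sum_(k < N.+1) (1 - r) ^+ k <= 1.
  by rewrite -geom_polyE mulrC geom_poly_mulr gerBl exprn_ge0.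
apply: le_trans; rewrite -mulrA ler_wpM2l//.
rewrite mulr_natr -[leLHS](_ : \sum_(k < N.+1) (1 - r) ^+ N = _); last first.
  by rewrite sumr_const card_ord.
apply: ler_sum => k _; apply: ler_wiXn2l => //; first by rewrite gerBl.
by rewrite -ltnS.
Qed.

Lemma geom_poly_ge0 N r : 0 <= r <= 1 -> 0 <= (geom_poly N).[r].
Proof.
move=> /andP[r0 r1]; rewrite geom_polyE; apply: sumr_ge0 => k _.
by rewrite exprn_ge0// subr_ge0.
Qed.

Lemma geom_poly_leN N r : 0 <= r <= 1 -> (geom_poly N).[r] <= N%:R.
Proof.
move=> /andP[r0 r1]; rewrite geom_polyE.
have -> : N%:R = \sum_(k < N) (1 : R) by rewrite sumr_const card_ord.
by apply: ler_sum => k _; rewrite exprn_ile1 ?subr_ge0// gerBl.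
Qed.

(** [1 / r] is approximated by the partial sums [b] of the geometric series in
    [1 - r], and [r |1 / sqrt r - sqrt b| <= sqrt (r (1 - r) ^ N)]. *)
Lemma sqrt_geom_poly N r : 0 < r -> r <= 1 ->
  r * `|(Num.sqrt r)^-1 - Num.sqrt (geom_poly N).[r]| <= Num.sqrt (N.+1%:R^-1).
Proof.
move=> r0 r1; have r01 : 0 <= r <= 1 by rewrite ltW.
set b := (geom_poly N).[r]; have b0 : 0 <= b by exact: geom_poly_ge0.
set s := Num.sqrt r; have s0 : 0 < s by rewrite sqrtr_gt0.
set c := Num.sqrt b; have c0 : 0 <= c by exact: sqrtr_ge0.
have sE : s ^+ 2 = r by rewrite sqr_sqrtr ?ltW.
have cE : c ^+ 2 = b by rewrite sqr_sqrtr.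
have br : b * r = 1 - (1 - r) ^+ N by exact: geom_poly_mulr.
have pw0 : 0 <= (1 - r) ^+ N by rewrite exprn_ge0// subr_ge0.
have cs : c * s <= 1.
  rewrite -(@ler_pXn2r _ 2) ?nnegrE ?mulr_ge0 ?(ltW s0)// exprMn sE cE expr1n br.
  by rewrite gerBl.
have D0 : 0 <= s^-1 - c.
  by rewrite subr_ge0 -[s^-1]mul1r ler_pdivlMr.
rewrite ger0_norm//; rewrite -(@ler_pXn2r _ 2) ?nnegrE ?sqrtr_ge0 ?mulr_ge0 ?(ltW r0)//.
rewrite sqr_sqrtr ?invr_ge0//; apply: le_trans (pow_small N r01).
have -> : (r * (s^-1 - c)) ^+ 2 = r * (1 - c * s) ^+ 2.
  rewrite -{1}sE -sE; field; exact: lt0r_neq0.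
rewrite ler_wpM2l ?(ltW r0)//.
have -> : (1 - r) ^+ N = (1 - c * s) * (1 + c * s).
  have -> : (1 - c * s) * (1 + c * s) = 1 - c ^+ 2 * s ^+ 2 by ring.
  by rewrite sE cE br; ring.
rewrite expr2 ler_wpM2l ?subr_ge0//; have := mulr_ge0 c0 (ltW s0); lra.
Qed.

(** The cosine series is even, so its partial sums at [t sqrt b] are polynomials in [b],
    hence in [r] when [b] is a partial sum of the geometric series for [1 / r]. The degree
    of [b] is chosen first, from [sqrt_geom_poly] and the Lipschitz bound of the cosine; then
    [b] is bounded on [0, 1] and the series converges uniformly. *)
Lemma cos_approx t e : 0 < e -> exists p : {poly R},
  (forall r, 0 <= r <= 1 -> `|p.[r]| <= 2) /\
  (forall r, 0 < r -> r <= 1 -> `|r * (p.[r] - cos (t / Num.sqrt r))| <= e).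
Proof.
move=> e0; pose e1 := Num.min 1 (e / 2).
have e10 : 0 < e1 by rewrite lt_min ltr01 divr_gt0.
have e11 : e1 <= 1 by rewrite ge_min lexx.
have e12 : e1 <= e / 2 by rewrite ge_min lexx orbT.
have [N HN] : exists N : nat, `|t| * Num.sqrt (N.+1%:R^-1) <= e / 2.
  pose d := e / 2 / (`|t| + 1).
  have d0 : 0 < d by rewrite !divr_gt0// ltr_wpDl.
  have [N HN] : exists N : nat, N.+1%:R^-1 <= d ^+ 2.
    have := @cvg_harmonic R; move/cvgr0Pnorm_le => /(_ (d ^+ 2)); rewrite exprn_gt0// => /(_ isT).
    move=> [N _ /(_ N (leqnn N)) /=]; rewrite ger0_norm ?invr_ge0// => h.
    by exists N.
  exists N; apply: (@le_trans _ _ (`|t| * d)).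
    rewrite ler_wpM2l// -(ger0_norm (ltW d0)) -sqrtr_sqr ler_sqrt//.
    exact: sqr_ge0.
  rewrite /d mulrA ler_pdivrMr ?ltr_wpDl// mulrC ler_wpM2l ?lerDl//.
  by rewrite divr_ge0// ltW.
have [M HM] := @cos_sum_unif (`|t| * Num.sqrt N%:R) e1 e10.
pose p : {poly R} := \sum_(k < M) ((-1) ^+ k * t ^+ (2 * k) / (2 * k)`!%:R) *: geom_poly N ^+ k.
have pE r : 0 <= r <= 1 -> p.[r] = cos_sum M (t * Num.sqrt (geom_poly N).[r]).
  move=> r01; rewrite horner_sum; apply: eq_bigr => k _.
  rewrite hornerZ horner_exp exprMn [Num.sqrt _ ^+ _]exprM sqr_sqrtr ?geom_poly_ge0//.
  by rewrite -!mulrA; congr (_ * (_ * _)); rewrite mulrC.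
have bnd r : 0 <= r <= 1 -> `|p.[r] - cos (t * Num.sqrt (geom_poly N).[r])| <= e1.
  move=> r01; rewrite pE//; apply: HM; rewrite normrM ler_wpM2l// ger0_norm ?sqrtr_ge0//.
  by rewrite ler_sqrt ?ler0n// geom_poly_leN.
exists p; split => [r r01|r r0 r1].
  rewrite -[p.[r]](subrK (cos (t * Num.sqrt (geom_poly N).[r]))).
  apply: le_trans (ler_normD _ _) _; rewrite -[2]/(1 + 1) lerD//.
    exact: le_trans (bnd r r01) e11.
  exact: cos_max.
have r01 : 0 <= r <= 1 by rewrite ltW.
rewrite -(subrK (cos (t * Num.sqrt (geom_poly N).[r])) p.[r]) -addrA mulrDr.
apply: le_trans (ler_normD _ _) _; rewrite (splitr e) lerD//.
  rewrite normrM gtr0_norm//; apply: le_trans e12; apply: le_trans (bnd r r01).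
  by rewrite ler_piMl.
rewrite normrM gtr0_norm//; apply: le_trans HN.
apply: (@le_trans _ _ (r * (`|t| * `|(Num.sqrt r)^-1 - Num.sqrt (geom_poly N).[r]|))).
  rewrite ler_wpM2l ?(ltW r0)// -normrM mulrBr distrC.
  exact: cos_lip.
by rewrite mulrCA ler_wpM2l// sqrt_geom_poly.
Qed.

End CosApproximation.

(** * Primitives and Riemann sums of real functions *)
Section ScalarCalculus.
Variable R : realType.
Implicit Types (f F : R -> R) (a b t x y e : R).

Lemma lerNnorml x : - `|x| <= x.
Proof. by rewrite lerNl -normrN ler_norm. Qed.

(** The base point of the integral moves with [x] so as to stay to its left; by additivity
    the increments do not depend on it. *)
Lemma continuous_primitive f : continuous f ->
  exists2 F, (forall x, is_derive x 1 F (f x)) & F 0 = 0.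
Proof.
move=> cf; pose I a x := Rintegral lebesgue_measure `[a, x]%classic f.
have int_f a b : lebesgue_measure.-integrable `[a, b] (EFin \o f).
  apply: continuous_compact_integrable; first exact: segment_compact.
  exact: continuous_subspaceT.
have chasles a b x : a <= b -> b <= x -> I a x = I a b + I b x.
  move=> ab bx; have := @Rintegral_itvB R f (BLeft a) (BRight x) b (int_f a x).
  rewrite !bnd_simp => /(_ ab bx) H.
  have -> : I b x = Rintegral lebesgue_measure `]b, x]%classic f.
    rewrite /I -Rintegral_itv_obnd_cbnd//.
    by apply: integrableS (int_f b x) => // y; rewrite /= !in_itv/= => /andP[/ltW -> ->].
  by rewrite -H addrC subrK.
pose F x := I (- `|x| - 1) x - I (- `|x| - 1) 0.
have FE a x : a <= - `|x| - 1 -> F x = I a x - I a 0.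
  move=> ax; have x1 : - `|x| - 1 <= x.
    by have := lerNnorml x; lra.
  have x2 : - `|x| - 1 <= 0 by have := normr_ge0 x; lra.
  by rewrite (chasles a _ x ax x1) (chasles a _ 0 ax x2) /F; ring.
exists F; last by rewrite /F subrr.
move=> x; pose a := - `|x| - 3.
have HI : is_derive x 1 (I a) (f x).
  have xu : x < x + 1 by rewrite ltrDl.
  have ax : a < x by have := lerNnorml x; rewrite /a; lra.
  have [dI dE] := continuous_FTC1_closed xu (int_f a (x + 1)) ax (cf x).
  by apply: DeriveDef; [exact: dI|rewrite -derive1E; exact: dE].
have := is_deriveB HI (is_derive_cst (I a 0) x 1); rewrite subr0.
apply: near_eq_is_derive; near=> y.
rewrite [RHS](FE a)//.
have : `|x - y| < 1 by near: y; apply: cvgr_dist_lt.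
have := ler_normD (y - x) x; rewrite subrK [`|x - y|]distrC /a; lra.
Unshelve. all: by end_near. Qed.

Lemma mean_value f F a b : (forall x, is_derive x 1 F (f x)) ->
  exists c, [/\ Num.min a b <= c, c <= Num.max a b & F b - F a = f c * (b - a)].
Proof.
move=> dF; have cF : continuous F.
  by move=> x; apply: differentiable_continuous; apply/derivable1_diffP; have [] := dF x.
wlog ab : a b / a <= b => [Hw|].
  have [|] := boolP (a <= b); first exact: Hw.
  rewrite -ltNge => /ltW ba.
  have [c [c1 c2 c3]] := Hw b a ba; exists c; split; [by rewrite minC|by rewrite maxC|].
  by rewrite -opprB c3; ring.
have [c + Hc] := MVT_segment ab (fun x _ => dF x) (continuous_subspaceT cF).
rewrite in_itv/= => /andP[ac cb]; exists c; split => //.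
  by rewrite ge_min ac.
by rewrite le_max cb orbT.
Qed.

Lemma is_derive_sqr_near f t (C : R) : f t = 0 ->
  (\forall s \near t, `|f s| <= C * (s - t) ^+ 2) -> is_derive t 1 f 0.
Proof.
move=> f0 Hf.
have Hc : (fun h : R => h^-1 *: (f (h *: 1 + t) - f t)) @ 0^' --> (0 : R).
  apply/cvgr0Pnorm_le => eps eps0; near=> h.
  have h0 : h != 0 by near: h; exact: nbhs_dnbhs_neq.
  rewrite f0 subr0 scaler1 normrZ normfV ler_pdivrMl ?normr_gt0//.
  apply: (@le_trans _ _ (C * h ^+ 2)).
    have -> : h ^+ 2 = (h + t - t) ^+ 2 by rewrite addrK.
    near: h; have : \forall h \near (0 : R), `|f (h + t)| <= C * (h + t - t) ^+ 2.
      by move: Hf; rewrite (near_shift 0 t) /= subr0.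
    exact: nbhs_dnbhs.
  rewrite -(real_normK (num_real h)) expr2 mulrCA ler_wpM2l//.
  apply: (@le_trans _ _ ((`|C| + 1) * `|h|)).
    by rewrite ler_wpM2r// (le_trans (ler_norm _))// lerDl.
  rewrite mulrC -ler_pdivlMr ?ltr_wpDl//.
  by near: h; apply: dnbhs0_le; rewrite divr_gt0// ltr_wpDl.
apply: DeriveDef; first by apply/cvg_ex; exists 0.
exact: cvg_lim Hc.
Unshelve. all: by end_near. Qed.

(** By the mean value theorem the sum for [F b - F 0] has the same form, with other sample
    points. *)
Lemma riemann_sum_est f F b n (w : R) : (0 < n)%N ->
  (forall x : R, is_derive x 1 F (f x)) ->
  (forall x y : R, `|x| <= `|b| -> `|y| <= `|b| -> `|x - y| <= `|b / n%:R| ->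
     `|f x - f y| <= w) ->
  `|\sum_(k < n) b / n%:R * f (k%:R * (b / n%:R)) - (F b - F 0)| <= `|b| * w.
Proof.
move=> n0 dF Hw; pose h := b / n%:R.
have nn0 : n%:R != 0 :> R by rewrite pnatr_eq0 -lt0n.
have hn : h * n%:R = b by rewrite /h divfK.
have -> : F b - F 0 = \sum_(k < n) (F (k.+1%:R * h) - F (k%:R * h)).
  have := telescope_sumr (fun k => F (k%:R * h)) (leq0n n).
  by rewrite big_mkord mul0r mulrC hn => ->.
rewrite -sumrB; apply: le_trans (ler_norm_sum _ _ _) _.
have -> : `|b| * w = \sum_(k < n) (`|h| * w).
  rewrite sumr_const card_ord -mulr_natr -!mulrA; rewrite -[b in LHS]hn normrM.
  by rewrite (ger0_norm (ler0n _ n)); ring.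
apply: ler_sum => k _; have [c [c1 c2 ->]] := mean_value (k%:R * h) (k.+1%:R * h) dF.
have -> : k.+1%:R * h - k%:R * h = h by rewrite -natr1; ring.
rewrite -/h [f c * h]mulrC -mulrBr normrM ler_wpM2l//.
have kn : k.+1%:R <= n%:R :> R by rewrite ler_nat.
have k1 : k%:R <= n%:R :> R by rewrite ler_nat ltnW.
have bh : `|b| = n%:R * `|h| by rewrite -[b in LHS]hn normrM (ger0_norm (ler0n _ n)) mulrC.
have kk : k.+1%:R = k%:R + 1 :> R by rewrite natr1.
have k0 : 0 <= k%:R :> R by exact: ler0n.
rewrite kk in kn c1 c2.
have [h0|h0] := leP 0 h.
  have c1' : k%:R * h <= c by move: c1; rewrite ge_min => /orP[]; nra.
  have c2' : c <= (k%:R + 1) * h by move: c2; rewrite le_max => /orP[]; nra.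
  rewrite (ger0_norm h0) in bh; have c0 : 0 <= c by apply: le_trans c1'; rewrite mulr_ge0.
  apply: Hw; rewrite ?bh.
  - by rewrite (ger0_norm (mulr_ge0 k0 h0)); apply: ler_wpM2r.
  - by rewrite ger0_norm//; apply: le_trans c2' _; rewrite ler_wpM2r.
  - by rewrite -/h (ger0_norm h0) distrC ger0_norm ?subr_ge0//; lra.
have c1' : (k%:R + 1) * h <= c by move: c1; rewrite ge_min => /orP[]; nra.
have c2' : c <= k%:R * h by move: c2; rewrite le_max => /orP[]; nra.
rewrite (ltr0_norm h0) in bh.
have kh0 : k%:R * h <= 0 by rewrite mulr_ge0_le0// ltW.
have c0 : c <= 0 by apply: le_trans kh0.
apply: Hw; rewrite ?bh.
- by rewrite ler0_norm// -mulrN ler_wpM2r// oppr_ge0 ltW.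
- rewrite ler0_norm//; apply: (@le_trans _ _ ((k%:R + 1) * - h)); first by lra.
  by rewrite ler_wpM2r// oppr_ge0 ltW.
- by rewrite -/h (ltr0_norm h0) ger0_norm ?subr_ge0//; lra.
Qed.

End ScalarCalculus.

(** * Calculus of curves in a Hilbert space *)
Section Curves.
Variables (R : realType) (E : lmodType R) (H : hilbert E).
Implicit Types (x y z w : E) (a b e r s t : R) (u v U V : R -> E).

Local Notation "<< x , y >>" := (ip H x y) (at level 0, format "<< x ,  y >>").
Local Notation nrm := (hnrm H).
Local Notation null := (hnull H).
Local Notation tends := (htends H).

Definition hcont v := forall t e, 0 < e ->
  exists2 d : R, 0 < d & forall s, `|s - t| < d -> nrm (v s - v t) <= e.

(** Testing against vectors reduces the calculus of curves to that of real functions,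
    and is insensitive to null vectors. *)
Definition wprim v V := forall z t, is_derive t 1 (fun s => <<V s, z>>) <<v t, z>>.

Lemma hcont_ip v z : hcont v -> continuous (fun t => <<v t, z>>).
Proof.
move=> cv t; apply/cvgrPdist_le => e e0.
have e1 : 0 < e / (nrm z + 1) by rewrite divr_gt0// ltr_wpDl.
have [d d0 Hd] := cv t _ e1; near=> s.
rewrite -ipBl; apply: le_trans (ip_nrm _ _ _) _; rewrite nrmB.
apply: (@le_trans _ _ (nrm (v s - v t) * (nrm z + 1))); first by rewrite ler_wpM2l// lerDl.
rewrite -ler_pdivlMr ?ltr_wpDl//; apply: Hd; rewrite distrC.
by near: s; apply: cvgr_dist_lt.
Unshelve. all: by end_near. Qed.

Lemma hcontD u v : hcont u -> hcont v -> hcont (fun t => u t + v t).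
Proof.
move=> cu cv t e e0; have e2 : 0 < e / 2 by rewrite divr_gt0.
have [d1 d10 H1] := cu t _ e2; have [d2 d20 H2] := cv t _ e2.
exists (Num.min d1 d2); first by rewrite lt_min d10.
move=> s; rewrite lt_min => /andP[s1 s2]; rewrite opprD addrACA.
by apply: le_trans (ler_nrmD _ _ _) _; rewrite (splitr e) lerD// ?H1 ?H2.
Qed.

Lemma hcont_cst x : hcont (fun=> x).
Proof. by move=> t e e0; exists 1 => // s _; rewrite subrr nrm0 ltW. Qed.

Lemma hcont_scale (f : R -> R) v : continuous f -> hcont v -> hcont (fun t => f t *: v t).
Proof.
move=> cf cv t e e0; have e2 : 0 < e / 2 by rewrite divr_gt0.
pose M : R := `|f t| + 1; have M0 : 0 < M by rewrite ltr_wpDl.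
have [d1 d10 H1] := cv t _ (divr_gt0 e2 M0).
have N0 : 0 < nrm (v t) + 1 by rewrite ltr_wpDl.
have Hf : \forall s \near t, `|f t - f s| < Num.min 1 (e / 2 / (nrm (v t) + 1)).
  have m0 : 0 < Num.min 1 (e / 2 / (nrm (v t) + 1)) by rewrite lt_min ltr01 divr_gt0.
  by move/cvgrPdist_lt: (cf t) => /(_ _ m0).
have [d2 /= d20 H2] := Hf.
exists (Num.min d1 d2); first by rewrite lt_min d10.
move=> s; rewrite lt_min => /andP[s1 s2].
have := H2 s; rewrite /ball/= distrC => /(_ s2); rewrite lt_min => /andP[f1 f2].
have -> : f s *: v s - f t *: v t = f s *: (v s - v t) + (f s - f t) *: v t.
  by rewrite scalerBr scalerBl addrA subrK.
apply: le_trans (ler_nrmD _ _ _) _; rewrite (splitr e) !nrmZ lerD//.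
  apply: (@le_trans _ _ (M * nrm (v s - v t))).
    rewrite ler_wpM2r// -[f s](subrK (f t)) addrC (le_trans (ler_normD _ _))// lerD2l.
    by rewrite distrC ltW.
  by rewrite mulrC -ler_pdivlMr// H1.
apply: (@le_trans _ _ (`|f s - f t| * (nrm (v t) + 1))); first by rewrite ler_wpM2l// lerDl.
by rewrite -ler_pdivlMr// distrC ltW.
Qed.

Lemma hcont_bnd v (L : E -> E) (C : R) : (forall x y, L (x - y) = L x - L y) ->
  (forall x, nrm (L x) <= C * nrm x) -> hcont v -> hcont (fun t => L (v t)).
Proof.
move=> LB LC cv t e e0; pose D := `|C| + 1.
have D0 : 0 < D by rewrite ltr_wpDl.
have [d d0 Hd] := cv t _ (divr_gt0 e0 D0); exists d => // s /Hd sd.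
rewrite -LB; apply: le_trans (LC _) _; apply: (@le_trans _ _ (D * nrm (v s - v t))).
  by rewrite ler_wpM2r// (le_trans (ler_norm _))// lerDl.
by rewrite mulrC -ler_pdivlMr.
Qed.

Lemma heine v a b e : hcont v -> 0 < e -> exists2 d : R, 0 < d &
  forall s t, a <= s <= b -> `|t - s| < d -> nrm (v t - v s) <= e.
Proof.
move=> cv e0; have e2 : 0 < e / 2 by rewrite divr_gt0.
have cK : compact (`[a, b]%classic : set R) by exact: segment_compact.
pose P (d s : R) := forall t, `|t - s| < d -> nrm (v t - v s) <= e.
have /(_ R (0^'+)) := (compact_near_coveringP _).1 cK.
move=> /(_ P _) [|d /= d0 Hd].
  move=> s _; have [d d0 Hd] := cv s _ e2.
  exists (ball s (d / 2), [set x | x < d / 2]) => /=.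
    split; first by apply: nbhsx_ballx; rewrite divr_gt0.
    by apply: nbhs_right_lt; rewrite divr_gt0.
  move=> [s' d'] /= [ss' d'd] t ts'.
  rewrite -[v t - _](subrKA (v s)); apply: le_trans (ler_nrmD _ _ _) _.
  rewrite (splitr e) lerD//.
    apply: Hd; have -> : t - s = (t - s') + (s' - s) by rewrite addrA subrK.
    apply: le_lt_trans (ler_normD _ _) _; move: ss'; rewrite /ball/= distrC; lra.
  rewrite nrmB; apply: Hd; move: ss'; rewrite /ball/= distrC; lra.
exists (d / 2); first by rewrite divr_gt0.
move=> s t sab ts; apply: (Hd (d / 2)) ts => //=.
- by rewrite sub0r normrN gtr0_norm ?divr_gt0// ltr_pdivrMr// ltr_pMr// ltr1n.
- by rewrite divr_gt0.
Qed.

(** ** Primitives *)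

(** The point [c] depends on [z], which is harmless for the norm estimate [wprim_le]. *)
Lemma wprim_mean v V a b z : wprim v V ->
  exists c, [/\ Num.min a b <= c, c <= Num.max a b &
    <<V b - V a, z>> = (b - a) * <<v c, z>>].
Proof.
move=> HV; have [c [c1 c2 c3]] := mean_value a b (HV z).
by exists c; split => //; rewrite ipBl c3 mulrC.
Qed.

Lemma nrm_le_ip x (C : R) : 0 <= C -> (forall z, <<x, z>> <= C * nrm z) -> nrm x <= C.
Proof.
move=> C0 Hx; rewrite leNgt; apply/negP => Cx.
have x0 : 0 < nrm x by exact: le_lt_trans Cx.
have := Hx x; rewrite -nrm_sqr expr2 ler_pM2r// => /le_lt_trans /(_ Cx).
by rewrite ltxx.
Qed.

Lemma wprim_le v V a b (C : R) : wprim v V -> 0 <= C ->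
  (forall s, Num.min a b <= s -> s <= Num.max a b -> nrm (v s) <= C) ->
  nrm (V b - V a) <= C * `|b - a|.
Proof.
move=> HV C0 Hv; apply: nrm_le_ip => [|z]; first by rewrite mulr_ge0.
have [c [c1 c2 ->]] := wprim_mean a b z HV.
apply: le_trans (ler_norm _) _; rewrite normrM mulrC -mulrA [_ * nrm z]mulrC mulrA.
rewrite ler_wpM2r//; apply: le_trans (ip_nrm _ _ _) _; rewrite ler_wpM2r//.
exact: Hv.
Qed.

Lemma is_derive_ext (F G : R -> R) t d : (forall s, F s = G s) ->
  is_derive t 1 F d -> is_derive t 1 G d.
Proof. by move=> /funext ->. Qed.

Lemma wprimD u v U V : wprim u U -> wprim v V ->
  wprim (fun t => u t + v t) (fun t => U t + V t).
Proof.
move=> HU HV z t; rewrite ipDl; have := is_deriveD (HU z t) (HV z t).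
by apply: is_derive_ext => s; rewrite ipDl.
Qed.

Lemma wprimZ a v V : wprim v V -> wprim (fun t => a *: v t) (fun t => a *: V t).
Proof.
move=> HV z t; rewrite ipZl; have := is_deriveZ a (HV z t).
by apply: is_derive_ext => s; rewrite ipZl.
Qed.

Lemma wprimN v V : wprim v V -> wprim (fun t => - v t) (fun t => - V t).
Proof.
move=> HV z t; rewrite ipNl; have := is_deriveN (HV z t).
by apply: is_derive_ext => s; rewrite ipNl.
Qed.

Lemma wprim_cst x : wprim (fun=> 0) (fun=> x).
Proof. by move=> z t; rewrite ip0l; exact: is_derive_cst. Qed.

Lemma wprim_op (L : E -> E) v V : (forall x y, <<L x, y>> = <<x, L y>>) ->
  wprim v V -> wprim (fun t => L (v t)) (fun t => L (V t)).
Proof.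
move=> LS HV z t; rewrite LS; have := HV (L z) t.
by apply: is_derive_ext => s; rewrite LS.
Qed.

Lemma wprim_eq v v' V V' : (forall t, null (v t - v' t)) ->
  (forall t, null (V t - V' t)) -> wprim v V -> wprim v' V'.
Proof.
have eqip x y z : null (x - y) -> <<x, z>> = <<y, z>>.
  by move=> xy; apply/eqP; rewrite -subr_eq0 -ipBl (null_ip z xy).
move=> Hv HV' HV z t; rewrite -(eqip _ _ z (Hv t)); have := HV z t.
by apply: is_derive_ext => s; exact: eqip.
Qed.

Lemma wprim_scale (f : R -> R) f' v V : (forall t, is_derive t 1 f (f' t)) ->
  wprim v V -> wprim (fun t => f' t *: V t + f t *: v t) (fun t => f t *: V t).
Proof.
move=> df HV z t; rewrite ipDl !ipZl.
have := is_deriveM (df t) (HV z t); rewrite addrC [_ *: f' t]mulrC.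
by apply: is_derive_ext => s; rewrite ipZl.
Qed.

Lemma wprim0_null V : wprim (fun=> 0) V -> forall a b, null (V b - V a).
Proof.
move=> HV a b; apply: ip_null => z; have [c [_ _ ->]] := wprim_mean a b z HV.
by rewrite ip0l mulr0.
Qed.

Lemma wprim_unique v V V' : wprim v V -> wprim v V' -> null (V 0 - V' 0) ->
  forall t, null (V t - V' t).
Proof.
move=> HV HV' V0 t.
have HD : wprim (fun=> 0) (fun t => V t - V' t).
  have := wprimD HV (wprimN HV'); apply: wprim_eq => s; last by rewrite subrr; exact: nrm0.
  by rewrite subrr subr0; exact: nrm0.
by have := nullD (wprim0_null HD 0 t) V0; rewrite subrK.
Qed.

Lemma wprim_deriv_unique v v' V V' : wprim v V -> wprim v' V' ->
  (forall t, null (V t - V' t)) -> forall t, null (v t - v' t).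
Proof.
move=> HV HV' VV t; apply: ip_null => z; rewrite ipBl.
have dV := HV z t; have dV' := HV' z t.
have : is_derive t 1 (fun s => <<V' s, z>>) <<v t, z>>.
  apply: is_derive_ext dV => s.
  by apply/eqP; rewrite -subr_eq0 -ipBl (null_ip z (VV s)).
by move=> /@derive_val <-; rewrite (@derive_val _ _ _ _ _ _ _ dV') subrr.
Qed.

Lemma hcont_local_bnd v a b : hcont v ->
  exists2 C : R, 0 <= C & forall s, Num.min a b <= s -> s <= Num.max a b -> nrm (v s) <= C.
Proof.
move=> cv; pose N s := nrm (v s).
have cN : continuous N.
  move=> t; apply/cvgrPdist_le => e e0; have [d d0 Hd] := cv t _ e0; near=> s.
  have st : nrm (v s - v t) <= e.
    by apply: Hd; rewrite distrC; near: s; apply: cvgr_dist_lt.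
  rewrite ler_norml; apply/andP; split.
    have := ler_nrmD H (v s - v t) (v t); rewrite subrK /N; lra.
  have := ler_nrmD H (v t - v s) (v s); rewrite subrK [nrm (v t - v s)]nrmB /N; lra.
have mm : Num.min a b <= Num.max a b by rewrite ge_min !le_max lexx.
have [c _ Hc] := EVT_max mm (continuous_subspaceT cN).
by exists (N c); [exact: nrm_ge0|move=> s s1 s2; apply: Hc; rewrite in_itv/= s1].
Unshelve. all: by end_near. Qed.

Lemma wprim_hcont v V : hcont v -> wprim v V -> hcont V.
Proof.
move=> cv HV t e e0; have [C C0 HC] := hcont_local_bnd (t - 1) (t + 1) cv.
have C1 : 0 < C + 1 by rewrite ltr_wpDl.
exists (Num.min 1 (e / (C + 1))); first by rewrite lt_min ltr01 divr_gt0.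
move=> s; rewrite lt_min => /andP[s1 s2].
apply: le_trans (wprim_le HV C0 _) _ => [r|].
  rewrite ge_min le_max => /orP r1 /orP r2; apply: HC.
    rewrite ge_min; apply/orP; left; have := ler_norm (t - s); rewrite distrC; case: r1; lra.
  rewrite le_max; apply/orP; right; have := ler_norm (s - t); case: r2; lra.
apply: (@le_trans _ _ ((C + 1) * `|s - t|)); first by rewrite ler_wpM2r// lerDl.
by rewrite mulrC -ler_pdivlMr// ltW.
Qed.

(** Expand both curves around [t]: the first-order terms are scalar derivatives of weak
    primitives, and the remaining pairing of two increments is of second order. *)
Lemma wprim_ip u v U V : hcont u -> hcont v -> wprim u U -> wprim v V ->
  forall t, is_derive t 1 (fun s => <<U s, V s>>) (<<u t, V t>> + <<U t, v t>>).
Proof.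
move=> cu cv HU HV t.
have [Cu Cu0 HCu] := hcont_local_bnd (t - 1) (t + 1) cu.
have [Cv Cv0 HCv] := hcont_local_bnd (t - 1) (t + 1) cv.
have D3 : is_derive t 1 (fun s => <<U s - U t, V s - V t>>) 0.
  apply: (@is_derive_sqr_near _ _ _ (Cu * Cv)); first by rewrite subrr ip0l.
  near=> s; apply: le_trans (ip_nrm _ _ _) _.
  have st : `|t - s| < 1 by near: s; apply: cvgr_dist_lt.
  have between r : Num.min t s <= r -> r <= Num.max t s ->
      Num.min (t - 1) (t + 1) <= r /\ r <= Num.max (t - 1) (t + 1).
    rewrite ge_min le_max => /orP r1 /orP r2; split.
      rewrite ge_min; apply/orP; left; have := ler_norm (t - s); case: r1; lra.
    rewrite le_max; apply/orP; right; have := ler_norm (s - t); rewrite distrC; case: r2; lra.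
  rewrite -(real_normK (num_real (s - t))) expr2 mulrACA.
  apply: ler_pM => //.
    by apply: wprim_le HU Cu0 _ => r r1 r2; have [] := between r r1 r2; exact: HCu.
  by apply: wprim_le HV Cv0 _ => r r1 r2; have [] := between r r1 r2; exact: HCv.
have D1 := HU (V t) t; have D2 := HV (U t) t.
have := is_deriveD (is_deriveD D1 D2) D3; rewrite addr0 [<<v t, _>>]ipC.
have := is_derive_cst (- <<U t, V t>>) t 1 => D4 D5.
have := is_deriveD D5 D4; rewrite addr0; apply: is_derive_ext => s /=.
by rewrite !fctE /= !ipBl !ipBr [<<V s, U t>>]ipC; ring.
Unshelve. all: by end_near. Qed.

(** ** Riemann sums *)

Definition usum v b n : E := \sum_(k < n) (b / n%:R) *: v (k%:R * (b / n%:R)).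

Lemma usum_est v b n z (F : R -> R) (w : R) : (0 < n)%N ->
  (forall x : R, is_derive x 1 F <<v x, z>>) ->
  (forall x y : R, `|x| <= `|b| -> `|y| <= `|b| -> `|x - y| <= `|b / n%:R| -> nrm (v x - v y) <= w) ->
  `|<<usum v b n, z>> - (F b - F 0)| <= `|b| * w * nrm z.
Proof.
move=> n0 dF Hw; rewrite /usum ip_suml -mulrA.
under eq_bigr do rewrite ipZl.
apply: riemann_sum_est => // x y xb yb xy; rewrite -ipBl.
by apply: le_trans (ip_nrm _ _ _) _; rewrite ler_wpM2r//; exact: Hw.
Qed.

Lemma usum_small v b e : hcont v -> 0 < e -> \forall n \near \oo,
  forall x y : R, `|x| <= `|b| -> `|y| <= `|b| -> `|x - y| <= `|b / n%:R| -> nrm (v x - v y) <= e.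
Proof.
move=> cv e0; have [d d0 Hd] := heine (- `|b|) `|b| cv e0.
have : \forall n \near \oo, `|b| / d < n%:R by exact: nbhs_infty_gtr.
move=> Hn; near=> n; move=> x y xb yb xy; apply: Hd; first by rewrite -ler_norml.
apply: le_lt_trans xy _.
have n0 : 0 < n%:R :> R.
  by apply: (@le_lt_trans _ _ (`|b| / d)); [rewrite divr_ge0// ltW|near: n].
rewrite normrM normfV (gtr0_norm n0) ltr_pdivrMr// mulrC -ltr_pdivrMr//.
by near: n.
Unshelve. all: by end_near. Qed.

Lemma usum_tends v V b : hcont v -> wprim v V -> tends (usum v b) (V b - V 0).
Proof.
move=> cv HV e e0; pose w := e / (`|b| + 1).
have b1 : 0 < `|b| + 1 by rewrite ltr_wpDl.
have w0 : 0 < w by rewrite divr_gt0.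
have := usum_small b cv w0 => Hs; near=> n.
apply: nrm_le_ip => [|z]; first exact: ltW.
rewrite ipBl ipBl; apply: le_trans (ler_norm _) _.
apply: le_trans (@usum_est v b n z (fun s => <<V s, z>>) w _ (HV z) _) _.
- by near: n; exact: nbhs_infty_gt.
- by near: n.
rewrite ler_wpM2r// mulrC /w mulrAC ler_pdivrMr// ler_wpM2l ?(ltW e0)//.
by rewrite lerDl.
Unshelve. all: by end_near. Qed.

(** The Riemann sums are Cauchy in norm because, tested against any [z], they are close to
    the increment of a scalar primitive, uniformly for [z] in the unit ball. *)
Lemma hcont_wprim v : hcont v -> exists2 V, wprim v V & null (V 0).
Proof.
move=> cv.
have cau b : exists x, tends (usum v b) x.
  apply: cauchy_tends => e e0; pose w := e / (2 * (`|b| + 1)).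
  have b1 : 0 < 2 * (`|b| + 1) by rewrite mulr_gt0// ltr_wpDl.
  have w0 : 0 < w by rewrite divr_gt0.
  have [N _ HN] := usum_small b cv w0; exists N.+1 => k l Nk Nl.
  apply: nrm_le_ip => [|z]; first exact: ltW.
  have [F dF _] := continuous_primitive (@hcont_ip v z cv).
  have est n : (N < n)%N -> `|<<usum v b n, z>> - (F b - F 0)| <= `|b| * w * nrm z.
    by move=> Nn; apply: usum_est (leq_ltn_trans _ Nn) dF _ => //; exact: HN (ltnW Nn).
  have ek := est k Nk; have el := est l Nl.
  rewrite ipBl; apply: (@le_trans _ _ (2 * (`|b| * w * nrm z))).
    move: ek el; rewrite !ler_norml => /andP[k1 k2] /andP[l1 l2]; lra.
  rewrite mulrA; apply: ler_wpM2r => //.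
  have wE : e = w * (2 * (`|b| + 1)) by rewrite /w divfK// gt_eqF.
  by rewrite [leRHS]wE; have := normr_ge0 b; nra.
have [V HV] := choice cau.
have VE z b F : (forall x : R, is_derive x 1 F <<v x, z>>) -> <<V b, z>> = F b - F 0.
  move=> dF; have c1 := @tends_ip _ _ _ _ _ z (HV b).
  apply: (cvg_unique _ c1) => //; apply/cvgrPdist_le => e e0.
  pose w := e / (`|b| * nrm z + 1).
  have b1 : 0 < `|b| * nrm z + 1 by rewrite ltr_wpDl// mulr_ge0.
  have w0 : 0 < w by rewrite divr_gt0.
  have Hs := usum_small b cv w0; near=> n; rewrite distrC.
  apply: le_trans (@usum_est v b n z F w _ dF _) _.
  - by near: n; exact: nbhs_infty_gt.
  - by near: n.
  have wE : e = w * (`|b| * nrm z + 1) by rewrite /w divfK// gt_eqF.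
  by rewrite [leRHS]wE; nra.
exists V => [z t|].
  have [F dF F0] := continuous_primitive (@hcont_ip v z cv).
  have := dF t; apply: is_derive_ext => s.
  by rewrite (VE z s F dF) F0 subr0.
apply: ip_null => z; have [F dF F0] := continuous_primitive (@hcont_ip v z cv).
by rewrite (VE z 0 F dF) subrr.
Unshelve. all: by end_near. Qed.

(** ** Riemann integrals *)

Definition is_riemann v a b w := forall e, 0 < e -> exists2 d : R, 0 < d &
  forall (s : seq R) (xi : nat -> R), itv_partition a b s ->
    (forall k, (k < size s)%N -> [/\ nth b s k - nth b (a :: s) k < d,
       nth b (a :: s) k <= xi k & xi k <= nth b s k]) ->
    nrm (\sum_(k < size s) (nth b s k - nth b (a :: s) k) *: v (xi k) - w) < e.

Definition is_integral v a b w :=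
  if a <= b then is_riemann v a b w else is_riemann v b a (- w).

(** Induction along the partition: on each step the mean value of the weak primitive differs
    from the sample by at most the oscillation [C]. *)
Lemma partition_est v V a0 b (d C : R) z : wprim v V ->
  (forall x y : R, a0 <= y <= b -> `|x - y| < d -> nrm (v x - v y) <= C) ->
  forall (s : seq R) a (xi : nat -> R), a0 <= a -> itv_partition a b s ->
  (forall k, (k < size s)%N -> [/\ nth b s k - nth b (a :: s) k < d,
       nth b (a :: s) k <= xi k & xi k <= nth b s k]) ->
  `|<<\sum_(k < size s) (nth b s k - nth b (a :: s) k) *: v (xi k) - (V b - V a), z>>|
    <= C * (b - a) * nrm z.
Proof.
move=> HV Hv; elim=> [a xi _ /itv_partition_nil <- _|x s IH a xi a0a pxs Hxi].
  by rewrite big_ord0 subrr subr0 ip0l normr0 subrr mulr0 mul0r.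
have ps := itv_partition_cons pxs; have xb := itv_partition_le ps.
have ax : a <= x by move: pxs => -[/=/andP[/ltW]].
have /= [xi1 xi2 xi3] := Hxi 0%N isT.
have := IH x (fun k => xi k.+1) (le_trans a0a ax) ps (fun k ks => Hxi k.+1 ks).
rewrite big_ord_recl/=; set S := \sum_(i < _) _.
move=> HS; have [c [c1 c2 Hc]] := wprim_mean a x z HV.
rewrite (min_idPl ax) in c1; rewrite (max_idPr ax) in c2.
have -> : (x - a) *: v (xi 0%N) + S - (V b - V a) =
    ((x - a) *: v (xi 0%N) - (V x - V a)) + (S - (V b - V x)).
  by rewrite addrACA -opprD [V x - V a + _]addrC subrKA.
rewrite ipDl; apply: le_trans (ler_normD _ _) _.
rewrite -[b - a](subrKA x) addrC mulrDr mulrDl addrC [leRHS]addrC lerD//.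
rewrite ipBl Hc ipZl -mulrBr normrM -ipBl ger0_norm ?subr_ge0// [C * _]mulrC -mulrA.
rewrite ler_wpM2l ?subr_ge0//; apply: le_trans (ip_nrm _ _ _) _; rewrite ler_wpM2r//.
apply: Hv; first by apply/andP; split; [exact: le_trans c1|exact: le_trans xb].
by rewrite ltr_norml; apply/andP; split; lra.
Qed.

Lemma riemann_wprim v V a b : hcont v -> wprim v V -> a <= b ->
  is_riemann v a b (V b - V a).
Proof.
move=> cv HV ab e e0; pose C := e / (2 * (b - a + 1)).
have b1 : 0 < 2 * (b - a + 1) by rewrite mulr_gt0// ltr_wpDl// subr_ge0.
have C0 : 0 < C by rewrite divr_gt0.
have [d d0 Hd] := heine a b cv C0; exists d => // s xi ps Hxi.
have e2 : e / 2 < e by rewrite ltr_pdivrMr// ltr_pMr// ltr1n.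
apply: le_lt_trans e2; apply: nrm_le_ip => [|z]; first by rewrite divr_ge0// ltW.
apply: le_trans (ler_norm _) _.
apply: le_trans (partition_est z HV _ (lexx a) ps Hxi) _; first by move=> x y; exact: Hd.
apply: ler_wpM2r => //.
have CE : e = C * (2 * (b - a + 1)) by rewrite /C divfK// gt_eqF.
by rewrite [X in _ <= X / _]CE; lra.
Qed.

(** Needed for uniqueness: a Riemann integral is only determined if there are partitions
    as fine as required. *)
Lemma partition_ex a b (d : R) : a <= b -> 0 < d -> exists2 s : seq R, itv_partition a b s &
  forall k, (k < size s)%N -> 0 <= nth b s k - nth b (a :: s) k < d.
Proof.
move=> ab d0; pose h := d / 2; have h0 : 0 < h by rewrite divr_gt0.
have [n Hn] : exists n, b - a < n%:R * h.
  have : \forall n \near \oo, (b - a) / h < n%:R by exact: nbhs_infty_gtr.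
  by move=> [n _ /(_ n (leqnn n))/=]; rewrite ltr_pdivrMr// => ?; exists n.
elim: n a ab Hn => [|n IH] a ab Hn; first by move: Hn; rewrite mul0r; lra.
have [bah|hba] := ltP (b - a) d.
  move: ab; rewrite le_eqVlt => /predU1P[->|ab].
    by exists [::] => //; split.
  exists [:: b]; first exact: itv_partition1.
  by move=> [|k]//= _; rewrite bah subr_ge0 ltW.
have dh : d = 2 * h by rewrite /h mulrC divfK.
have [||s [ps /eqP ls] Hs] := IH (a + h); first lra.
  by move: Hn; rewrite -natr1; lra.
exists (a + h :: s); first by split => /=; rewrite ?ps ?ls// ltrDl h0.
move=> [|k]/= ks; last exact: Hs.
by rewrite addrAC subrr add0r ltW//; lra.
Qed.

Lemma is_riemann_unique v a b w w' : a <= b -> is_riemann v a b w -> is_riemann v a b w' ->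
  null (w - w').
Proof.
move=> ab Hw Hw'; apply: null_small => e e0; have e2 : 0 < e / 2 by rewrite divr_gt0.
have [d d0 Hd] := Hw _ e2; have [d' d'0 Hd'] := Hw' _ e2.
have [|s ps Hs] := @partition_ex a b (Num.min d d') ab; first by rewrite lt_min d0.
have Hxi k : (k < size s)%N -> [/\ nth b s k - nth b (a :: s) k < Num.min d d',
    nth b (a :: s) k <= nth b s k & nth b s k <= nth b s k].
  by move=> /Hs/andP[h1 h2]; rewrite -subr_ge0 h1 h2 lexx.
apply: le_trans (ler_nrm_trans _ _
  (\sum_(k < size s) (nth b s k - nth b (a :: s) k) *: v (nth b s k)) _) _.
rewrite (splitr e) nrmB; apply: lerD; apply: ltW.
  by apply: (Hd s (nth b s) ps) => k /Hxi[]; rewrite lt_min => /andP[].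
by apply: (Hd' s (nth b s) ps) => k /Hxi[]; rewrite lt_min => /andP[].
Qed.

Lemma is_riemann_null v a b w w' : null (w - w') -> is_riemann v a b w -> is_riemann v a b w'.
Proof.
move=> ww Hw e e0; have [d d0 Hd] := Hw e e0; exists d => // s xi ps Hxi.
by apply: le_lt_trans (ler_nrm_trans _ _ w _) _; rewrite ww addr0; exact: Hd.
Qed.

Lemma integral_wprim v V a b w : hcont v -> wprim v V -> null (V b - V a - w) ->
  is_integral v a b w.
Proof.
move=> cv HV Vw; rewrite /is_integral; case: ifP => ab.
  by apply: is_riemann_null Vw _; exact: riemann_wprim.
have ba : b <= a by rewrite ltW// ltNge ab.
apply: is_riemann_null (riemann_wprim cv HV ba).
by have := nullN Vw; rewrite opprB opprB opprK addrC.
Qed.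

Lemma integral_unique v a b w w' : is_integral v a b w -> is_integral v a b w' ->
  null (w - w').
Proof.
rewrite /is_integral; case: ifP => [ab|/negbT]; first exact: is_riemann_unique.
rewrite -ltNge => /ltW ba Hw Hw'; have := is_riemann_unique ba Hw Hw'.
by rewrite /null -opprD nrmN.
Qed.

(** Integration by parts turns the integral of [(t - s) u s] into a second primitive. *)
Lemma wprim_second u V1 V2 t : wprim u V1 -> wprim V1 V2 ->
  wprim (fun s => (t - s) *: u s) (fun s => (t - s) *: V1 s + V2 s).
Proof.
move=> H1 H2; have df (s : R) : is_derive s 1 (fun s => t - s) (- 1).
  have := is_deriveB (is_derive_cst t s 1) (is_derive_id s (1 : R)).
  by rewrite sub0r; exact: is_derive_ext.
have := wprimD (wprim_scale df H1) H2; apply: wprim_eq => s; last by rewrite subrr; exact: nrm0.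
by rewrite scaleN1r [_ + V1 s]addrAC addNr add0r subrr; exact: nrm0.
Qed.

Lemma integral_second u V1 V2 t : hcont u -> wprim u V1 -> wprim V1 V2 ->
  null (V1 0) -> null (V2 0) -> is_integral (fun s => (t - s) *: u s) 0 t (V2 t).
Proof.
move=> cu H1 H2 V10 V20; apply: integral_wprim (wprim_second t H1 H2) _.
  by apply: hcont_scale cu => s; apply: cvgB; [exact: cvg_cst|exact: cvg_id].
rewrite subrr scale0r add0r subr0 addrAC subrr add0r; apply: nullN; apply: nullD => //.
exact: nullZ.
Qed.

(** With [V2 = - K v], the energy [<<K V1, V1>> + <<V2, V2>>] has derivative
    [2 <<K v, V1>> + 2 <<V1, V2>> = 0] and vanishes at 0. So [V2] is null, and [V1] and
    [v] are null as its derivatives. *)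
Lemma second_primitive_unique (K : E -> E) (C : R) v V1 V2 :
  (forall x y, K (x - y) = K x - K y) -> (forall x y, <<K x, y>> = <<x, K y>>) ->
  (forall x, 0 <= <<K x, x>>) -> (forall x, nrm (K x) <= C * nrm x) ->
  hcont v -> wprim v V1 -> wprim V1 V2 -> null (V1 0) -> null (V2 0) ->
  (forall t, null (V2 t + K (v t))) -> forall t, null (v t).
Proof.
move=> KB KS K0 KC cv H1 H2 V10 V20 E0.
have cV1 := wprim_hcont cv H1; have cK := hcont_bnd KB KC cv.
have HK := wprim_op KS H1.
have V2K s z : <<V2 s, z>> = - <<K (v s), z>>.
  by apply/eqP; rewrite -addr_eq0 -ipDl (null_ip _ (E0 s)).
have D1 := wprim_ip cK cv HK H1; have D2 := wprim_ip cV1 cV1 H2 H2.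
pose e s := <<K (V1 s), V1 s>> + <<V2 s, V2 s>>.
have De s : is_derive s 1 e 0.
  have := is_deriveD (D1 s) (D2 s).
  rewrite [<<V1 s, V2 s>>]ipC !V2K (KS (V1 s)) [<<V1 s, K _>>]ipC -opprD subrr.
  exact: is_derive_ext.
have e0 t : e t = 0.
  by rewrite (@is_derive_0_is_cst _ e t 0 De) /e (null_ip _ V20) addr0 KS (null_ip _ V10).
have V2n t : null (V2 t).
  have := e0 t; rewrite /e => /eqP; rewrite paddr_eq0 ?ip_ge0// => /andP[_ /eqP].
  by rewrite /null /hnrm => ->; rewrite sqrtr0.
have H20 : wprim (fun=> 0) V2.
  apply: wprim_eq (wprim_cst 0) => s; first by rewrite subrr; exact: nrm0.
  by rewrite sub0r; exact: nullN.
have V1n t : null (V1 t).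
  have VV s : null (V2 s - V2 s) by rewrite subrr; exact: nrm0.
  by have := wprim_deriv_unique H2 H20 VV t; rewrite subr0.
have H10 : wprim (fun=> 0) V1.
  apply: wprim_eq (wprim_cst 0) => s; first by rewrite subrr; exact: nrm0.
  by rewrite sub0r; exact: nullN.
move=> t; have VV s : null (V1 s - V1 s) by rewrite subrr; exact: nrm0.
by have := wprim_deriv_unique H1 H10 VV t; rewrite subr0.
Qed.

End Curves.

(** * Cosine family of a positive contraction *)
Section CosineFamily.
Variables (R : realType) (E : lmodType R) (H : hilbert E) (K : E -> E).
Hypothesis HK : pos_contraction H K.
Implicit Types (x y z f g u v : E) (a b e r t : R) (p q : nat -> {poly R}) (F G : R -> R).

Local Notation "<< x , y >>" := (ip H x y) (at level 0, format "<< x ,  y >>").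
Local Notation nrm := (hnrm H).
Local Notation null := (hnull H).
Local Notation tends := (htends H).
Local Notation act := (act K).

Lemma op_le x : nrm (K x) <= nrm x.
Proof.
rewrite -(actX K) -[x in leRHS]scale1r -(actC K); apply: (act_bound HK).
by move=> r /andP[r0 r1]; rewrite hornerX hornerC normr1 ger0_norm.
Qed.

Lemma act_le (P : {poly R}) (B : R) f : (forall r, 0 <= r <= 1 -> `|P.[r]| <= B) ->
  nrm (act P f) <= B * nrm f.
Proof.
move=> HP; have B0 : 0 <= B by apply: le_trans (HP 0 _) => //; rewrite lexx ler01.
rewrite -(ger0_norm B0) -nrmZ -(actC K); apply: (act_bound HK) => r r01; rewrite hornerC (ger0_norm B0).
exact: HP.
Qed.

(** On a vector [K y] the symbol is multiplied by [r], so a bound of [r * P r] suffices. *)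
Lemma act_op_le (P : {poly R}) (M e : R) y : 0 <= M -> 0 <= e ->
  (forall r, 0 < r -> r <= 1 -> `|r * P.[r]| <= M * r + e) ->
  nrm (act P (K y)) <= M * nrm (K y) + e * nrm y.
Proof.
move=> M0 e0 HP; rewrite -actMX.
apply: (@le_trans _ _ (nrm (act (M *: 'X + e%:P) y))).
  apply: act_bound => // r /andP[r0 r1]; rewrite hornerM hornerX !hornerE.
  have [->|rn0] := eqVneq r 0; first by rewrite mulr0 normr0.
  rewrite mulrC [leRHS]ger0_norm ?addr_ge0 ?mulr_ge0//; apply: HP => //.
  by rewrite lt_neqAle eq_sym rn0.
rewrite actDl actZl actX actC; apply: le_trans (ler_nrmD _ _ _) _.
by rewrite !nrmZ !ger0_norm.
Qed.

(** Polynomials that are bounded on [0, 1] and approximate [F] there after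
    multiplication by [r]. The factor [r] makes room for functions with a wild
    behaviour at 0, and is provided by vectors of the form [K y]. *)
Definition approx p F :=
  (exists B : R, forall n r, 0 <= r <= 1 -> `|(p n).[r]| <= B) /\
  (forall e, 0 < e -> \forall n \near \oo, forall r, 0 < r -> r <= 1 ->
     `|r * ((p n).[r] - F r)| <= e).

Lemma approx_ext p F G : (forall r, 0 < r -> r <= 1 -> F r = G r) -> approx p F -> approx p G.
Proof.
move=> FG [pB pF]; split => // e e0; have := pF e e0; apply: filterS => n Hn r r0 r1.
by rewrite -FG//; exact: Hn.
Qed.

Lemma approxD p q F G : approx p F -> approx q G ->
  approx (fun n => p n + q n) (fun r => F r + G r).
Proof.
move=> [[B pB] pF] [[C qC] qG]; split.
  exists (B + C) => n r r01; rewrite hornerD; apply: le_trans (ler_normD _ _) _.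
  by apply: lerD; [exact: pB|exact: qC].
move=> e e0; have e2 : 0 < e / 2 by rewrite divr_gt0.
near=> n => r r0 r1; rewrite hornerD opprD addrACA mulrDr.
apply: le_trans (ler_normD _ _) _; rewrite (splitr e); apply: lerD.
  by move: r r0 r1; near: n; exact: pF.
by move: r r0 r1; near: n; exact: qG.
Unshelve. all: by end_near. Qed.

Lemma poly_bnd (P : {poly R}) : exists2 B : R, 0 <= B &
  forall r, 0 <= r <= 1 -> `|P.[r]| <= B.
Proof.
exists (\sum_(i < size P) `|P`_i|); first by apply: sumr_ge0.
move=> r /andP[r0 r1]; rewrite horner_coef; apply: le_trans (ler_norm_sum _ _ _) _.
apply: ler_sum => i _; rewrite normrM ler_piMr// normrX exprn_ile1//.
by rewrite ger0_norm.
Qed.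

Lemma approxM (P : {poly R}) p F : approx p F -> approx (fun n => P * p n) (fun r => P.[r] * F r).
Proof.
move=> [[B pB] pF]; have [C C0 HC] := poly_bnd P; split.
  exists (C * B) => n r r01; rewrite hornerM normrM; apply: ler_pM => //; first exact: HC.
  exact: pB.
move=> e e0; have C1 : 0 < C + 1 by rewrite ltr_wpDl.
have := pF _ (divr_gt0 e0 C1); apply: filterS => n Hn r r0 r1.
rewrite hornerM -mulrBr mulrCA normrM.
apply: (@le_trans _ _ ((C + 1) * (e / (C + 1)))); last by rewrite mulrC divfK// gt_eqF.
apply: ler_pM => //; last exact: Hn.
by apply: le_trans (HC r _) _; rewrite ?lerDl// ltW.
Qed.

Lemma approxZ a p F : approx p F -> approx (fun n => a *: p n) (fun r => a * F r).
Proof.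
move=> /(approxM a%:P) [[B pB] pF]; split.
  by exists B => n r r01; rewrite -mul_polyC; exact: pB.
move=> e e0; have := pF e e0; apply: filterS => n Hn r r0 r1.
by have := Hn r r0 r1; rewrite mul_polyC hornerC.
Qed.

Lemma approx_cst (P : {poly R}) : approx (fun=> P) (fun r => P.[r]).
Proof.
split; first by have [B _ HB] := poly_bnd P; exists B.
by move=> e e0; near=> n => r _ _; rewrite subrr mulr0 normr0 ltW.
Unshelve. all: by end_near. Qed.

Lemma approx_sum N (p : 'I_N -> nat -> {poly R}) (F : 'I_N -> R -> R) :
  (forall i, approx (p i) (F i)) ->
  approx (fun n => \sum_i p i n) (fun r => \sum_i F i r).
Proof.
elim: N p F => [|N IH] p F HpF.
  rewrite (_ : (fun _ => _) = fun=> 0); last by apply/funext => n; rewrite big_ord0.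
  by apply: approx_ext (approx_cst 0) => r _ _; rewrite big_ord0 hornerC.
have := approxD (HpF ord0) (IH _ _ (fun i => HpF (lift ord0 i))).
rewrite (_ : (fun n => \sum_i p i n) = fun n => p ord0 n + \sum_i p (lift ord0 i) n); last first.
  by apply/funext => n; rewrite big_ord_recl.
by apply: approx_ext => r _ _; rewrite big_ord_recl.
Qed.

(** The vectors on which an approximation in the sense of [approx] converges: it does so
    on the range of [K], where the factor [r] is available, and then on the closure because
    the polynomials are bounded. *)
Definition clo f := forall e, 0 < e -> exists y, nrm (f - K y) <= e.

Lemma clo_op y : clo (K y).
Proof. by move=> e e0; exists y; rewrite subrr nrm0 ltW. Qed.

Lemma cloD f g : clo f -> clo g -> clo (f + g).
Proof.
move=> cf cg e e0; have e2 : 0 < e / 2 by rewrite divr_gt0.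
have [x Hx] := cf _ e2; have [y Hy] := cg _ e2; exists (x + y).
by rewrite (opD HK) opprD addrACA (le_trans (ler_nrmD _ _ _))// (splitr e) lerD.
Qed.

Lemma cloN f : clo f -> clo (- f).
Proof. by move=> cf e /cf[y Hy]; exists (- y); rewrite (opN HK) -opprD nrmN. Qed.

Lemma approx_tends p F f : approx p F -> clo f -> exists u, tends (fun n => act (p n) f) u.
Proof.
move=> [[B pB] pF] cf; apply: cauchy_tends => e e0.
have B0 : 0 <= B by apply: le_trans (pB 0%N 0 _) => //; rewrite lexx ler01.
have e1 : 0 < e / (4 * (B + 1)) by rewrite divr_gt0// mulr_gt0// ltr_wpDl.
have [y Hy] := cf _ e1.
have y1 : 0 < nrm y + 1 by rewrite ltr_wpDl.
have e2 : 0 < e / (4 * (nrm y + 1)) by rewrite divr_gt0// mulr_gt0.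
have [N _ HN] := pF _ e2; exists N => k l Nk Nl.
have -> : act (p k) f - act (p l) f =
    act (p k - p l) (f - K y) + act (p k - p l) (K y).
  by rewrite -(actDr HK) subrK actBl.
apply: le_trans (ler_nrmD _ _ _) _; rewrite (splitr e); apply: lerD.
  have Hkl r : 0 <= r <= 1 -> `|(p k - p l).[r]| <= 2 * B.
    move=> r01; rewrite hornerD hornerN; apply: le_trans (ler_normB _ _) _.
    have := pB k r r01; have := pB l r r01; lra.
  apply: le_trans (act_le _ Hkl) _.
  apply: (@le_trans _ _ (2 * (B + 1) * (e / (4 * (B + 1))))).
    by apply: ler_pM => //; rewrite ?mulr_ge0// ler_wpM2l// lerDl.
  by rewrite le_eqVlt; apply/orP; left; apply/eqP; field; rewrite gt_eqF// ltr_wpDl.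
apply: le_trans (act_op_le (M := 0) (e := 2 * (e / (4 * (nrm y + 1)))) _ _ _ _) _ => //.
- by rewrite mulr_ge0// ltW.
- move=> r r0 r1; rewrite mul0r add0r hornerD hornerN.
  have -> : r * ((p k).[r] - (p l).[r]) = r * ((p k).[r] - F r) - r * ((p l).[r] - F r) by ring.
  apply: le_trans (ler_normB _ _) _.
  have := HN k Nk r r0 r1; have := HN l Nl r r0 r1; lra.
rewrite mul0r add0r; apply: (@le_trans _ _ (2 * (e / (4 * (nrm y + 1))) * (nrm y + 1))).
  by rewrite ler_wpM2l ?lerDl// mulr_ge0// ltW.
by rewrite le_eqVlt; apply/orP; left; apply/eqP; field; rewrite gt_eqF.
Qed.

(** The limit obeys the bound of the limit symbol, which may be smaller than that of the
    approximating polynomials. *)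
Lemma approx_le p F f u (M : R) : approx p F -> clo f ->
  (forall r, 0 < r -> r <= 1 -> `|F r| <= M) -> tends (fun n => act (p n) f) u ->
  nrm u <= M * nrm f.
Proof.
move=> [[B pB] pF] cf HM Hu; apply/ler_addgt0Pr => e e0.
have B0 : 0 <= B by apply: le_trans (pB 0%N 0 _) => //; rewrite lexx ler01.
have M0 : 0 <= M by apply: le_trans (HM 1 _ _).
pose d := e / (2 * (B + M + 1)).
have BM1 : 0 < 2 * (B + M + 1) by rewrite mulr_gt0// ltr_wpDl// addr_ge0.
have d0 : 0 < d by rewrite divr_gt0.
have [y Hy] := cf _ d0.
have y1 : 0 < 2 * (nrm y + 1) by rewrite mulr_gt0// ltr_wpDl.
pose e2 := e / (2 * (nrm y + 1)); have e20 : 0 < e2 by rewrite divr_gt0.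
apply: tends_nrm_le Hu _; have := pF _ e20; apply: filterS => n Hn.
have -> : act (p n) f = act (p n) (f - K y) + act (p n) (K y) by rewrite -(actDr HK) subrK.
apply: le_trans (ler_nrmD _ _ _) _.
have H1 : nrm (act (p n) (f - K y)) <= B * d.
  by apply: le_trans (act_le _ (pB n)) _; rewrite ler_wpM2l.
have H2 : nrm (act (p n) (K y)) <= M * nrm (K y) + e2 * nrm y.
  apply: act_op_le => //; first exact: ltW.
  move=> r r0 r1; have -> : r * (p n).[r] = r * F r + r * ((p n).[r] - F r) by ring.
  apply: le_trans (ler_normD _ _) _; apply: lerD; last exact: Hn.
  by rewrite normrM mulrC (gtr0_norm r0); apply: ler_wpM2r; [exact: ltW|exact: HM].
have H3 : nrm (K y) <= nrm f + d.
  by rewrite -[K y](subrK f) addrC (le_trans (ler_nrmD _ _ _))// lerD2l nrmB.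
have H4 : M * nrm (K y) <= M * (nrm f + d) by rewrite ler_wpM2l.
have H5 : e2 * nrm y <= e / 2.
  apply: (@le_trans _ _ (e2 * (nrm y + 1))); first by rewrite ler_wpM2l ?lerDl// ltW.
  by rewrite /e2 le_eqVlt; apply/orP; left; apply/eqP; field; rewrite gt_eqF// ltr_wpDl.
have H6 : (B + M) * d <= e / 2.
  apply: (@le_trans _ _ ((B + M + 1) * d)); first by rewrite ler_wpM2r ?lerDl// ltW.
  by rewrite /d le_eqVlt; apply/orP; left; apply/eqP; field; rewrite gt_eqF// ltr_wpDl// addr_ge0.
lra.
Qed.

(** Splitting [f] as [(f - K y) + K y] trades a symbol that is bounded but not small
    against one that is small after multiplication by [r]; continuity in time and
    convergence of Riemann sums both come from this estimate. *)
Lemma approx_le_split p F f u (M d : R) : approx p F -> clo f ->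
  (forall r, 0 < r -> r <= 1 -> `|F r| <= M) ->
  (forall r, 0 < r -> r <= 1 -> `|r * F r| <= d) ->
  tends (fun n => act (p n) f) u -> forall y, nrm u <= M * nrm (f - K y) + d * nrm y.
Proof.
move=> pF cf HM Hd Hu y.
have d0 : 0 <= d by apply: le_trans (Hd 1 _ _).
have [v Hv] := approx_tends pF (@clo_op y).
have Huv : tends (fun n => act (p n) (f - K y)) (u - v).
  have := tendsD Hu (tendsZ (-1) Hv); rewrite scaleN1r; apply: tends_ext => n.
  by rewrite scaleN1r (actBr HK).
rewrite -[u](subrK v); apply: le_trans (ler_nrmD _ _ _) _; apply: lerD.
  by apply: approx_le pF _ HM Huv; apply: cloD => //; apply: cloN; exact: clo_op.
apply/ler_addgt0Pr => e e0; have y1 : 0 < nrm y + 1 by rewrite ltr_wpDl.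
have e1 : 0 < e / (nrm y + 1) by rewrite divr_gt0.
apply: tends_nrm_le Hv _; have [_ /(_ _ e1)] := pF; apply: filterS => n Hn.
apply: le_trans (act_op_le (M := 0) (e := d + e / (nrm y + 1)) _ _ _ _) _ => //.
- by rewrite addr_ge0// ltW.
- move=> r r0 r1; have -> : r * (p n).[r] = r * F r + r * ((p n).[r] - F r) by ring.
  rewrite mul0r add0r; apply: le_trans (ler_normD _ _) _; apply: lerD; first exact: Hd.
  exact: Hn.
rewrite mul0r add0r mulrDl lerD2l.
apply: (@le_trans _ _ (e / (nrm y + 1) * (nrm y + 1))); last by rewrite divfK// gt_eqF.
by rewrite ler_wpM2l ?lerDl// ltW.
Qed.

(** ** The cosine family *)

Variable om : R.
Hypothesis om0 : 0 < om.

Fact inv_succ_gt0 n : 0 < n.+1%:R^-1 :> R. Proof. by rewrite invr_gt0. Qed.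

Definition cos_poly t n := projT1 (cid (cos_approx (om * t) (inv_succ_gt0 n))).

Definition cos_symbol t r := cos (om * t / Num.sqrt r).

Lemma cos_poly_approx t : approx (cos_poly t) (cos_symbol t).
Proof.
have HP n := projT2 (cid (cos_approx (om * t) (inv_succ_gt0 n))).
split; first by exists 2 => n; have [] := HP n.
move=> e e0; have : \forall n \near \oo, n.+1%:R^-1 < e.
  by apply: (@near_infty_natSinv_lt R (PosNum e0)).
apply: filterS => n /ltW ne r r0 r1; have [_ Hn] := HP n.
exact: le_trans (Hn r r0 r1) ne.
Qed.

Lemma cos_symbol_le t r : `|cos_symbol t r| <= 1.
Proof. by rewrite ler_norml cos_geN1 cos_le1. Qed.

Lemma cos_symbol_lip t s r : 0 < r -> r <= 1 ->
  `|r * (cos_symbol t r - cos_symbol s r)| <= om * `|t - s|.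
Proof.
move=> r0 r1; have q0 : 0 < Num.sqrt r by rewrite sqrtr_gt0.
rewrite normrM (gtr0_norm r0).
apply: (@le_trans _ _ (r * (om * `|t - s| / Num.sqrt r))).
  rewrite ler_wpM2l ?(ltW r0)//; apply: le_trans (cos_lip _ _) _.
  by rewrite -mulrBl -mulrBr !normrM (gtr0_norm om0) normfV (gtr0_norm q0).
rewrite mulrCA -[leRHS]mulr1; apply: ler_wpM2l; first by rewrite mulr_ge0// ltW.
rewrite -{1}(sqr_sqrtr (ltW r0)) expr2 mulfK ?gt_eqF//.
by rewrite -[leRHS]sqrtr1 ler_sqrt.
Qed.

Definition Cos t f := xget 0 [set u | tends (fun n => act (cos_poly t n) f) u].

Lemma Cos_tends t f : clo f -> tends (fun n => act (cos_poly t n) f) (Cos t f).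
Proof.
move=> cf; rewrite /Cos; case: xgetP => // noex.
by have [u /noex] := approx_tends (cos_poly_approx t) cf.
Qed.

Lemma Cos_le t f : clo f -> nrm (Cos t f) <= nrm f.
Proof.
move=> cf; rewrite -[leRHS]mul1r.
exact: approx_le (cos_poly_approx t) cf (fun r _ _ => cos_symbol_le t r) (Cos_tends t cf).
Qed.

Lemma CosB t f g : clo f -> clo g -> null (Cos t (f - g) - (Cos t f - Cos t g)).
Proof.
move=> cf cg; have cfg := cloD cf (cloN cg).
apply: tends_unique (Cos_tends t cfg) _.
have := tendsD (Cos_tends t cf) (tendsZ (-1) (Cos_tends t cg)).
by rewrite scaleN1r; apply: tends_ext => n; rewrite scaleN1r (actBr HK).
Qed.

Lemma Cos_eq t f g : clo f -> clo g -> null (f - g) -> null (Cos t f - Cos t g).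
Proof.
move=> cf cg fg; have cfg := cloD cf (cloN cg).
have := nullB (nrm_le0 (le_trans (Cos_le t cfg) _)) (CosB t cf cg).
by rewrite opprB addrCA subrr addr0; apply; rewrite fg.
Qed.

Lemma Cos_op t y : clo y -> null (Cos t (K y) - K (Cos t y)).
Proof.
move=> cy; apply: tends_unique (Cos_tends t (@clo_op y)) _.
have KB x z : K (x - z) = K x - K z by rewrite (opD HK) (opN HK).
have K1 x : nrm (K x) <= 1 * nrm x by rewrite mul1r; exact: op_le.
by have := tends_bnd KB K1 (Cos_tends t cy); apply: tends_ext => n; rewrite (act_op HK).
Qed.

Lemma Cos_hcont f : clo f -> hcont H (Cos^~ f).
Proof.
move=> cf t e e0; have e4 : 0 < e / 4 by rewrite divr_gt0.
have [y Hy] := cf _ e4; have y1 : 0 < om * (nrm y + 1) by rewrite mulr_gt0// ltr_wpDl.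
exists (e / (2 * (om * (nrm y + 1)))); first by rewrite divr_gt0// mulr_gt0.
move=> s st; have Hp := approxD (cos_poly_approx s) (approxZ (-1) (cos_poly_approx t)).
have := approx_le_split (M := 2) (d := om * `|s - t|) Hp cf _ _ _ y.
move=> /(_ (Cos s f - Cos t f)) Hle; apply: le_trans (Hle _ _ _) _.
- move=> r _ _; rewrite mulN1r; apply: le_trans (ler_normB _ _) _.
  by have := cos_symbol_le s r; have := cos_symbol_le t r; lra.
- by move=> r r0 r1; rewrite mulN1r; exact: cos_symbol_lip.
- have := tendsD (Cos_tends s cf) (tendsZ (-1) (Cos_tends t cf)); rewrite scaleN1r.
  by apply: tends_ext => n; rewrite !scaleN1r actDl actNl.
have H2 : om * `|s - t| * nrm y <= e / 2.
  apply: (@le_trans _ _ (om * (nrm y + 1) * (e / (2 * (om * (nrm y + 1)))))).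
    rewrite mulrAC; apply: ler_pM => //; rewrite ?mulr_ge0 ?(ltW om0)//; last exact: ltW.
    by apply: ler_wpM2l; rewrite ?lerDl// ltW.
  rewrite le_eqVlt; apply/orP; left; apply/eqP.
  by move: (om * (nrm y + 1)) y1 => X X0; field; exact: lt0r_neq0.
lra.
Qed.

(** ** Second primitives of the cosine family *)

(** The Riemann sum of [(t - s) cos (a s)] on [[0, t]], with [a = om / sqrt r], tends to
    [(1 - cos (a t)) / a ^ 2]. The Lipschitz constant of the integrand grows like [1 / sqrt r],
    and the factor [r] makes the error uniform. *)
Lemma cos_symbol_riemann t r n : 0 < r -> r <= 1 -> (0 < n)%N ->
  `|r * (\sum_(k < n) t / n%:R * ((t - k%:R * (t / n%:R)) * cos_symbol (k%:R * (t / n%:R)) r)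
         + r / om ^+ 2 * (cos_symbol t r - 1))|
    <= `|t| * (`|t| * (1 + 2 * `|t| * om)) / n%:R.
Proof.
move=> r0 r1 n0; have q0 : 0 < Num.sqrt r by rewrite sqrtr_gt0.
pose a := om / Num.sqrt r; have a0 : 0 < a by rewrite divr_gt0.
pose f s := (t - s) * cos (a * s).
pose F s := (t - s) * (sin (a * s) / a) - cos (a * s) / a ^+ 2.
have csE s : cos_symbol s r = cos (a * s).
  by rewrite /cos_symbol /a mulrAC.
have dF (s : R) : is_derive s 1 F (f s).
  rewrite /F; apply: is_derive_eq.
  by rewrite /f /GRing.scale/=; field; exact: lt0r_neq0.
have qq : r = Num.sqrt r ^+ 2 by rewrite sqr_sqrtr// ltW.
have ra : r / om ^+ 2 = (a ^+ 2)^-1.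
  rewrite /a {1}qq; field; rewrite !gt_eqF//.
have F0 : F t - F 0 = r / om ^+ 2 * (1 - cos_symbol t r).
  rewrite /F subrr mul0r add0r mulr0 sin0 mul0r mulr0 add0r cos0 csE ra; ring.
pose L := 1 + 2 * `|t| * a.
have t0 := normr_ge0 t.
have L0 : 0 <= L by rewrite addr_ge0// mulr_ge0 ?mulr_ge0// ltW.
have flip (x y : R) : `|x| <= `|t| -> `|y| <= `|t| -> `|x - y| <= `|t / n%:R| ->
    `|f x - f y| <= L * `|t / n%:R|.
  move=> xt yt xy; apply: le_trans (_ : L * `|x - y| <= _); last by rewrite ler_wpM2l.
  have -> : f x - f y = (y - x) * cos (a * x) + (t - y) * (cos (a * x) - cos (a * y)).
    by rewrite /f; ring.
  apply: le_trans (ler_normD _ _) _; rewrite (_ : L * `|x - y| = `|x - y| + 2 * `|t| * (a * `|x - y|)); last by rewrite /L; ring.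
  apply: lerD.
    by rewrite normrM distrC ler_piMr// ler_norml cos_geN1 cos_le1.
  rewrite normrM; apply: ler_pM => //.
    by apply: le_trans (ler_normB _ _) _; lra.
  by apply: le_trans (cos_lip _ _) _; rewrite -mulrBr normrM gtr0_norm.
have := riemann_sum_est n0 dF flip; rewrite F0 => HS.
rewrite normrM (gtr0_norm r0).
have -> : \sum_(k < n) t / n%:R * ((t - k%:R * (t / n%:R)) * cos_symbol (k%:R * (t / n%:R)) r)
    + r / om ^+ 2 * (cos_symbol t r - 1)
   = \sum_(k < n) t / n%:R * f (k%:R * (t / n%:R)) - r / om ^+ 2 * (1 - cos_symbol t r).
  rewrite -mulrN opprB; congr (_ + _); apply: eq_bigr => k _.
  by rewrite csE.
apply: le_trans (_ : r * (`|t| * (L * `|t / n%:R|)) <= _); first by rewrite ler_wpM2l// ltW.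
have rL : r * L <= 1 + 2 * `|t| * om.
  have ra1 : r * a <= om.
    have -> : r * a = om * Num.sqrt r.
      by rewrite /a {1}qq; field; rewrite gt_eqF.
    rewrite -[leRHS]mulr1; apply: ler_wpM2l; first exact: ltW.
    by rewrite -[leRHS]sqrtr1 ler_sqrt.
  rewrite /L mulrDr mulr1 lerD// mulrCA; apply: ler_wpM2l => //.
rewrite normrM normfV (ger0_norm (ler0n R n)).
have -> : r * (`|t| * (L * (`|t| / n%:R))) = `|t| * (`|t| * (r * L)) / n%:R by ring.
rewrite ler_wpM2r// ?invr_ge0//; apply: ler_wpM2l => //; exact: ler_wpM2l.
Qed.

Lemma tends_cst x : tends (fun=> x) x.
Proof. by move=> e e0; apply: nearW => n; rewrite subrr nrm0 ltW. Qed.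

Lemma tends_sum N (u : 'I_N -> nat -> E) (x : 'I_N -> E) : (forall i, tends (u i) (x i)) ->
  tends (fun n => \sum_i u i n) (\sum_i x i).
Proof.
elim: N u x => [|N IH] u x Hu.
  by rewrite big_ord0; apply: tends_ext (tends_cst 0) => n; rewrite big_ord0.
have := tendsD (Hu ord0) (IH _ _ (fun i => Hu (lift ord0 i))).
by rewrite big_ord_recl; apply: tends_ext => n; rewrite big_ord_recl.
Qed.

(** The second primitive is the integral of [(t - s) Cos s f], the limit of Riemann sums.
    Such a sum plus [om ^ -2 K (Cos t f - f)] is the action of a symbol bounded uniformly in
    [n], and of size [1 / n] after multiplication by [r]. *)
Lemma Cos_second f V1 V2 : clo f -> wprim H (Cos^~ f) V1 -> wprim H V1 V2 ->
  null (V1 0) -> null (V2 0) ->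
  forall t, null (V2 t + om ^- 2 *: K (Cos t f - f)).
Proof.
move=> cf H1 H2 V10 V20 t.
pose v s := (t - s) *: Cos s f; pose X := om ^- 2 *: K (Cos t f - f).
have cv : hcont H v.
  by apply: hcont_scale (Cos_hcont cf) => s; apply: cvgB; [exact: cvg_cst|exact: cvg_id].
have HD : tends (fun n => usum v t n + X) (V2 t + X).
  apply: tendsD (tends_cst X).
  apply: tends_null (usum_tends t cv (wprim_second t H1 H2)).
  rewrite subrr scale0r add0r subr0 addrAC subrr add0r; apply: nullN; apply: nullD => //.
  exact: nullZ.
pose M := 2 * `|t| ^+ 2 + om ^- 2 * 2.
have om2 : 0 <= om ^- 2 by rewrite invr_ge0 exprn_ge0// ltW.
have M0 : 0 <= M by rewrite addr_ge0// mulr_ge0// exprn_ge0.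
pose C := `|t| * (`|t| * (1 + 2 * `|t| * om)).
have C0 : 0 <= C by rewrite !mulr_ge0// addr_ge0// !mulr_ge0// ltW.
have bnd n y : (0 < n)%N -> nrm (usum v t n + X) <= M * nrm (f - K y) + C / n%:R * nrm y.
  move=> n0; pose h := t / n%:R; pose a (k : 'I_n) := h * (t - k%:R * h).
  pose F r := \sum_(k < n) a k * cos_symbol (k%:R * h) r + r / om ^+ 2 * (cos_symbol t r - 1).
  have aF : approx (fun m => \sum_(k < n) a k *: cos_poly (k%:R * h) m +
      om ^- 2 *: ('X * (cos_poly t m + (-1)%:P))) F.
    have A1 := approx_sum (fun k : 'I_n => approxZ (a k) (cos_poly_approx (k%:R * h))).
    have A2 := approxZ (om ^- 2) (approxM 'X (approxD (cos_poly_approx t) (approx_cst (-1)%:P))).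
    by apply: approx_ext (approxD A1 A2) => r _ _; rewrite hornerX hornerC /F; ring.
  apply: (approx_le_split aF cf _ _ _ y).
  - move=> r r0 r1; apply: le_trans (ler_normD _ _) _; apply: lerD.
      apply: le_trans (ler_norm_sum _ _ _) _.
      have -> : 2 * `|t| ^+ 2 = \sum_(k < n) (`|h| * (2 * `|t|)).
        rewrite sumr_const card_ord -mulr_natr normrM normfV (ger0_norm (ler0n R n)).
        by field; rewrite pnatr_eq0 -lt0n.
      apply: ler_sum => k _; rewrite normrM.
      apply: (@le_trans _ _ (`|a k|)); first by rewrite ler_piMr// cos_symbol_le.
      rewrite normrM ler_wpM2l//; apply: le_trans (ler_normB _ _) _.
      rewrite mulrDl mul1r lerD2l /h mulrCA normrM ler_piMr// ger0_norm ?divr_ge0//.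
      by rewrite ler_pdivrMr ?ltr0n// mul1r ler_nat ltnW.
    rewrite -mulrA mulrC -mulrA normrM (ger0_norm om2) ler_wpM2l// normrM.
    rewrite -[leRHS]mulr1; apply: ler_pM => //; last by rewrite ger0_norm// ltW.
    apply: le_trans (ler_normB _ _) _; rewrite normr1.
    by have := cos_symbol_le t r; lra.
  - move=> r r0 r1; have := cos_symbol_riemann t r0 r1 n0.
    by rewrite /F; under eq_bigr do rewrite mulrA.
  - under eq_fun do rewrite actDl act_suml actZl mulrC actMX.
    apply: tendsD.
      have := tends_sum (fun k : 'I_n => tendsZ (a k) (Cos_tends (k%:R * h) cf)).
      rewrite /usum; under [\sum_(k < n) h *: _]eq_bigr do rewrite scalerA.
      by apply: tends_ext => m; apply: eq_bigr => k _; rewrite actZl.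
    apply: tendsZ.
    have KB x z : K (x - z) = K x - K z by rewrite (opD HK) (opN HK).
    have K1 x : nrm (K x) <= 1 * nrm x by rewrite mul1r; exact: op_le.
    have := tends_bnd KB K1 (tendsD (Cos_tends t cf) (tends_cst (- f))).
    by apply: tends_ext => m; rewrite actDl actC scaleN1r (act_op HK) (opD HK) (opN HK).
have lim y : nrm (V2 t + X) <= M * nrm (f - K y).
  apply/ler_addgt0Pr => e e0; apply: tends_nrm_le HD _; near=> n.
  have n0 : (0 < n)%N by near: n; exact: nbhs_infty_gt.
  apply: le_trans (bnd n y n0) _; rewrite lerD2l mulrAC ler_pdivrMr ?ltr0n//.
  by rewrite -ler_pdivrMl//; apply: ltW; near: n; exact: nbhs_infty_gtr.
apply: null_small => e e0; have e1 : 0 < e / (M + 1) by rewrite divr_gt0// ltr_wpDl.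
have [y Hy] := cf _ e1; apply: le_trans (lim y) _.
apply: (@le_trans _ _ ((M + 1) * (e / (M + 1)))); last by rewrite mulrC divfK// gt_eqF// ltr_wpDl.
by apply: ler_pM => //; rewrite lerDl.
Unshelve. all: by end_near. Qed.

End CosineFamily.

(** * The closure of the range *)
Section Closure.
Variables (R : realType) (E : lmodType R) (H : hilbert E) (K : E -> E).
Hypothesis HK : pos_contraction H K.
Implicit Types (x y z f g : E) (e : R).

Local Notation "<< x , y >>" := (ip H x y) (at level 0, format "<< x ,  y >>").
Local Notation nrm := (hnrm H).
Local Notation null := (hnull H).
Local Notation tends := (htends H).
Local Notation act := (act K).
Local Notation Q := ((1 - 'X) : {poly R}).

Lemma opB x y : K (x - y) = K x - K y.
Proof. by rewrite (opD HK) (opN HK). Qed.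

Lemma op_nrm1 x : nrm (K x) <= 1 * nrm x.
Proof. by rewrite mul1r (op_le HK). Qed.

Lemma act1 y : act 1 y = y.
Proof. by rewrite -polyC1 actC scale1r. Qed.

Lemma null_op x : null x -> null (K x).
Proof. by move=> x0; apply: nrm_le0; rewrite -x0 (op_le HK). Qed.

(** The powers [(1 - K) ^ n] decrease as quadratic forms, so that [(1 - K) ^ n f] converges,
    to a vector [u] which [K] kills. Then [(1 - K) ^ n] fixes [u], whence [<<u, u>>] is the limit of
    [<<(1 - K) ^ n f, u>> = <<f, u>> = 0]. *)
Lemma ker_sub_pow f : (forall x, null (K x) -> <<f, x>> = 0) -> tends (fun n => act (Q ^+ n) f) 0.
Proof.
move=> fker; pose a n := <<act (Q ^+ n) f, f>>.
have Q01 (r : R) : 0 <= r <= 1 -> 0 <= Q.[r] <= 1.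
  by rewrite !hornerE => /andP[r0 r1]; apply/andP; split; lra.
have a0 n : 0 <= a n.
  apply: (act_pos_ge0 HK) => r /Q01/andP[q0 q1]; rewrite horner_exp; exact: exprn_ge0.
have adec : nonincreasing_seq a.
  apply/nonincreasing_seqP => n; rewrite -subr_ge0 /a -ipBl -actBl.
  apply: (act_pos_ge0 HK) => r /Q01/andP[q0 q1].
  by rewrite hornerD hornerN !horner_exp subr_ge0 exprSr ler_piMr// exprn_ge0.
have cva : cvgn a.
  by apply: (nonincreasing_is_cvgn adec); exists 0 => _ [n _ <-].
have dist k l : nrm (act (Q ^+ k) f - act (Q ^+ l) f) ^+ 2 = a (k + k)%N - 2 * a (k + l)%N + a (l + l)%N.
  rewrite nrm_sqr !ipBl !ipBr /a.
  have E1 i j : <<act (Q ^+ i) f, act (Q ^+ j) f>> = <<act (Q ^+ (i + j)) f, f>>.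
    by rewrite addnC exprD (actM HK) [RHS](act_sym HK).
  by rewrite !E1 [(l + k)%N]addnC; ring.
have [u Hu] : exists u, tends (fun n => act (Q ^+ n) f) u.
  apply: cauchy_tends => e e0; have e2 : 0 < e ^+ 2 / 4 by rewrite divr_gt0// exprn_gt0.
  have /cvgrPdist_le/(_ _ e2)[N _ HN] := cva; exists N => k l Nk Nl.
  rewrite -(@ler_pXn2r _ 2) ?nnegrE ?(ltW e0)// dist.
  have Hkk := HN (k + k)%N (leq_trans Nk (leq_addr _ _)).
  have Hkl := HN (k + l)%N (leq_trans Nk (leq_addr _ _)).
  have Hll := HN (l + l)%N (leq_trans Nl (leq_addr _ _)).
  move: Hkk Hkl Hll; rewrite !ler_norml => /andP[? ?] /andP[? ?] /andP[? ?]; lra.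
have Ku : null (K u).
  have T1 := tends_bnd opB op_nrm1 Hu.
  have T2 : tends (fun n => act (Q ^+ n.+1) f) u.
    move=> e /Hu[N _ HN]; exists N => // n Nn; apply: HN; exact: leqW.
  have := tendsD Hu (tendsZ (-1) T2); rewrite scaleN1r subrr => T3.
  have := tends_unique T1 (tends_ext _ T3); rewrite subr0; apply => n.
  rewrite scaleN1r -actBl -(act_op HK) -actMX; congr (act _ f).
  by rewrite exprS; ring.
have Qu n : null (act (Q ^+ n) u - u).
  have -> : act (Q ^+ n) u - u = - act (geom_poly R n) (K u).
    rewrite -actMX geom_poly_mulX actBl act1 opprB.
    by [].
  apply: nullN; have [B B0 HB] := poly_bnd (geom_poly R n).
  by apply: nrm_le0; apply: le_trans (act_le HK _ HB) _; rewrite Ku mulr0.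
have u0 : null u.
  have := tends_ip (z := u) Hu => T.
  have fu n : <<act (Q ^+ n) f, u>> = 0.
    by rewrite (act_sym HK) -[act _ u](subrK u) ipDr ipC (null_ip _ (Qu n)) add0r fker.
  have : <<u, u>> = 0.
    by move: T; rewrite (funext fu) => /cvg_lim <-//; rewrite lim_cst.
  by rewrite /null /hnrm => ->; rewrite sqrtr0.
by apply: tends_null Hu; rewrite subr0.
Qed.

(** [1 - (1 - K) ^ n] is [K] times a polynomial in [K]. *)
Lemma ker_orth_clo f : (forall x, null (K x) -> <<f, x>> = 0) -> clo H K f.
Proof.
move=> /ker_sub_pow Hf e /Hf[N _ HN]; exists (act (geom_poly R N) f).
have := HN N (leqnn N); rewrite subr0; congr (nrm _ <= _).
by rewrite -(act_op HK) -actMX geom_poly_mulX actBl act1 subKr.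
Qed.

End Closure.

(** * The abstract wave equation *)
Section AbstractWave.
Variables (R : realType) (E : lmodType R) (H : hilbert E) (K P : E -> E) (om : R).
Hypothesis HK : pos_contraction H K.
Hypothesis om0 : 0 < om.
Hypothesis PD : forall x y, P (x + y) = P x + P y.
Hypothesis PZ : forall a x, P (a *: x) = a *: P x.
Hypothesis P_sym : forall x y, ip H (P x) y = ip H x (P y).
Hypothesis P_id : forall x, P (P x) = P x.
Hypothesis PK : forall x, P (K x) = 0.
Hypothesis K_ker : forall x, hnull H (K x) -> hnull H (x - P x).
Implicit Types (x y z f g w : E) (e t s : R) (u v : R -> E).

Local Notation "<< x , y >>" := (ip H x y) (at level 0, format "<< x ,  y >>").
Local Notation nrm := (hnrm H).
Local Notation null := (hnull H).
Local Notation tends := (htends H).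
Local Notation act := (act K).
Local Notation clo := (clo H K).
Local Notation Cos := (Cos H K om).

Lemma PN x : P (- x) = - P x.
Proof. by rewrite -scaleN1r PZ scaleN1r. Qed.

Lemma PB x y : P (x - y) = P x - P y.
Proof. by rewrite PD PN. Qed.

Lemma P_le x : nrm (P x) <= nrm x.
Proof.
have [->|Px0] := eqVneq (nrm (P x)) 0; first exact: nrm_ge0.
have Px : 0 < nrm (P x) by rewrite lt_neqAle eq_sym Px0 nrm_ge0.
rewrite -(ler_pM2r Px) -expr2 nrm_sqr P_sym P_id.
by apply: le_trans (ler_norm _) _; exact: ip_nrm.
Qed.

Lemma null_P x : null x -> null (P x).
Proof. by move=> x0; apply: nrm_le0; rewrite -x0 P_le. Qed.

Lemma clo_subP f : clo (f - P f).
Proof.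
apply: (ker_orth_clo HK) => x /K_ker xP; rewrite -[x](subrK (P x)) ipDr ipC (null_ip _ xP) add0r.
by rewrite -P_sym PB P_id subrr ip0l.
Qed.

Definition Sin g : R -> E := xget (fun=> 0) [set V | wprim H (Cos^~ g) V /\ null (V 0)].

Lemma SinP g : clo g -> wprim H (Cos^~ g) (Sin g) /\ null (Sin g 0).
Proof.
move=> cg; rewrite /Sin; case: xgetP => // noex.
by have [V HV V0] := hcont_wprim (Cos_hcont HK om0 cg); case: (noex V).
Qed.

Lemma Sin_hcont g : clo g -> hcont H (Sin g).
Proof. by move=> cg; have [HS _] := SinP cg; exact: wprim_hcont (Cos_hcont HK om0 cg) HS. Qed.

Lemma Sin_le g t : clo g -> nrm (Sin g t) <= `|t| * nrm g.
Proof.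
move=> cg; have [HS S0] := SinP cg.
have := @wprim_le _ _ H _ _ 0 t (nrm g) HS (nrm_ge0 _ _) (fun s _ _ => Cos_le HK om s cg).
rewrite subr0 mulrC; apply: le_trans; rewrite -[in leLHS](subrK (Sin g 0) (Sin g t)).
by apply: le_trans (ler_nrmD _ _ _) _; rewrite S0 addr0.
Qed.

Lemma Sin_eq f g t : clo f -> clo g -> null (f - g) -> null (Sin f t - Sin g t).
Proof.
move=> cf cg fg; have [Hf f0] := SinP cf; have [Hg g0] := SinP cg.
apply: wprim_unique Hf _ (nullB f0 g0) t; apply: wprim_eq Hg => s.
  by apply: (Cos_eq HK om) => //; rewrite /hnull nrmB.
by rewrite subrr; exact: null0.
Qed.

Lemma Sin_op y t : clo y -> null (Sin (K y) t - K (Sin y t)).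
Proof.
move=> cy; have [Hy y0] := SinP cy; have [HKy Ky0] := SinP (@clo_op _ _ _ _ y).
apply: (wprim_unique (V' := fun t => K (Sin y t)) HKy); last by apply: nullB => //; exact: null_op.
apply: wprim_eq (wprim_op (op_sym HK) Hy) => s.
  by have := nullN (Cos_op HK om s cy); rewrite opprB.
by rewrite subrr; exact: null0.
Qed.

Lemma Sin_second g V : clo g -> wprim H (Sin g) V -> null (V 0) ->
  forall t, null (V t + om ^- 2 *: K (Cos t g - g)).
Proof. by move=> cg HV V0; have [HS S0] := SinP cg; exact: (Cos_second HK om0 cg HS HV). Qed.

(** The mild formulation of [u'' = A u] when [- A] has inverse [om ^- 2 *: K] on the
    complement of its kernel, [P] being the projection on the kernel. *)
Definition mild f g u := hcont H u /\ forall t, exists w,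
  [/\ is_integral H (fun s => (t - s) *: u s) 0 t w,
      null (P (u t - f - t *: g)) &
      null (w - P w + om ^- 2 *: K (u t - f - t *: g))].

Definition wave f g t := P f + t *: P g + (Cos t (f - P f) + Sin (g - P g) t).

Lemma P_Cos t f : clo f -> P f = 0 -> null (P (Cos t f)).
Proof.
move=> cf Pf; have P1 x : nrm (P x) <= 1 * nrm x by rewrite mul1r P_le.
have T := tends_bnd PB P1 (Cos_tends HK om t cf).
have Pact (q : {poly R}) : P (act q f) = 0.
  elim/poly_ind: q => [|q c IH]; first by rewrite act0l; have := PZ 0 0; rewrite !scale0r.
  by rewrite actDl actMX (act_op HK) actC PD PZ PK Pf scaler0 addr0.
rewrite -[P _]subr0; apply: tends_unique T _.
by apply: tends_ext (@tends_cst _ _ H 0) => n; rewrite Pact.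
Qed.

Lemma P_Sin t g : clo g -> P g = 0 -> null (P (Sin g t)).
Proof.
move=> cg Pg; have [HS S0] := SinP cg.
rewrite -[P _]subr0; apply: (wprim_unique (V' := fun=> 0) (wprim_op P_sym HS)); last first.
  by rewrite subr0; exact: null_P.
apply: wprim_eq (@wprim_cst _ _ H 0) => s; last by rewrite subrr; exact: null0.
by rewrite sub0r; apply: nullN; exact: P_Cos.
Qed.

Lemma wprim_affine x y : wprim H (fun=> y) (fun t => x + t *: y).
Proof.
move=> z t; have D : is_derive t 1 (fun s : R => <<x, z>> + s * <<y, z>>) <<y, z>>.
  by apply: is_derive_eq; rewrite /GRing.scale/=; ring.
by apply: is_derive_ext D => s; rewrite ipDl ipZl.
Qed.

Lemma wprim_affine2 x y : wprim H (fun t => x + t *: y) (fun t => t *: x + (t ^+ 2 / 2) *: y).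
Proof.
move=> z t; have D : is_derive t 1 (fun s : R => s * <<x, z>> + s ^+ 2 / 2 * <<y, z>>)
    (<<x, z>> + t * <<y, z>>).
  by apply: is_derive_eq; rewrite /GRing.scale/=; field.
rewrite ipDl ipZl; apply: is_derive_ext D => s; by rewrite ipDl !ipZl.
Qed.

Lemma wprim_affine3 x y :
  wprim H (fun t => t *: x + (t ^+ 2 / 2) *: y) (fun t => (t ^+ 2 / 2) *: x + (t ^+ 3 / 6) *: y).
Proof.
move=> z t; have D : is_derive t 1 (fun s : R => s ^+ 2 / 2 * <<x, z>> + s ^+ 3 / 6 * <<y, z>>)
    (t * <<x, z>> + t ^+ 2 / 2 * <<y, z>>).
  by apply: is_derive_eq; rewrite /GRing.scale/=; field.
rewrite ipDl !ipZl; apply: is_derive_ext D => s; by rewrite ipDl !ipZl.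
Qed.

(** On the kernel the solution is affine in time; on the complement the second primitives of
    [Cos] and [Sin] are known in closed form. *)
Lemma wave_mild f g : mild f g (wave f g).
Proof.
set f0 := f - P f; set g0 := g - P g.
have cf : clo f0 by exact: clo_subP.
have cg : clo g0 by exact: clo_subP.
have Pf0 : P f0 = 0 by rewrite PB P_id subrr.
have Pg0 : P g0 = 0 by rewrite PB P_id subrr.
have [HS S0] := SinP cg; have cS := Sin_hcont cg; have cC := Cos_hcont HK om0 cf.
have cW : hcont H (wave f g).
  apply: hcontD; last exact: hcontD.
  by apply: hcontD; [exact: hcont_cst|apply: hcont_scale => //; [move=> s; exact: cvg_id|exact: hcont_cst]].
have [C1 HC1 C10] := hcont_wprim cC; have cC1 := wprim_hcont cC HC1.
have [C2 HC2 C20] := hcont_wprim cC1.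
have [S1 HS1 S10] := hcont_wprim cS; have cS1 := wprim_hcont cS HS1.
have [S2 HS2 S20] := hcont_wprim cS1.
have H1 := wprimD (wprim_affine2 (P f) (P g)) (wprimD HC1 HS1).
have H2 := wprimD (wprim_affine3 (P f) (P g)) (wprimD HC2 HS2).
have EC := Cos_second HK om0 cf HC1 HC2 C10 C20.
have ES1 := Sin_second cg HS1 S10.
(* the second primitive of [Sin g0], primitive of - om^-2 K (Cos g0 - g0) *)
have ES t : null (S2 t + om ^- 2 *: K (Sin g0 t - t *: g0)).
  have HD := wprimD HS (wprimN (wprim_affine 0 g0)).
  have HKD := wprimZ (- om ^- 2) (wprim_op (op_sym HK) HD).
  have HKD' : wprim H S1 (fun t => - om ^- 2 *: K (Sin g0 t - (0 + t *: g0))).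
    apply: wprim_eq HKD => s; last by rewrite subrr; exact: null0.
    by have := nullN (ES1 s); rewrite opprD addrC scaleNr.
  have i0 : null (S2 0 - - om ^- 2 *: K (Sin g0 0 - (0 + 0 *: g0))).
    rewrite scaleNr opprK scale0r addr0 subr0; apply: nullD => //.
    by apply: nullZ; apply: null_op.
  by have := wprim_unique HS2 HKD' i0 t; rewrite add0r scaleNr opprK.
have uE t : wave f g t - f - t *: g = (Cos t f0 - f0) + (Sin g0 t - t *: g0).
  rewrite /wave -/f0 -/g0; set c := Cos t f0; set d := Sin g0 t; rewrite scalerBr !opprB.
  by rewrite [RHS]addrACA [(_ - _) + (_ - _)]addrACA [RHS]addrA [c + d + _]addrC [RHS]addrA.
split=> // t; exists ((t ^+ 2 / 2) *: P f + (t ^+ 3 / 6) *: P g + (C2 t + S2 t)); split.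
- apply: (integral_second t cW H1 H2); rewrite ?expr0n/= ?mul0r ?scale0r ?add0r ?addr0.
    exact: nullD.
  exact: nullD.
- rewrite uE !PD !PN PZ Pf0 Pg0 scaler0 oppr0 !addr0.
  by apply: nullD; [exact: P_Cos|exact: P_Sin].
rewrite uE (opD HK) scalerDr !PD !PZ !P_id.
have PC2 : null (P (C2 t)).
  have := null_P (EC t); rewrite PD PZ PK scaler0 addr0; exact.
have PS2 : null (P (S2 t)).
  have := null_P (ES t); rewrite PD PZ PK scaler0 addr0; exact.
have := nullB (nullD (EC t) (ES t)) (nullD PC2 PS2).
set a := _ *: P f; set b := _ *: P g; set c := _ *: K _; set d := _ *: K _.
congr (null _); rewrite [C2 t + c + _]addrACA [a + b + _]addrC [a + b + _]addrC.
set Y := P _ + P _; set AB := a + b; by rewrite [Y + AB]addrC addrKA [RHS]addrAC.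
Qed.

Lemma wave_le f g t : nrm (wave f g t) <= 3 * nrm f + 3 * `|t| * nrm g.
Proof.
have h x : nrm (x - P x) <= 2 * nrm x.
  by apply: le_trans (ler_nrmB _ _ _) _; have := P_le x; lra.
have H1 := Cos_le HK om t (clo_subP f); have H2 := Sin_le t (clo_subP g).
have H3 := h f; have H4 : `|t| * nrm (g - P g) <= `|t| * (2 * nrm g) by rewrite ler_wpM2l.
have H5 := P_le f; have H6 : `|t| * nrm (P g) <= `|t| * nrm g by rewrite ler_wpM2l// P_le.
apply: le_trans (ler_nrmD _ _ _) _.
have := ler_nrmD H (P f) (t *: P g); rewrite nrmZ.
have := ler_nrmD H (Cos t (f - P f)) (Sin (g - P g) t); lra.
Qed.

(** The difference of two solutions has no component in the kernel, and its second primitive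
    [W] satisfies [W = - om ^ -2 K (u - v)], so that conservation of energy applies. *)
Lemma mild_unique f g u v : mild f g u -> mild f g v -> forall t, null (u t - v t).
Proof.
move=> [cu Hu] [cv Hv].
have cd : hcont H (fun t => u t - v t).
  apply: hcontD => //; apply: hcont_bnd cv => [x y|x]; first by rewrite opprD.
  by rewrite nrmN; rewrite -[leLHS]mul1r.
have [U1 HU1 U10] := hcont_wprim cu; have cU1 := wprim_hcont cu HU1.
have [U2 HU2 U20] := hcont_wprim cU1.
have [V1 HV1 V10] := hcont_wprim cv; have cV1 := wprim_hcont cv HV1.
have [V2 HV2 V20] := hcont_wprim cV1.
have HD1 := wprimD HU1 (wprimN HV1); have HD2 := wprimD HU2 (wprimN HV2).
have D10 := nullB U10 V10; have D20 := nullB U20 V20.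
have PD0 t : null (P (u t - v t)).
  have [_ [_ Pu _]] := Hu t; have [_ [_ Pv _]] := Hv t.
  by have := nullB Pu Pv; rewrite -PB opprB addrA subrK opprB addrA subrK.
have PV W : wprim H (fun=> 0) W -> null (W 0) -> forall t, null (W t).
  move=> HW W0 t; rewrite -[W t]subr0.
  by apply: (wprim_unique HW (wprim_cst H 0)); rewrite subr0.
have P1 : forall t, null (P (U1 t - V1 t)).
  apply: (PV (fun t => P (U1 t - V1 t))) => [|]; last exact: null_P.
  apply: wprim_eq (wprim_op P_sym HD1) => s; last by rewrite subrr; exact: null0.
  by rewrite subr0.
have P2 : forall t, null (P (U2 t - V2 t)).
  apply: (PV (fun t => P (U2 t - V2 t))) => [|]; last exact: null_P.
  apply: wprim_eq (wprim_op P_sym HD2) => s; last by rewrite subrr; exact: null0.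
  by rewrite subr0.
have om2 : 0 <= om ^- 2 by rewrite invr_ge0 exprn_ge0// ltW.
apply: (@second_primitive_unique _ _ H (fun x => om ^- 2 *: K x) (om ^- 2) _ _ _ _ _ _ _ cd HD1 HD2 D10 D20).
- by move=> x y; rewrite (opB HK) scalerBr.
- by move=> x y; rewrite ipZl ipZr (op_sym HK).
- by move=> x; rewrite ipZl mulr_ge0// (op_ge0 HK).
- by move=> x; rewrite nrmZ (ger0_norm om2) ler_wpM2l// (op_le HK).
move=> t; have [w [Iw _ Ew]] := Hu t; have [w' [Iw' _ Ew']] := Hv t.
have ww := integral_unique Iw (integral_second t cu HU1 HU2 U10 U20).
have ww' := integral_unique Iw' (integral_second t cv HV1 HV2 V10 V20).
apply: ip_null => z.
have e1 := null_ip z ww; have e2 := null_ip z ww'.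
have e3 := null_ip z Ew; have e4 := null_ip z Ew'.
have e5 := null_ip z (null_P ww); have e6 := null_ip z (null_P ww').
have e7 := null_ip z (P2 t).
move: e1 e2 e3 e4 e5 e6 e7.
rewrite !(PD, PN) !(opD HK, opN HK, opZ HK) !(ipDl, ipNl, ipZl); lra.
Qed.

Lemma mildB f g u f' g' u' : mild f g u -> mild f' g' u' ->
  mild (f - f') (g - g') (fun t => u t - u' t).
Proof.
move=> [cu Hu] [cv Hv].
have cd : hcont H (fun t => u t - u' t).
  apply: hcontD => //; apply: hcont_bnd cv => [x y|x]; first by rewrite opprD.
  by rewrite nrmN; rewrite -[leLHS]mul1r.
have [U1 HU1 U10] := hcont_wprim cu; have cU1 := wprim_hcont cu HU1.
have [U2 HU2 U20] := hcont_wprim cU1.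
have [V1 HV1 V10] := hcont_wprim cv; have cV1 := wprim_hcont cv HV1.
have [V2 HV2 V20] := hcont_wprim cV1.
have HD1 := wprimD HU1 (wprimN HV1); have HD2 := wprimD HU2 (wprimN HV2).
split=> // t; exists (U2 t - V2 t).
have [w [Iw Pw Ew]] := Hu t; have [w' [Iw' Pw' Ew']] := Hv t.
have ww := integral_unique Iw (integral_second t cu HU1 HU2 U10 U20).
have ww' := integral_unique Iw' (integral_second t cv HV1 HV2 V10 V20).
split; first exact: (integral_second t cd HD1 HD2 (nullB U10 V10) (nullB U20 V20)).
- apply: ip_null => z; move: (null_ip z Pw) (null_ip z Pw').
  rewrite !(PD, PN, PZ) !(ipDl, ipNl, ipZl); lra.
apply: ip_null => z; move: (null_ip z ww) (null_ip z ww') (null_ip z Ew) (null_ip z Ew')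
  (null_ip z (null_P ww)) (null_ip z (null_P ww')).
rewrite !(PD, PN) !(opD HK, opN HK, opZ HK) !(ipDl, ipNl, ipZl); lra.
Qed.

(** [Cos t] and [Sin t] commute with [K], so the solution is in the range of the same power
    of [K] as the data. *)
Lemma wave_range f g k fk gk t : clo fk -> clo gk ->
  null (f - P f - iter k K fk) -> null (g - P g - iter k K gk) ->
  null (wave f g t - (P (f + t *: g) + iter k K (Cos t fk + Sin gk t))).
Proof.
move=> cf cg Hf Hg.
have it x : clo x -> clo (iter k K x) by case: k {Hf Hg} => [|k] // _; exact: clo_op.
have itC : null (Cos t (iter k K fk) - iter k K (Cos t fk)).
  elim: k {Hf Hg it} => [|k IH] /=; first by rewrite subrr; exact: null0.
  have ck : clo (iter k K fk) by case: k {IH} => [|k] //; exact: clo_op.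
  have := nullD (Cos_op HK om t ck) (null_op HK IH); rewrite (opB HK).
  by rewrite addrA subrK.
have itS : null (Sin (iter k K gk) t - iter k K (Sin gk t)).
  elim: k {Hf Hg it itC} => [|k IH] /=; first by rewrite subrr; exact: null0.
  have ck : clo (iter k K gk) by case: k {IH} => [|k] //; exact: clo_op.
  have := nullD (Sin_op t ck) (null_op HK IH); rewrite (opB HK).
  by rewrite addrA subrK.
have eC := nullD (Cos_eq HK om t (clo_subP f) (it _ cf) Hf) itC.
have eS := nullD (Sin_eq t (clo_subP g) (it _ cg) Hg) itS.
apply: ip_null => z; have := null_ip z eC; have := null_ip z eS.
rewrite /wave PD PZ (iter_opD HK) !ipBl !ipDl !ipNl; lra.
Qed.

End AbstractWave.

(** * Families of square-integrable functions *)
Section L2Families.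
Variables (R : realType) (m : nat).
Implicit Types (f g : 'I_m -> R -> R^o).

Definition L2fam : {pred 'I_m -> R -> R^o} := [pred f | `[< forall j, L2 (f j) >]].

Lemma L2famP f : reflect (forall j, L2 (f j)) (f \in L2fam).
Proof. exact: asboolP. Qed.

Fact L2fam_submod : submod_closed L2fam.
Proof.
split; first by apply/L2famP => j; exact: L2_cst 0.
move=> a f g /L2famP Lf /L2famP Lg; apply/L2famP => j.
by apply: L2D => //; exact: L2Z.
Qed.
HB.instance Definition _ := GRing.isSubmodClosed.Build R ('I_m -> R -> R^o) L2fam L2fam_submod.

Definition X2r := {f : 'I_m -> R -> R^o | f \in L2fam}.
HB.instance Definition _ := SubType.on X2r.
HB.instance Definition _ := Choice.on X2r.
HB.instance Definition _ := [SubChoice_isSubLmodule of X2r by <:].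

Definition fn (f : X2r) : 'I_m -> R -> R := val f.

Lemma fn_L2 (f : X2r) j : L2 (fn f j).
Proof. by case: f => f Hf; move/L2famP: (Hf); exact. Qed.

Definition mkX2 f (Lf : forall j, L2 (f j)) : X2r := exist _ f (introT (L2famP f) Lf).

Section InnerProduct.
Variable mu : 'I_m -> R.
Hypothesis mu_gt0 : forall j, 0 < mu j.

Definition X2ip (f g : X2r) : R := \sum_j mu j * int01 (fun x => fn f j x * fn g j x).

Implicit Types (u v z : X2r).

Fact X2ipC u v : X2ip u v = X2ip v u.
Proof.
by apply: eq_bigr => j _; congr (_ * _); apply: int01_in => x _; exact: mulrC.
Qed.

Fact X2ipDl u v z : X2ip (u + v) z = X2ip u z + X2ip v z.
Proof.
rewrite -big_split/=; apply: eq_bigr => j _; rewrite -mulrDr -int01D; last 2 first.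
- by apply: L2M; exact: fn_L2.
- by apply: L2M; exact: fn_L2.
by congr (_ * _); apply: int01_in => x _; rewrite -mulrDl.
Qed.

Fact X2ipZl a u v : X2ip (a *: u) v = a * X2ip u v.
Proof.
rewrite mulr_sumr; apply: eq_bigr => j _; rewrite [RHS]mulrCA; congr (_ * _).
rewrite -int01Z; last by apply: L2M; exact: fn_L2.
by apply: int01_in => x _; rewrite mulrA.
Qed.

Fact X2ip_edge u j : mu j * nrm2 (fn u j) <= X2ip u u.
Proof.
rewrite /X2ip (bigD1 j)//= lerDl; apply: sumr_ge0 => k _.
by apply: mulr_ge0; [exact: ltW|apply: int01_ge0 => x _; rewrite -expr2 sqr_ge0].
Qed.

Fact X2ip_ge0 u : 0 <= X2ip u u.
Proof.
apply: sumr_ge0 => k _.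
by apply: mulr_ge0; [exact: ltW|apply: int01_ge0 => x _; rewrite -expr2 sqr_ge0].
Qed.

Fact X2ip_complete (u : nat -> X2r) :
  (forall e : R, 0 < e -> exists N, forall k l, (N <= k)%N -> (N <= l)%N ->
    X2ip (u k - u l) (u k - u l) <= e) ->
  exists x, forall e : R, 0 < e -> exists N, forall k, (N <= k)%N ->
    X2ip (u k - x) (u k - x) <= e.
Proof.
move=> Hu; have lim j : exists w : R -> R, L2 w /\ forall e : R, 0 < e ->
    exists N, forall k, (N <= k)%N -> nrm2 (fun x => fn (u k) j x - w x) <= e.
  suff [w] : exists2 w : R -> R, L2 w & forall e : R, 0 < e ->
      exists N, forall k, (N <= k)%N -> nrm2 (fun x => fn (u k) j x - w x) <= e by exists w.
  apply: L2_complete => [k|e e0]; first exact: fn_L2.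
  have [N HN] := Hu (mu j * e) (mulr_gt0 (mu_gt0 j) e0); exists N => k l Nk Nl.
  have := le_trans (X2ip_edge (u k - u l) j) (HN k l Nk Nl).
  by rewrite ler_pM2l.
have [w Hw] := choice lim.
pose x := mkX2 (fun j => (Hw j).1); exists x => e e0.
have Hj j : exists N, forall k, (N <= k)%N ->
    mu j * nrm2 (fun y => fn (u k) j y - w j y) <= e / m.+1%:R.
  have em : 0 < e / m.+1%:R / mu j by rewrite !divr_gt0.
  have [N HN] := (Hw j).2 _ em; exists N => k /HN.
  by rewrite ler_pdivlMr// mulrC.
have [N HN] := choice Hj; exists (\max_j N j)%N => k Nk.
apply: (@le_trans _ _ (\sum_(j < m) e / m.+1%:R)).
  by apply: ler_sum => j _; apply: HN; apply: leq_trans Nk; exact: leq_bigmax.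
rewrite sumr_const card_ord -[_ *+ m]mulr_natr mulrAC ler_pdivrMr ?ltr0n//.
by rewrite ler_wpM2l ?(ltW e0)// ler_nat.
Qed.

Definition X2hilbert : hilbert X2r :=
  Hilbert X2ipC X2ipDl X2ipZl X2ip_ge0 X2ip_complete.

End InnerProduct.

End L2Families.

(** ** Bounded linear functionals *)
Section BoundedFunctionals.
Variables (R : realType) (m : nat).
Local Notation X2r := (X2r R m).
Implicit Types (f g : X2r).
Variable mu : 'I_m -> R.
Hypothesis mu_gt0 : forall j, 0 < mu j.
Local Notation nrm := (hnrm (X2hilbert mu_gt0)).

(** Linearity and boundedness of the resolvent are proved together, value by value: each
    of the intermediate quantities is a family of functionals, indexed by edges, vertices or
    pairs of an edge and a point, with one bound for the whole family. *)
Definition blin (T : Type) (phi : T -> X2r -> R) :=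
  (forall t a f g, phi t (a *: f + g) = a * phi t f + phi t g) /\
  exists2 C : R, 0 <= C & forall t f, `|phi t f| <= C * nrm f.

Definition bounded (T : Type) (a : T -> R) := exists M : R, forall t, `|a t| <= M.

Lemma bounded_fin (T : finType) (a : T -> R) : bounded a.
Proof.
exists (\sum_t `|a t|) => t; rewrite (bigD1 t)//= lerDl; exact: sumr_ge0.
Qed.

Lemma blin_comp (S T : Type) (s : S -> T) (phi : T -> X2r -> R) : blin phi -> blin (phi \o s).
Proof. by move=> [L [C C0 HC]]; split=> [t|]; [exact: L|exists C => // t; exact: HC]. Qed.

Lemma blin_ext (T : Type) (phi psi : T -> X2r -> R) : (forall t f, phi t f = psi t f) ->
  blin phi -> blin psi.
Proof.
move=> E [L [C C0 HC]]; split=> [t a f g|]; first by rewrite -!E L.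
by exists C => // t f; rewrite -E.
Qed.

Lemma blinD (T : Type) (phi psi : T -> X2r -> R) : blin phi -> blin psi ->
  blin (fun t f => phi t f + psi t f).
Proof.
move=> [L [C C0 HC]] [L' [C' C'0 HC']]; split=> [t a f g|].
  by rewrite L L'; ring.
exists (C + C') => [|t f]; first exact: addr_ge0.
by apply: le_trans (ler_normD _ _) _; rewrite mulrDl lerD.
Qed.

Lemma blinM (T : Type) (a : T -> R) (phi : T -> X2r -> R) : bounded a -> blin phi ->
  blin (fun t f => a t * phi t f).
Proof.
move=> [M HM] [L [C C0 HC]]; split=> [t b f g|]; first by rewrite L; ring.
exists (`|M| * C) => [|t f]; first exact: mulr_ge0.
rewrite normrM -mulrA; apply: ler_pM => //.
by apply: le_trans (HM t) _; exact: ler_norm.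
Qed.

Lemma blinB (T : Type) (phi psi : T -> X2r -> R) : blin phi -> blin psi ->
  blin (fun t f => phi t f - psi t f).
Proof.
move=> Hp Hq; have b1 : bounded (fun _ : T => - 1 : R) by exists 1 => t; rewrite normrN1.
by apply: blin_ext (blinD Hp (blinM b1 Hq)) => t f; rewrite mulN1r.
Qed.

Lemma blin_sum (T : Type) N (phi : 'I_N -> T -> X2r -> R) : (forall i, blin (phi i)) ->
  blin (fun t f => \sum_i phi i t f).
Proof.
elim: N phi => [|N IH] phi Hphi.
  split=> [t a f g|]; first by rewrite !big_ord0 mulr0 addr0.
  by exists 0 => // t f; rewrite big_ord0 normr0 mul0r.
apply: blin_ext (blinD (Hphi ord0) (IH _ (fun i => Hphi (lift ord0 i)))) => t f.
by rewrite big_ord_recl.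
Qed.

Lemma blin_int (T : Type) (k : T -> R -> R) (phi : T -> R -> X2r -> R) :
  (forall t, int1 (k t)) -> bounded (fun t => int01 (fun y => `|k t y|)) ->
  blin (fun p : T * R => phi p.1 p.2) -> (forall t f, meas01 (phi t ^~ f)) ->
  blin (fun t f => int01 (fun y => k t y * phi t y f)).
Proof.
move=> ki [M HM] [L [C C0 HC]] mphi.
have ib t f : int1 (fun y => k t y * phi t y f).
  apply: int1_in (int1_bndM (M := C * nrm f) (mphi t f) _ (ki t)) => [y _|y _].
    exact: mulrC.
  exact: HC (t, y) f.
split=> [t a f g|].
  rewrite -int01Z// -int01D//; last exact: int1Z.
  by apply: int01_in => y _; have := L (t, y) a f g => /= ->; ring.
exists (`|M| * C) => [|t f]; first exact: mulr_ge0.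
apply: le_trans (int01_norm (ib t f)) _.
apply: (@le_trans _ _ (int01 (fun y => (C * nrm f) * `|k t y|))).
  apply: int01_le; first exact: int1_norm.
    by apply: int1Z; exact: int1_norm.
  by move=> y _; rewrite normrM mulrC ler_wpM2r//; exact: HC (t, y) f.
rewrite int01Z; last exact: int1_norm.
rewrite mulrC -mulrA ler_wpM2r ?mulr_ge0//.
by apply: le_trans (ler_norm _) (le_trans (HM t) _); exact: ler_norm.
Qed.

Lemma blin_prim : blin (fun (p : 'I_m * R) f => prim (fn f p.1) p.2).
Proof.
have fi f j : int1 (fn f j) by apply: L2_int1; exact: fn_L2.
split=> [[j x] a f g /=|].
  by rewrite -primZ// -primD//; apply: int1Z.
exists (\sum_j (Num.sqrt (mu j))^-1) => [|[j x] f /=].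
  by apply: sumr_ge0 => j _; rewrite invr_ge0.
have sj : 0 < Num.sqrt (mu j) by rewrite sqrtr_gt0.
apply: (@le_trans _ _ ((Num.sqrt (mu j))^-1 * nrm f)); last first.
  rewrite ler_wpM2r// (bigD1 j)//= lerDl; apply: sumr_ge0 => k _.
  by rewrite invr_ge0.
rewrite mulrC ler_pdivlMr// -(@ler_pXn2r _ 2) ?nnegrE ?mulr_ge0//.
rewrite nrm_sqr exprMn sqr_sqrtr ?(ltW (mu_gt0 j))// real_normK ?num_real// mulrC.
apply: le_trans (X2ip_edge mu_gt0 f j); rewrite ler_pM2l//.
have L1 : L2 (fun y : R => (y < x)%R%:R : R).
  by apply: (@L2_bnd _ _ 1) (meas01_lt x) _ => y _; exact: normr_bool.
apply: le_trans (int01_CS (fn_L2 f j) L1) _.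
rewrite -[leRHS]mulr1 ler_wpM2l//; first by apply: int01_ge0 => y _; exact: sqr_ge0.
rewrite -[leRHS](int01_cst (1 : R)); apply: int01_le; [exact: L2_sqr|exact: int1_cst|].
by move=> y _; case: (y < x); rewrite ?expr1n ?expr0n.
Qed.

Lemma blin_int01 : blin (fun j f => int01 (fn f j)).
Proof.
by apply: blin_ext (blin_comp (fun j => (j, 1)) blin_prim) => j f /=; rewrite prim1.
Qed.

End BoundedFunctionals.

(** * The resolvent of the network operator *)
Section Network.
Variables (R : realType) (n m : nat) (G : graph n m).
Variables (mu : 'I_m -> R) (ci : 'I_m -> R -> R).
Hypothesis mu_gt0 : forall j, 0 < mu j.
Hypothesis ci_cont : forall j, {within `[0, 1], continuous (ci j)}.
Hypothesis ci_gt0 : forall j (x : R), 0 <= x <= 1 -> 0 < ci j x.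
Hypothesis G_conn : connected_graph G.
Hypothesis m_gt0 : (0 < m)%N.
Local Notation X2r := (X2r R m).
Local Notation H := (X2hilbert mu_gt0).
Local Notation nrm := (hnrm H).
Implicit Types (f g h : X2r) (i k : 'I_n) (j : 'I_m) (a x y : R).

Definition inc j i : R := (e0 G j == i)%:R - (e1 G j == i)%:R.

Lemma sum_e0 (d : 'I_n -> R) j : \sum_i (e0 G j == i)%:R * d i = d (e0 G j).
Proof.
rewrite (bigD1 (e0 G j))//= eqxx mul1r big1 ?addr0// => i /negPf.
by rewrite eq_sym => ->; rewrite mul0r.
Qed.

Lemma sum_e1 (d : 'I_n -> R) j : \sum_i (e1 G j == i)%:R * d i = d (e1 G j).
Proof.
rewrite (bigD1 (e1 G j))//= eqxx mul1r big1 ?addr0// => i /negPf.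
by rewrite eq_sym => ->; rewrite mul0r.
Qed.

Lemma sum_inc (d : 'I_n -> R) j : \sum_i inc j i * d i = d (e0 G j) - d (e1 G j).
Proof.
by rewrite -sum_e0 -sum_e1 -sumrB; apply: eq_bigr => i _; rewrite mulrBl.
Qed.

(** ** The weighted Laplacian *)

(** The resistance of the edge when [ci] is the inverse of the weight. *)
Definition gam j := int01 (ci j).

Lemma gam_gt0 j : 0 < gam j.
Proof.
rewrite lt_neqAle eq_sym; apply/andP; split; last first.
  by apply: int01_ge0 => x /andP[/ltW x0 /ltW x1]; rewrite ltW// ci_gt0// x0.
apply/eqP => g0; have L := cont01_L2 (@ci_cont j).
have := int01_eq0 (L2_int1 L) _ g0; have ge0 x : 0 < x < 1 -> 0 <= ci j x.
  by move=> /andP[/ltW x0 /ltW x1]; rewrite ltW// ci_gt0// x0.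
move=> /(_ ge0) /(cont01_ae0 (@ci_cont j)) /(_ 0); rewrite lexx ler01 => /(_ isT).
by have := ci_gt0 j (x := 0); rewrite lexx ler01 => /(_ isT) /gt_eqF/eqP.
Qed.

Definition wt j := mu j / gam j.

Lemma wt_gt0 j : 0 < wt j. Proof. by rewrite divr_gt0// gam_gt0. Qed.

(** The Laplacian is singular on constants; adding the all-ones matrix makes it
    invertible. *)
Definition Lap : 'M[R]_n := \matrix_(i, k) (\sum_j wt j * inc j i * inc j k + 1).

Lemma LapE (v : 'I_n -> R) i :
  (Lap *m \col_k v k) i 0 = \sum_j wt j * inc j i * (v (e0 G j) - v (e1 G j)) + \sum_k v k.
Proof.
rewrite mxE; under eq_bigr do rewrite !mxE mulrDl mul1r.
rewrite big_split/=; congr (_ + _).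
under eq_bigr do rewrite mulr_suml.
rewrite exchange_big/=; apply: eq_bigr => j _; rewrite -(sum_inc v j) mulr_sumr.
by apply: eq_bigr => k _; rewrite !mulrA.
Qed.

(** The quadratic form is the sum of a Dirichlet energy and of the square of the total. The
    energy makes the vector constant along edges, hence constant by connectedness, and the
    total makes the constant zero. *)
Lemma Lap_ker (v : 'I_n -> R) : (forall i, (Lap *m \col_k v k) i 0 = 0) -> forall i, v i = 0.
Proof.
move=> Lv; have : \sum_i v i * (Lap *m \col_k v k) i 0 = 0.
  by apply: big1 => i _; rewrite Lv mulr0.
under eq_bigr do rewrite LapE mulrDr.
rewrite big_split/= -mulr_suml -expr2.
have -> : \sum_i v i * (\sum_j wt j * inc j i * (v (e0 G j) - v (e1 G j))) =
    \sum_j wt j * (v (e0 G j) - v (e1 G j)) ^+ 2.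
  under eq_bigr do rewrite mulr_sumr.
  rewrite exchange_big/=; apply: eq_bigr => j _.
  transitivity (wt j * (v (e0 G j) - v (e1 G j)) * \sum_i inc j i * v i).
    by rewrite mulr_sumr; apply: eq_bigr => i _; ring.
  by rewrite sum_inc; ring.
have ge j : 0 <= wt j * (v (e0 G j) - v (e1 G j)) ^+ 2.
  by rewrite mulr_ge0 ?sqr_ge0// ltW// wt_gt0.
move=> /eqP; rewrite paddr_eq0 ?sqr_ge0 ?sumr_ge0// psumr_eq0// sqrf_eq0.
move=> /andP[/allP dv0 /eqP sv].
have edge j : v (e0 G j) = v (e1 G j).
  have := dv0 j (mem_index_enum _); rewrite mulf_eq0 gt_eqF ?wt_gt0//= sqrf_eq0 subr_eq0.
  by move/eqP.
have adj i k : Defs.adjacent G i k -> v i = v k.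
  move=> /existsP[j /andP[/andP[_]]]; rewrite /incident.
  by move=> /orP[]/eqP <- /orP[]/eqP <-; rewrite ?edge.
have conn i k : v i = v k.
  have /connectP[p pp ->] := (G_conn.2 i k); elim: p i pp => //= l p IH i /andP[il pl].
  by rewrite (adj i l il); exact: IH.
move=> i; have : n%:R * v i = 0.
  rewrite -sv (eq_bigr (fun=> v i)) => [|k _]; last exact: conn.
  by rewrite sumr_const card_ord mulr_natl.
move=> /eqP; rewrite mulf_eq0 pnatr_eq0 => /orP[/eqP n0|/eqP//].
by have := G_conn.1; rewrite n0.
Qed.

Lemma Lap_unit : Lap \in unitmx.
Proof.
rewrite -row_free_unit; apply: inj_row_free => v vL; apply/rowP => i; rewrite [RHS]mxE.
apply: (Lap_ker (v := fun i => v 0 i)) => k.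
have <- : v^T = \col_k v 0 k by apply/matrixP => p q; rewrite !mxE (ord1 q).
have LT : Lap^T = Lap.
  apply/matrixP => p q; rewrite !mxE; congr (_ + 1); apply: eq_bigr => j _; exact: mulrAC.
by rewrite -LT -trmx_mul vL !mxE.
Qed.

Definition lap_sol (b : 'I_n -> R) i := (invmx Lap *m \col_k b k) i 0.

(** Summing the equations over the vertices cancels the Laplacian, so the total of the
    solution is zero and the all-ones matrix contributes nothing. *)
Lemma lap_solP (b : 'I_n -> R) : \sum_i b i = 0 -> forall i,
  \sum_j wt j * inc j i * (lap_sol b (e0 G j) - lap_sol b (e1 G j)) = b i.
Proof.
move=> b0 i; have E k : \sum_j wt j * inc j k * (lap_sol b (e0 G j) - lap_sol b (e1 G j)) +
    \sum_l lap_sol b l = b k.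
  rewrite -LapE (_ : \col_k lap_sol b k = invmx Lap *m \col_k b k).
    by rewrite mulKVmx ?Lap_unit// mxE.
  by apply/matrixP => p q; rewrite mxE (ord1 q).
have : \sum_k (\sum_j wt j * inc j k * (lap_sol b (e0 G j) - lap_sol b (e1 G j)) +
    \sum_l lap_sol b l) = 0 by rewrite -[RHS]b0; apply: eq_bigr => k _; exact: E.
rewrite big_split/= exchange_big/= big1 ?add0r => [|j _]; last first.
  have := sum_inc (fun=> wt j * (lap_sol b (e0 G j) - lap_sol b (e1 G j))) j.
  by move=> Es; rewrite -[RHS](subrr (wt j * (lap_sol b (e0 G j) - lap_sol b (e1 G j)))) -Es;
    apply: eq_bigr => k _; ring.
rewrite sumr_const card_ord -mulr_natr => /eqP; rewrite mulf_eq0 pnatr_eq0.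
move=> /orP[/eqP s0|/eqP n0]; last by exfalso; move: (G_conn.1); rewrite n0.
by have := E i; rewrite s0 addr0.
Qed.

(** ** The solution operator *)

Definition tot := \sum_j mu j.

Lemma tot_gt0 : 0 < tot.
Proof.
pose j := Ordinal m_gt0; rewrite /tot (bigD1 j)//= ltr_wpDr//.
by apply: sumr_ge0 => k _; exact: ltW.
Qed.

Definition mean (f : 'I_m -> R -> R) : R := (\sum_j mu j * int01 (f j)) / tot.

(** The unknown [w] solves [- (c w')' = f - mean f]: its flux is [kap - prim (ctr f)],
    and the conditions at the two ends of an edge determine [kap] from the values of
    [w] at the vertices, which solve a discrete Laplace equation. *)
Definition ctr f j x := fn f j x - mean (fn f).
Definition bet f j := int01 (fun x => ci j x * prim (ctr f j) x).
Definition rhs f i := \sum_j (wt j * bet f j * inc j i + mu j * int01 (ctr f j) * (e1 G j == i)%:R).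
Definition pot f i := lap_sol (rhs f) i.
Definition kap f j := (pot f (e1 G j) - pot f (e0 G j) + bet f j) / gam j.
Definition flux f j y := kap f j - prim (ctr f j) y.
Definition sol f j x := pot f (e0 G j) + prim (fun y => ci j y * flux f j y) x.
Definition res f j x := sol f j x - mean (sol f).

Lemma ctr_L2 f j : L2 (ctr f j).
Proof. by apply: L2B; [exact: fn_L2|exact: L2_cst]. Qed.

Lemma mean_cst a : mean (fun _ _ => a) = a.
Proof.
rewrite /mean; under eq_bigr do rewrite int01_cst.
by rewrite -mulr_suml mulrAC divff ?mul1r// gt_eqF// tot_gt0.
Qed.

Lemma meanB (u v : 'I_m -> R -> R) : (forall j, L2 (u j)) -> (forall j, L2 (v j)) ->
  mean (fun j x => u j x - v j x) = mean u - mean v.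
Proof.
move=> Lu Lv; rewrite /mean -mulrBl -sumrB; congr (_ / _); apply: eq_bigr => j _.
by rewrite int01B ?mulrBr//; exact: L2_int1.
Qed.

Lemma mean_ctr f : \sum_j mu j * int01 (ctr f j) = 0.
Proof.
have : mean (ctr f) = 0.
  rewrite meanB ?mean_cst ?subrr// => j; first exact: fn_L2.
  exact: L2_cst.
move=> /eqP; rewrite mulf_eq0 invr_eq0 (gt_eqF tot_gt0) orbF => /eqP; exact.
Qed.

(** The solvability condition of the Laplace equation. *)
Lemma rhs_sum f : \sum_i rhs f i = 0.
Proof.
rewrite /rhs exchange_big/= -[RHS](mean_ctr f); apply: eq_bigr => j _.
rewrite big_split/=.
have -> : \sum_i wt j * bet f j * inc j i = 0.
  under eq_bigr do rewrite mulrC.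
  by rewrite (sum_inc (fun=> wt j * bet f j)) subrr.
rewrite add0r.
by under eq_bigr do rewrite mulrC; exact: (sum_e1 (fun=> mu j * int01 (ctr f j))).
Qed.

Lemma flux_AC f j : abscont (flux f j) (fun x => - ctr f j x).
Proof.
apply: abscont_ext (ACB (AC_cst (kap f j)) (AC_prim (ctr_L2 f j))) => x //.
by rewrite sub0r.
Qed.

Lemma sol_AC f j : abscont (sol f j) (fun x => ci j x * flux f j x).
Proof.
have L : L2 (fun x => ci j x * flux f j x).
  by apply: cont01_L2M; [exact: ci_cont|apply: cont01_L2; exact: AC_cont (flux_AC f j)].
apply: abscont_ext (ACD (AC_cst (pot f (e0 G j))) (AC_prim L)) => x //.
by rewrite add0r.
Qed.

Lemma sol0 f j : sol f j 0 = pot f (e0 G j).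
Proof. by rewrite /sol prim0 addr0. Qed.

(** This is the equation that fixes the constant [kap] of the flux. *)
Lemma sol1 f j : sol f j 1 = pot f (e1 G j).
Proof.
rewrite /sol prim1; have Lc := cont01_L2 (@ci_cont j).
have Lp : L2 (fun x => ci j x * prim (ctr f j) x).
  by apply: cont01_L2M; [exact: ci_cont|apply: cont01_L2; apply: prim_cont; exact: ctr_L2].
rewrite (@int01_in _ _ (fun x => kap f j * ci j x - ci j x * prim (ctr f j) x)); last first.
  by move=> x _; rewrite /flux; ring.
rewrite int01B; [|by apply: int1Z; exact: L2_int1|exact: L2_int1].
rewrite int01Z; last exact: L2_int1.
rewrite -/(bet f j) -/(gam j) /kap divfK ?gt_eqF ?gam_gt0//; ring.
Qed.

(** The Laplace equation for [pot], rewritten in terms of fluxes. *)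
Lemma kirchhoff f i : \sum_j mu j * flux f j 0 * (e0 G j == i)%:R =
  \sum_j mu j * flux f j 1 * (e1 G j == i)%:R.
Proof.
have := lap_solP (rhs_sum f) i; rewrite -/(pot f) {2}/rhs => E.
apply/eqP; rewrite -subr_eq0 -sumrB; apply/eqP.
rewrite -[RHS](subrr (\sum_j wt j * inc j i * (pot f (e0 G j) - pot f (e1 G j)))) {1}E -sumrB.
apply: eq_bigr => j _; rewrite /flux prim0 prim1 subr0 /kap /inc /wt.
by field; rewrite gt_eqF// gam_gt0.
Qed.

(** ** Green's formula *)

(** [w] is in the domain of the network operator, with flux [q], image [r] and
    vertex values [d]. Here [ci] is the inverse of the weight [c]: writing [w' = ci q] for
    [q = c w'] keeps the derivative of [c] out of the equation. *)
Definition netdom (w q r : 'I_m -> R -> R) (d : 'I_n -> R) :=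
  [/\ forall j, abscont (w j) (fun x => ci j x * q j x),
      forall j, abscont (q j) (r j),
      forall j, w j 0 = d (e0 G j),
      forall j, w j 1 = d (e1 G j) &
      forall i, \sum_j mu j * q j 0 * (e0 G j == i)%:R =
                \sum_j mu j * q j 1 * (e1 G j == i)%:R].

(** Integration by parts on each edge. The boundary terms gather at the vertices, where
    the continuity of [w'] and Kirchhoff's condition for [q] cancel them. *)
Lemma green w q r d w' q' r' d' : netdom w q r d -> netdom w' q' r' d' ->
  \sum_j mu j * int01 (fun x => r j x * w' j x) =
  - \sum_j mu j * int01 (fun x => ci j x * (q j x * q' j x)).
Proof.
move=> [Hw Hq w0 w1 Kq] [Hw' Hq' w0' w1' _].
have Lci j : L2 (fun x => ci j x * q' j x) by exact: AC_L2 (Hw' j).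
have cw j := AC_cont (Hw' j); have cq j := AC_cont (Hq j).
have parts j : int01 (fun x => r j x * w' j x) =
    (q j 1 * d' (e1 G j) - q j 0 * d' (e0 G j)) - int01 (fun x => ci j x * (q j x * q' j x)).
  have [L E] := ACM (Hq j) (Hw' j); have := E 1; rewrite ler01 lexx => /(_ isT).
  have L1 : int1 (fun x => r j x * w' j x) by apply: L2M; [exact: AC_L2 (Hq j)|exact: cont01_L2].
  have L2' : int1 (fun x => q j x * (ci j x * q' j x)) by apply: L2M => //; exact: cont01_L2.
  rewrite prim1 int01D// w0' w1'.
  rewrite (@int01_in _ (fun x => ci j x * (q j x * q' j x)) (fun x => q j x * (ci j x * q' j x))).
    by move=> ->; ring.
  by move=> x _; ring.
under eq_bigr do rewrite parts mulrBr; rewrite sumrB [X in X - _](_ : _ = 0) ?sub0r//.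
under eq_bigr do rewrite mulrBr !mulrA; rewrite sumrB.
have S1 : \sum_j mu j * q j 1 * d' (e1 G j) = \sum_i d' i * (\sum_j mu j * q j 1 * (e1 G j == i)%:R).
  under [RHS]eq_bigr do rewrite mulr_sumr.
  rewrite [RHS]exchange_big/=; apply: eq_bigr => j _; rewrite -(sum_e1 d') mulr_sumr.
  by apply: eq_bigr => i _; ring.
have S0 : \sum_j mu j * q j 0 * d' (e0 G j) = \sum_i d' i * (\sum_j mu j * q j 0 * (e0 G j == i)%:R).
  under [RHS]eq_bigr do rewrite mulr_sumr.
  rewrite [RHS]exchange_big/=; apply: eq_bigr => j _; rewrite -(sum_e0 d') mulr_sumr.
  by apply: eq_bigr => i _; ring.
by rewrite S1 S0; under eq_bigr do rewrite -Kq; rewrite subrr.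
Qed.

Lemma netdom_cst a : netdom (fun _ _ => a) (fun _ _ => 0) (fun _ _ => 0) (fun=> a).
Proof.
split=> // [j|j|i]; first by apply: abscont_ext (AC_cst a) => // x; rewrite mulr0.
  exact: AC_cst.
by apply: eq_bigr => j _; rewrite !mulr0 !mul0r.
Qed.

Lemma netdomB w q r d w' q' r' d' : netdom w q r d -> netdom w' q' r' d' ->
  netdom (fun j x => w j x - w' j x) (fun j x => q j x - q' j x) (fun j x => r j x - r' j x)
    (fun i => d i - d' i).
Proof.
move=> [Hw Hq w0 w1 Kq] [Hw' Hq' w0' w1' Kq']; split=> [j|j|j|j|i].
- by apply: abscont_ext (ACB (Hw j) (Hw' j)) => // x; rewrite mulrBr.
- exact: ACB.
- by rewrite w0 w0'.
- by rewrite w1 w1'.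
under eq_bigr do rewrite mulrBr mulrBl.
under [RHS]eq_bigr do rewrite mulrBr mulrBl.
by rewrite !sumrB Kq Kq'.
Qed.

(** Green's formula against a constant: the range of the operator is orthogonal to its kernel. *)
Lemma netdom_mean w q r d : netdom w q r d -> \sum_j mu j * int01 (r j) = 0.
Proof.
move=> Hw; have := green Hw (netdom_cst 1).
rewrite [X in - X](_ : _ = 0); last first.
  by apply: big1 => j _; under eq_fun do rewrite !mulr0; rewrite int01_cst mulr0.
rewrite oppr0 => E; rewrite -[RHS]E; apply: eq_bigr => j _; congr (_ * _).
by apply: int01_in => x _; rewrite mulr1.
Qed.

Lemma res_netdom f :
  netdom (res f) (flux f) (fun j x => - ctr f j x) (fun i => pot f i - mean (sol f)).
Proof.
have Hs : netdom (sol f) (flux f) (fun j x => - ctr f j x) (pot f).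
  by split; [exact: sol_AC|exact: flux_AC|exact: sol0|exact: sol1|exact: kirchhoff].
have [H1 H2 H3 H4 H5] := netdomB Hs (netdom_cst (mean (sol f))); split.
- by move=> j; apply: abscont_ext (H1 j) => x //; rewrite subr0.
- by move=> j; apply: abscont_ext (H2 j) => x; rewrite subr0.
- exact: H3.
- exact: H4.
- by move=> i; under eq_bigr do rewrite -[flux f _ 0]subr0; rewrite H5; under eq_bigr do rewrite subr0.
Qed.

Lemma sol_L2 f j : L2 (sol f j). Proof. by apply: cont01_L2; exact: AC_cont (sol_AC f j). Qed.

Lemma res_L2 f j : L2 (res f j).
Proof. by apply: L2B; [exact: sol_L2|exact: L2_cst]. Qed.

Lemma mean_res f : mean (res f) = 0.
Proof. by rewrite meanB ?mean_cst ?subrr// => j; [exact: sol_L2|exact: L2_cst]. Qed.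

(** ** Linearity and boundedness *)

Local Notation blin := (blin mu_gt0).

Lemma blin_mean : blin (fun (_ : unit) f => mean (fn f)).
Proof.
have := blin_sum (fun j : 'I_m => blinM (bounded_fin (fun _ : unit => mu j / tot))
   (blin_comp (fun=> j) (blin_int01 mu_gt0))).
apply: blin_ext => t f; rewrite /mean mulr_suml; apply: eq_bigr => j _ /=.
by rewrite mulrAC.
Qed.

Lemma blin_pctr : blin (fun (p : 'I_m * R) f => prim (ctr f p.1) p.2).
Proof.
have B1 : bounded (fun p : 'I_m * R => prim (fun=> 1 : R) p.2).
  exists 1 => p; apply: le_trans (prim_norm _ (int1_cst 1)) _.
  by under eq_fun do rewrite normr1; rewrite int01_cst.
have := blinB (blin_prim mu_gt0) (blinM B1 (blin_comp (fun=> tt) blin_mean)).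
apply: blin_ext => -[j x] f /=; rewrite /ctr primB; [|by apply: L2_int1; exact: fn_L2|exact: int1_cst].
congr (_ - _); rewrite mulrC -primZ; last exact: int1_cst.
by congr prim; apply/funext => y; rewrite mulr1.
Qed.

Lemma blin_ictr : blin (fun j f => int01 (ctr f j)).
Proof. by apply: blin_ext (blin_comp (fun j => (j, 1)) blin_pctr) => j f /=; rewrite prim1. Qed.

Lemma ci_int1 j : int1 (ci j). Proof. by apply: L2_int1; apply: cont01_L2. Qed.

Lemma pctr_meas f j : meas01 (prim (ctr f j)).
Proof. by apply: cont01_meas; apply: prim_cont; exact: ctr_L2. Qed.

Lemma blin_bet : blin (fun j f => bet f j).
Proof.
apply: (blin_int (k := ci) (phi := fun j y f => prim (ctr f j) y)).
- exact: ci_int1.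
- exact: bounded_fin.
- exact: blin_pctr.
- by move=> j f; exact: pctr_meas.
Qed.

Lemma blin_rhs : blin (fun i f => rhs f i).
Proof.
have := blin_sum (fun j : 'I_m => blinD
  (blinM (bounded_fin (fun i => wt j * inc j i)) (blin_comp (fun=> j) blin_bet))
  (blinM (bounded_fin (fun i => mu j * (e1 G j == i)%:R)) (blin_comp (fun=> j) blin_ictr))).
by apply: blin_ext => i f; apply: eq_bigr => j _ /=; ring.
Qed.

Lemma blin_pot : blin (fun i f => pot f i).
Proof.
have := blin_sum (fun k : 'I_n =>
  blinM (bounded_fin (fun i => invmx Lap i k)) (blin_comp (fun=> k) blin_rhs)).
apply: blin_ext => i f; rewrite /pot /lap_sol mxE; apply: eq_bigr => k _ /=.
by rewrite mxE.
Qed.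

Lemma blin_kap : blin (fun j f => kap f j).
Proof.
have := blinM (bounded_fin (fun j => (gam j)^-1)) (blinD (blinB
  (blin_comp (e1 G) blin_pot) (blin_comp (e0 G) blin_pot)) blin_bet).
by apply: blin_ext => j f; rewrite /kap mulrC.
Qed.

Lemma blin_flux : blin (fun (p : 'I_m * R) f => flux f p.1 p.2).
Proof. exact: blinB (blin_comp fst blin_kap) blin_pctr. Qed.

Lemma flux_meas f j : meas01 (flux f j).
Proof. by apply: cont01_meas; exact: AC_cont (flux_AC f j). Qed.

Lemma blin_sol : blin (fun (p : 'I_m * R) f => sol f p.1 p.2).
Proof.
have ki (p : 'I_m * R) := int1_lt p.2 (ci_int1 p.1).
have Bk : bounded (fun p : 'I_m * R => int01 (fun y => `|ci p.1 y * (y < p.2)%R%:R|)).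
  have [M HM] := bounded_fin (fun j => int01 (fun y => `|ci j y|)).
  exists M => -[j x] /=; apply: le_trans (HM j).
  rewrite !ger0_norm; [|by apply: int01_ge0|by apply: int01_ge0].
  apply: int01_le; [by apply: int1_norm; exact: ki (j, x)|by apply: int1_norm; exact: ci_int1|].
  by move=> y _; rewrite normrM ler_piMr// normr_bool.
have BI := blin_int ki Bk (blin_comp (fun p : ('I_m * R) * R => (p.1.1, p.2)) blin_flux)
  (fun p f => flux_meas f p.1).
have := blinD (blin_comp (fun p : 'I_m * R => e0 G p.1) blin_pot) BI.
apply: blin_ext => -[j x] f /=; rewrite /sol; congr (_ + int01 _); apply/funext => y.
by rewrite mulrAC.
Qed.

Lemma blin_msol : blin (fun (_ : unit) f => mean (sol f)).
Proof.
have k1 (j : 'I_m) : int1 ((fun _ : 'I_m => fun _ : R => 1 : R) j) by exact: int1_cst.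
have BI := blin_int k1 (bounded_fin _) blin_sol (fun j f => L2_meas (sol_L2 f j)).
have := blin_sum (fun j : 'I_m => blinM (bounded_fin (fun _ : unit => mu j / tot))
   (blin_comp (fun=> j) BI)).
apply: blin_ext => t f; rewrite /mean mulr_suml; apply: eq_bigr => j _ /=.
by under eq_fun do rewrite mul1r; rewrite mulrAC.
Qed.

Lemma blin_res : blin (fun (p : 'I_m * R) f => res f p.1 p.2).
Proof. exact: blinB blin_sol (blin_comp (fun=> tt) blin_msol). Qed.

End Network.

(** * Symmetry and kernel of the resolvent *)
Section NetworkOperators.
Variables (R : realType) (n m : nat) (G : graph n m).
Variables (mu : 'I_m -> R) (ci : 'I_m -> R -> R).
Hypothesis mu_gt0 : forall j, 0 < mu j.
Hypothesis ci_cont : forall j, {within `[0, 1], continuous (ci j)}.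
Hypothesis ci_gt0 : forall j (x : R), 0 <= x <= 1 -> 0 < ci j x.
Hypothesis G_conn : connected_graph G.
Hypothesis m_gt0 : (0 < m)%N.
Local Notation X2r := (X2r R m).
Local Notation H := (X2hilbert mu_gt0).
Local Notation nrm := (hnrm H).
Local Notation null := (hnull H).
Local Notation "<< x , y >>" := (ip H x y) (at level 0, format "<< x ,  y >>").
Local Notation res := (res G mu ci).
Local Notation mean := (mean mu).
Local Notation netdom := (netdom G mu ci).
Implicit Types (f g h : X2r) (a : R).

Definition resX f : X2r := mkX2 (res_L2 G mu ci_cont f).
Definition meanX f : X2r := mkX2 (fun _ : 'I_m => L2_cst (mean (fn f))).

Lemma null_ae f : null f <-> forall j, ae01 (fn f j) (fun=> 0).
Proof.
split=> [f0 j|f0].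
  have E : int01 (fun x => fn f j x ^+ 2) = 0.
    apply/eqP; rewrite eq_le int01_ge0 ?andbT => [|x _]; last exact: sqr_ge0.
    have := X2ip_edge mu_gt0 f j; rewrite -[X2ip _ _ _]/(<<f, f>>) -nrm_sqr f0 expr0n/=.
    by rewrite pmulr_rle0.
  have := int01_eq0 (L2_sqr (fn_L2 f j)) (fun x _ => sqr_ge0 _) E.
  by apply: filterS => x Hx /Hx/eqP; rewrite sqrf_eq0 => /eqP.
rewrite /hnull /hnrm -[<<f, f>>]/(X2ip _ _ _) /X2ip big1 ?sqrtr0// => j _.
rewrite (int01_ae (g := fun=> 0)) ?int01_cst ?mulr0//.
- by apply: meas01M; apply: L2_meas; exact: fn_L2.
- exact: meas01_cst.
- by apply: ae01_trans (ae01_map (fun y => y * y) (f0 j)) _; apply: ae01_in => x _; rewrite mul0r.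
Qed.

Lemma X2r_ext f g : (forall j x, fn f j x = fn g j x) -> f = g.
Proof. by move=> fg; apply: val_inj; apply/funext => j; apply/funext => x; exact: fg. Qed.

Lemma meanX_lin a f g : meanX (a *: f + g) = a *: meanX f + meanX g.
Proof. by apply: X2r_ext => j x; have [L _] := blin_mean mu_gt0; exact: (L tt a f g). Qed.

Lemma resX_lin a f g : resX (a *: f + g) = a *: resX f + resX g.
Proof.
apply: X2r_ext => j x; have [L _] := blin_res G mu_gt0 ci_cont.
exact: (L (j, x) a f g).
Qed.

Lemma meanXD f g : meanX (f + g) = meanX f + meanX g.
Proof. by rewrite -[f in LHS]scale1r meanX_lin scale1r. Qed.

Lemma resXD f g : resX (f + g) = resX f + resX g.
Proof. by rewrite -[f in LHS]scale1r resX_lin scale1r. Qed.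

Lemma meanXZ a f : meanX (a *: f) = a *: meanX f.
Proof.
have z : meanX 0 = 0 by apply: (addrI (meanX 0)); rewrite -meanXD !addr0.
by rewrite -[a *: f]addr0 meanX_lin z addr0.
Qed.

Lemma resXZ a f : resX (a *: f) = a *: resX f.
Proof.
have z : resX 0 = 0 by apply: (addrI (resX 0)); rewrite -resXD !addr0.
by rewrite -[a *: f]addr0 resX_lin z addr0.
Qed.

Lemma ip_cst f a (La : forall j : 'I_m, L2 (fun=> a)) :
  <<f, mkX2 La>> = a * (mean (fn f) * tot mu).
Proof.
rewrite /mean divfK ?gt_eqF ?tot_gt0// mulr_sumr; apply: eq_bigr => j _.
rewrite [RHS]mulrCA; congr (_ * _); rewrite -int01Z; last by apply: L2_int1; exact: fn_L2.
by apply: int01_in => x _; exact: mulrC.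
Qed.

Lemma meanX_sym f g : <<meanX f, g>> = <<f, meanX g>>.
Proof. by rewrite ip_cst ipC ip_cst; ring. Qed.

Lemma meanX_id f : meanX (meanX f) = meanX f.
Proof. by apply: X2r_ext => j x /=; exact: (mean_cst mu_gt0 m_gt0). Qed.

Lemma meanX_res f : meanX (resX f) = 0.
Proof. by apply: X2r_ext => j x; exact: (mean_res G mu_gt0 ci_cont m_gt0 f). Qed.

Lemma dissC (u v : 'I_m -> R -> R) :
  \sum_j mu j * int01 (fun x => ci j x * (u j x * v j x)) =
  \sum_j mu j * int01 (fun x => ci j x * (v j x * u j x)).
Proof.
apply: eq_bigr => j _; congr (_ * _); apply: int01_in => x _.
by rewrite [u j x * _]mulrC.
Qed.

(** The dissipation form, manifestly symmetric and nonnegative. *)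
Lemma green_res f g : <<f, resX g>> = \sum_j mu j * int01 (fun x => ci j x *
  (flux G mu ci f j x * flux G mu ci g j x)).
Proof.
have -> : <<f, resX g>> = <<f - meanX f, resX g>>.
  by rewrite ipBl meanX_sym meanX_res [<<f, 0>>]ipC ip0l subr0.
have Df := res_netdom mu_gt0 ci_cont ci_gt0 G_conn m_gt0 f.
have Dg := res_netdom mu_gt0 ci_cont ci_gt0 G_conn m_gt0 g.
have := green Df Dg => /(congr1 -%R); rewrite opprK => <-.
rewrite -sumrN; apply: eq_bigr => j _; rewrite -mulrN -int01N; last first.
  by apply: L2M; [apply: L2N; exact: (ctr_L2 mu)|exact: (res_L2 G mu ci_cont)].
by congr (_ * _); apply: int01_in => x _; rewrite mulNr opprK.
Qed.

Lemma resX_sym f g : <<resX f, g>> = <<f, resX g>>.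
Proof.
apply: etrans (ipC _ _ _) _; apply: etrans (green_res g f) _.
apply: etrans (dissC _ _) _; exact: esym (green_res f g).
Qed.

Lemma resX_ge0 f : 0 <= <<resX f, f>>.
Proof.
rewrite ipC (green_res f f); apply: sumr_ge0 => j _; rewrite mulr_ge0 ?(ltW (mu_gt0 j))//.
apply: int01_ge0 => x /andP[/ltW x0 /ltW x1]; rewrite mulr_ge0 -?expr2 ?sqr_ge0//.
by rewrite ltW// ci_gt0// x0.
Qed.

(** By Green's formula both [w] and [- K r] pair with [z - mean z] as the same dissipation
    integral, for every [z]. *)
Lemma netdom_resX w q r d (Lw : forall j, L2 (w j)) (Lr : forall j, L2 (r j)) :
  netdom w q r d -> null (mkX2 Lw - meanX (mkX2 Lw) + resX (mkX2 Lr)).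
Proof.
move=> Hw; apply: ip_null => z; rewrite !ipDl ipNl meanX_sym -ipBr resX_sym.
have -> : <<mkX2 Lw, z - meanX z>> = - <<mkX2 Lr, resX z>>.
  have Dz := res_netdom mu_gt0 ci_cont ci_gt0 G_conn m_gt0 z.
  have E1 := green Hw Dz; have E2 := green Dz Hw.
  rewrite -[<<mkX2 Lr, _>>]/(X2ip _ _ _) [X2ip _ _ _]E1 opprK.
  have := congr1 -%R E2; rewrite opprK => E3; rewrite [RHS](_ : _ = \sum_j mu j * int01 (fun x => ci j x * (flux G mu ci z j x * q j x))).
    rewrite -E3 -sumrN; apply: eq_bigr => j _; rewrite -mulrN -int01N; last first.
      by apply: L2M => //; apply: L2N; exact: (ctr_L2 mu).
    by congr (_ * _); apply: int01_in => x _; rewrite mulNr opprK mulrC.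
  by rewrite dissC.
by rewrite addNr.
Qed.

(** If the resolvent of [f] vanishes then so does its derivative, the flux, and the
    derivative of the flux, which is [f - mean f] up to sign. *)
Lemma resX_ker f : null (resX f) -> null (f - meanX f).
Proof.
move=> /null_ae w0; apply/null_ae => j.
have [Hw Hq _ _ _] := res_netdom mu_gt0 ci_cont ci_gt0 G_conn m_gt0 f.
have W0 := cont01_ae0 (AC_cont (Hw j)) (w0 j).
have A0 : abscont (res f j) (fun=> 0) by apply: AC_eq (AC_cst 0) => x /W0.
have q0 : ae01 (flux G mu ci f j) (fun=> 0).
  have := abscont_deriv_unique (Hw j) A0; apply: filterS => x Hx x01.
  have := Hx x01 => /eqP; rewrite mulf_eq0 gt_eqF => [/eqP//|].
  move: x01; rewrite in_itv/= => /andP[/ltW x0 /ltW x1]; by rewrite ci_gt0// x0.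
have Q0 := cont01_ae0 (AC_cont (Hq j)) q0.
have B0 : abscont (flux G mu ci f j) (fun=> 0) by apply: AC_eq (AC_cst 0) => x /Q0.
have := abscont_deriv_unique (Hq j) B0; apply: filterS => x Hx /Hx /eqP.
by rewrite oppr_eq0 => /eqP.
Qed.

Lemma resX_bnd : exists2 M : R, 0 < M & forall f, nrm (resX f) <= M * nrm f.
Proof.
have [_ [C C0 HC]] := blin_res G mu_gt0 ci_cont.
have t0 := tot_gt0 mu_gt0 m_gt0.
exists (C * Num.sqrt (tot mu) + 1) => [|f]; first by rewrite ltr_wpDl// mulr_ge0.
apply: (@le_trans _ _ (C * Num.sqrt (tot mu) * nrm f)); last by rewrite ler_wpM2r// lerDl.
rewrite nrm_le ?mulr_ge0// -[<<_, _>>]/(X2ip _ _ _).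
rewrite !exprMn sqr_sqrtr ?(ltW t0)// mulrAC -exprMn mulr_sumr.
apply: ler_sum => j _; rewrite mulrC ler_wpM2r ?(ltW (mu_gt0 j))//.
rewrite -[leRHS](int01_cst ((C * nrm f) ^+ 2)); apply: int01_le.
- by apply: L2M; exact: (res_L2 G mu ci_cont).
- exact: int1_cst.
move=> x _; rewrite -expr2 -(real_normK (num_real (fn _ _ _))).
by rewrite ler_pXn2r ?nnegrE ?mulr_ge0//; exact: HC (j, x) f.
Qed.

End NetworkOperators.

(** * The wave equation for real families *)
Section RealWave.
Variables (R : realType) (n m : nat) (G : graph n m).
Variables (mu : 'I_m -> R) (ci : 'I_m -> R -> R).
Hypothesis mu_gt0 : forall j, 0 < mu j.
Hypothesis ci_cont : forall j, {within `[0, 1], continuous (ci j)}.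
Hypothesis ci_gt0 : forall j (x : R), 0 <= x <= 1 -> 0 < ci j x.
Hypothesis G_conn : connected_graph G.
Hypothesis m_gt0 : (0 < m)%N.
Local Notation X2r := (X2r R m).
Local Notation H := (X2hilbert mu_gt0).
Local Notation nrm := (hnrm H).
Local Notation null := (hnull H).
Local Notation K := (resX G mu ci_cont).
Local Notation P := (@meanX R m mu).
Implicit Types (f g h : X2r) (a t : R) (u v : R -> X2r).

(** [w] stands for the image of [u t - f - t *: g] under the inverse of the network
    operator, up to a constant. *)
Definition net_mild f g u := hcont H u /\ forall t, exists w,
  [/\ is_integral H (fun s => (t - s) *: u s) 0 t w,
      null (P (u t - f - t *: g)) & null (w - P w + K (u t - f - t *: g))].

Local Notation PD := (meanXD mu_gt0).
Local Notation PZ := (meanXZ mu_gt0).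
Local Notation P_sym := (meanX_sym mu_gt0 m_gt0).
Local Notation P_id := (meanX_id mu_gt0 m_gt0).

(** The resolvent divided by a bound of its norm is a contraction; the bound becomes
    the square of a speed in the abstract theory. *)
Lemma contraction_ex : exists (M om : R) (C : X2r -> X2r),
  [/\ [/\ 0 < M, 0 < om & forall f, C f = M^-1 *: K f], om ^- 2 = M,
      pos_contraction H C,
      forall x, P (C x) = 0 &
      forall x, null (C x) -> null (x - P x)].
Proof.
have [M M0 HM] := resX_bnd G mu_gt0 ci_cont m_gt0.
have Mi : 0 < M^-1 by rewrite invr_gt0.
exists M, (Num.sqrt M)^-1, (fun f => M^-1 *: K f); split.
- by split=> //; rewrite invr_gt0 sqrtr_gt0.
- by rewrite exprVn invrK sqr_sqrtr// ltW.
- split=> [x y|a x|x y|x|x].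
  + by rewrite (resXD _ mu_gt0) scalerDr.
  + by rewrite (resXZ _ mu_gt0) !scalerA mulrC.
  + by rewrite ipZl ipZr (resX_sym mu_gt0 ci_cont ci_gt0 G_conn m_gt0).
  + by rewrite ipZl mulr_ge0 ?(ltW Mi)// (resX_ge0 mu_gt0 ci_cont ci_gt0 G_conn m_gt0).
  + rewrite ipZl mulrC ler_pdivrMr// mulrC -nrm_sqr expr2.
    apply: le_trans (ler_norm _) _; apply: le_trans (ip_nrm _ _ _) _.
    by rewrite mulrA ler_wpM2r.
- by move=> x; rewrite PZ (meanX_res G mu_gt0 ci_cont m_gt0) scaler0.
move=> x x0; apply: (resX_ker ci_gt0 G_conn m_gt0).
by move: x0; rewrite /hnull nrmZ => /eqP; rewrite mulf_eq0 normr_eq0 gt_eqF//= => /eqP.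
Qed.

Lemma net_mildE M om (C : X2r -> X2r) : [/\ 0 < M, 0 < om & forall f, C f = M^-1 *: K f] ->
  om ^- 2 = M -> forall f g u, net_mild f g u <-> mild H C P om f g u.
Proof.
move=> [M0 _ CE] omM f g u; have E x : om ^- 2 *: C x = K x.
  by rewrite omM CE scalerA mulfV ?scale1r// gt_eqF.
by split=> -[cu Hu]; split=> // t; have [w [H1 H2 H3]] := Hu t; exists w; split=> //;
  move: H3; rewrite E.
Qed.

Lemma net_mild_ex f g : exists2 u, net_mild f g u &
  forall t, nrm (u t) <= 3 * nrm f + 3 * `|t| * nrm g.
Proof.
have [M [om [C [[M0 om0 CE] omM HC PC kerC]]]] := contraction_ex.
exists (wave H C P om f g); last first.
  by move=> t; exact: (wave_le HC om0 PD PZ P_sym P_id kerC).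
apply/(net_mildE (And3 M0 om0 CE) omM).
exact: (wave_mild HC om0 PD PZ P_sym P_id PC kerC).
Qed.

Lemma net_mild_unique f g u v : net_mild f g u -> net_mild f g v ->
  forall t, null (u t - v t).
Proof.
have [M [om [C [[M0 om0 CE] omM HC PC kerC]]]] := contraction_ex.
move=> /(net_mildE (And3 M0 om0 CE) omM) Hu /(net_mildE (And3 M0 om0 CE) omM) Hv.
exact: (mild_unique HC om0 PD PZ P_sym P_id Hu Hv).
Qed.

(** The difference of two solutions is the solution for the difference of the data. *)
Lemma net_mild_le f g u f' g' u' t : net_mild f g u -> net_mild f' g' u' ->
  nrm (u t - u' t) <= 3 * nrm (f - f') + 3 * `|t| * nrm (g - g').
Proof.
have [M [om [C [[M0 om0 CE] omM HC PC kerC]]]] := contraction_ex.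
move=> /(net_mildE (And3 M0 om0 CE) omM) Hu /(net_mildE (And3 M0 om0 CE) omM) Hv.
have /(net_mildE (And3 M0 om0 CE) omM) HD := mildB HC PD PZ P_sym P_id Hu Hv.
have [w Hw Lw] := net_mild_ex (f - f') (g - g').
have N := net_mild_unique HD Hw t.
apply: le_trans (Lw t); rewrite -[u t - u' t](subrK (w t)).
by apply: le_trans (ler_nrmD _ _ _) _; rewrite N add0r.
Qed.

Lemma net_mild_range k f g fk gk u t : net_mild f g u -> P fk = 0 -> P gk = 0 ->
  null (f - P f - iter k K fk) -> null (g - P g - iter k K gk) ->
  exists x y : X2r, null (u t - (P x + iter k K y)).
Proof.
have [M [om [C [[M0 om0 CE] omM HC PC kerC]]]] := contraction_ex.
move=> Hu Pf Pg Hf Hg.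
have KE x : K x = M *: C x by rewrite CE scalerA mulfV ?scale1r// gt_eqF.
have itK l x : iter l K x = iter l C (M ^+ l *: x).
  elim: l x => [|l IH] x; first by rewrite expr0 scale1r.
  by rewrite iterSr IH iterSr KE scalerA -exprSr (opZ HC).
have cl x : P x = 0 -> clo H C (M ^+ k *: x).
  move=> Px; have := clo_subP HC PD PZ P_sym P_id kerC (M ^+ k *: x).
  by rewrite PZ Px scaler0 subr0.
have Hw : net_mild f g (wave H C P om f g).
  by apply/(net_mildE (And3 M0 om0 CE) omM); exact: (wave_mild HC om0 PD PZ P_sym P_id PC kerC).
rewrite itK in Hf; rewrite itK in Hg.
have W := wave_range HC om0 PD PZ P_sym P_id kerC t (cl _ Pf) (cl _ Pg) Hf Hg.
exists (f + t *: g).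
exists (M ^- k *: (Cos H C om t (M ^+ k *: fk) + Sin H C om (M ^+ k *: gk) t)).
have := nullD (net_mild_unique Hu Hw t) W; rewrite addrA subrK; congr (null (_ - (_ + _))).
by rewrite itK scalerA mulfV ?scale1r// expf_neq0// gt_eqF.
Qed.

End RealWave.

(** * Real and imaginary parts *)
Section Parts.
Variables (R : realType) (m : nat).
Implicit Types (z w : R[i]) (f g : edge_fun R m) (b : bool).
Local Open Scope complex_scope.

Definition part b z : R := if b then complex.Im z else complex.Re z.

Lemma partD b z w : part b (z + w) = part b z + part b w.
Proof. by case: b; case: z w => [? ?] [? ?]. Qed.

Lemma partN b z : part b (- z) = - part b z.
Proof. by case: b; case: z => [? ?]. Qed.

Lemma partB b z w : part b (z - w) = part b z - part b w.
Proof. by rewrite partD partN. Qed.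

Lemma partZ b (a : R) z : part b (a%:C * z) = a * part b z.
Proof. by case: b; case: z => [x y]; rewrite /part; simpc => /=; ring. Qed.

Lemma part_sum b (I : Type) (s : seq I) (F : I -> R[i]) :
  part b (\sum_(i <- s) F i) = \sum_(i <- s) part b (F i).
Proof.
elim: s => [|i s IH]; last by rewrite !big_cons partD IH.
by rewrite !big_nil; case: b.
Qed.

Lemma part_eq z w : (forall b, part b z = part b w) -> z = w.
Proof.
by case: z w => [x y] [x' y'] E; have /= -> := E false; have /= -> := E true.
Qed.

Definition pf b f : 'I_m -> R -> R := fun j x => part b (f j x).

Lemma X2P f : X2 f <-> forall b j, L2 (pf b f j).
Proof.
split=> [Hf [] j|Hf j]; [by have [_ ?] := Hf j|by have [? _] := Hf j|].
by split; [exact: Hf false j|exact: Hf true j].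
Qed.

(** A total function, so that curves of families can be turned into curves of the Hilbert
    space without carrying proofs of square-integrability. *)
Definition toX (w : 'I_m -> R -> R) : X2r R m :=
  if pselect (forall j, L2 (w j)) is left L then mkX2 L else 0.

Lemma toXE (w : 'I_m -> R -> R) : (forall j, L2 (w j)) -> fn (toX w) = w.
Proof. by rewrite /toX; case: pselect. Qed.

Lemma toX_mk (w : 'I_m -> R -> R) (L : forall j, L2 (w j)) : mkX2 L = toX w.
Proof. by apply: X2r_ext => j x; rewrite toXE. Qed.

Lemma fn_sum (I : Type) (s : seq I) (F : I -> X2r R m) j x :
  fn (\sum_(i <- s) F i) j x = \sum_(i <- s) fn (F i) j x.
Proof.
elim: s => [|i s IH]; first by rewrite !big_nil.
by rewrite !big_cons -IH.
Qed.

Lemma X2_sub_X2 f g : X2 f -> X2 g -> X2 (X2_sub f g).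
Proof.
move=> /X2P Hf /X2P Hg; apply/X2P => b j.
by apply: L2_in (L2B (Hf b j) (Hg b j)) => x _; rewrite -partB.
Qed.

Lemma toX_sub b f g : X2 f -> X2 g -> toX (pf b (X2_sub f g)) = toX (pf b f) - toX (pf b g).
Proof.
move=> Hf Hg; have /X2P Hs := X2_sub_X2 Hf Hg; move/X2P: Hf => Hf; move/X2P: Hg => Hg.
apply: X2r_ext => j x; rewrite toXE//; rewrite -[RHS]/(fn (toX (pf b f)) j x - fn (toX (pf b g)) j x).
by rewrite !toXE// /pf partB.
Qed.

Section Norms.
Variable mu : 'I_m -> R.
Hypothesis mu_gt0 : forall j, 0 < mu j.
Local Notation nrm := (hnrm (X2hilbert mu_gt0)).

Lemma X2_normE f : X2 f ->
  X2_norm mu f ^+ 2 = nrm (toX (pf false f)) ^+ 2 + nrm (toX (pf true f)) ^+ 2.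
Proof.
move=> /X2P Hf; have E : complex.Re (X2_dot mu f f) =
    nrm (toX (pf false f)) ^+ 2 + nrm (toX (pf true f)) ^+ 2.
  rewrite !nrm_sqr -![ip _ _ _]/(X2ip _ _ _) /X2ip -big_split/=.
  rewrite -[LHS]/(part false _) /X2_dot part_sum; apply: eq_bigr => j _.
  rewrite !toXE//= -mulrDr -int01D; [|exact: L2M (Hf false j) (Hf false j)|exact: L2M (Hf true j) (Hf true j)].
  rewrite -int01Z; last first.
    by apply: int1D; [exact: L2M (Hf false j) (Hf false j)|exact: L2M (Hf true j) (Hf true j)].
  by apply: int01_in => x _; rewrite /pf /part; case: (f j x) => p q; simpc => /=; ring.
by rewrite sqr_sqrtr// E addr_ge0// sqr_ge0.
Qed.

Lemma nrm_le_X2 b f : X2 f -> nrm (toX (pf b f)) <= X2_norm mu f.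
Proof.
move=> /X2_normE E; rewrite -(@ler_pXn2r _ 2) ?nnegrE ?sqrtr_ge0// E.
by case: b; [rewrite lerDr|rewrite lerDl]; exact: sqr_ge0.
Qed.

Lemma X2_le_nrm f : X2 f -> X2_norm mu f <= nrm (toX (pf false f)) + nrm (toX (pf true f)).
Proof.
move=> /X2_normE E; rewrite -(@ler_pXn2r _ 2) ?nnegrE ?sqrtr_ge0 ?addr_ge0// E sqrrD.
by rewrite lerD2r lerDl mulrn_wge0// mulr_ge0.
Qed.

Lemma X2_hcont b u : X2_continuous mu u -> hcont (X2hilbert mu_gt0) (fun t => toX (pf b (u t))).
Proof.
move=> [Hu cu] t e e0; have := cu t; move/cvgrPdist_le => /(_ e e0)[d /= d0 Hd].
exists d => // s st; rewrite -toX_sub//; apply: le_trans (nrm_le_X2 _ (X2_sub_X2 (Hu s) (Hu t))) _.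
by have := Hd s; rewrite /= distrC st sub0r normrN ger0_norm ?sqrtr_ge0//; exact.
Qed.

Lemma hcont_X2 u : (forall t, X2 (u t)) ->
  (forall b, hcont (X2hilbert mu_gt0) (fun t => toX (pf b (u t)))) -> X2_continuous mu u.
Proof.
move=> Hu cu; split=> // t; apply/cvgrPdist_le => e e0; have e2 : 0 < e / 2 by rewrite divr_gt0.
have [d1 d10 H1] := cu false t _ e2; have [d2 d20 H2] := cu true t _ e2.
exists (Num.min d1 d2) => /=; first by rewrite lt_min d10.
move=> s /=; rewrite lt_min distrC => /andP[s1 s2].
rewrite sub0r normrN ger0_norm ?sqrtr_ge0//.
apply: le_trans (X2_le_nrm (X2_sub_X2 (Hu s) (Hu t))) _; rewrite !toX_sub// (splitr e).
by apply: lerD; [exact: H1|exact: H2].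
Qed.

Definition rsum (v : R -> edge_fun R m) (a b : R) (s : seq R) (xi : nat -> R) : edge_fun R m :=
  fun j x => \sum_(k < size s) (nth b s k - nth b (a :: s) k)%:C * v (xi k) j x.

Lemma pf_rsum beta v lo hi s xi j x : pf beta (rsum v lo hi s xi) j x =
  \sum_(k < size s) (nth hi s k - nth hi (lo :: s) k) * pf beta (v (xi k)) j x.
Proof. by rewrite /pf /rsum part_sum; apply: eq_bigr => k _; rewrite partZ. Qed.

Lemma rsum_X2 v lo hi s xi : (forall t, X2 (v t)) -> X2 (rsum v lo hi s xi).
Proof.
move=> Hv; apply/X2P => beta j; have Hv' t := (X2P (v t)).1 (Hv t).
apply: L2_in (L2_sum (index_enum 'I_(size s)) xpredT (fun k : 'I_(size s) =>
  L2Z (nth hi s k - nth hi (lo :: s) k) (Hv' (xi k) beta j))) => x _.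
by rewrite pf_rsum.
Qed.

Lemma toX_rsum beta v lo hi s xi : (forall t, X2 (v t)) -> toX (pf beta (rsum v lo hi s xi)) =
  \sum_(k < size s) (nth hi s k - nth hi (lo :: s) k) *: toX (pf beta (v (xi k))).
Proof.
move=> Hv; apply: X2r_ext => j x; rewrite toXE; last by have /X2P := rsum_X2 lo hi s xi Hv; exact.
rewrite fn_sum pf_rsum; apply: eq_bigr => k _.
rewrite -[RHS]/(_ * fn (toX _) j x) toXE//; by have /X2P := Hv (xi k); exact.
Qed.

Lemma riemann_part v lo hi (w : edge_fun R m) : (forall t, X2 (v t)) -> X2 w ->
  is_X2_integral_le mu v lo hi w <->
  forall beta, is_riemann (X2hilbert mu_gt0) (fun s => toX (pf beta (v s))) lo hi (toX (pf beta w)).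
Proof.
move=> Hv Hw; split=> [[_ I] beta e e0|I].
  have [d d0 Hd] := I e e0; exists d => // s xi ps Hxi.
  have HX := rsum_X2 lo hi s xi Hv.
  rewrite -(toX_rsum beta lo hi s xi Hv) -(toX_sub beta HX Hw).
  apply: le_lt_trans (nrm_le_X2 beta (X2_sub_X2 HX Hw)) _.
  exact: Hd.
split=> // e e0; have e2 : 0 < e / 2 by rewrite divr_gt0.
have [d1 d10 H1] := I false _ e2; have [d2 d20 H2] := I true _ e2.
exists (Num.min d1 d2); first by rewrite lt_min d10.
move=> s xi ps Hxi; have HX := rsum_X2 lo hi s xi Hv.
apply: le_lt_trans (X2_le_nrm (X2_sub_X2 HX Hw)) _.
rewrite !(toX_sub _ HX Hw) !(toX_rsum _ lo hi s xi Hv) (splitr e).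
by apply: ltrD; [apply: H1 => // k /Hxi[]|apply: H2 => // k /Hxi[]]; rewrite lt_min => /andP[].
Qed.

Lemma integral_part v lo hi (w : edge_fun R m) : (forall t, X2 (v t)) -> X2 w ->
  is_X2_integral mu v lo hi w <->
  forall beta, is_integral (X2hilbert mu_gt0) (fun s => toX (pf beta (v s))) lo hi (toX (pf beta w)).
Proof.
move=> Hv Hw; rewrite /is_X2_integral /is_integral; case: ifP => ab; first exact: riemann_part.
have Nw : X2 (fun j x => - w j x).
  apply/X2P => beta j; move/X2P: Hw => /(_ beta j)/L2N; apply: L2_in => x _.
  by rewrite /pf partN.
have E beta : toX (pf beta (fun j x => - w j x)) = - toX (pf beta w).
  apply: X2r_ext => j x; rewrite toXE; last by move/X2P: Nw; exact.
  rewrite -[RHS]/(- fn (toX _) j x) toXE; last by move/X2P: Hw; exact.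
  by rewrite /pf partN.
by split=> [/(riemann_part _ _ Hv Nw) I beta|I]; [rewrite -E|apply/riemann_part => // beta; rewrite E].
Qed.

End Norms.
End Parts.

(** Square-integrable functions agree with their representatives only up to null vectors;
    the abstract equation does not see the difference. *)
Lemma perturb_null (R : realType) (E : lmodType R) (H : hilbert E) (P K : E -> E) :
  (forall x y, P (x - y) = P x - P y) -> (forall x y, K (x - y) = K x - K y) ->
  (forall x, hnull H x -> hnull H (P x)) -> (forall x, hnull H x -> hnull H (K x)) ->
  forall h r w W, hnull H (h - r) -> hnull H (w - W) -> P r = 0 ->
  hnull H (W - P W + K r) -> hnull H (P h) /\ hnull H (w - P w + K h).
Proof.
move=> PB KB nP nK h r w W nh nw Pr nW; have nPh := nP _ nh; have nPw := nP _ nw.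
have nKh := nK _ nh; split; apply: ip_null => z.
  by have := null_ip z nPh; rewrite PB Pr subr0.
move: (null_ip z nPw) (null_ip z nKh) (null_ip z nW) (null_ip z nw).
rewrite !PB !KB !(ipDl, ipNl); lra.
Qed.

(** * The domain of the network operator *)
Section Domain.
Variables (R : realType) (n m : nat) (G : graph n m).
Variables (mu : 'I_m -> R) (c c' : 'I_m -> R -> R).
Hypothesis c_AC : forall j, abscont (c j) (c' j).
Hypothesis c_gt0 : forall j (x : R), 0 <= x <= 1 -> 0 < c j x.
Implicit Types (f g w : edge_fun R m) (b : bool).
Local Open Scope complex_scope.

Definition inv_wt j (x : R) := (c j x)^-1.

Lemma inv_wt_gt0 j (x : R) : 0 <= x <= 1 -> 0 < inv_wt j x.
Proof. by move=> x01; rewrite invr_gt0 c_gt0. Qed.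

Lemma inv_wt_cont j : {within `[0, 1], continuous (inv_wt j)}.
Proof. by apply: cont01_inv; [exact: AC_cont (c_AC j)|exact: c_gt0]. Qed.

Lemma inv_wtK j (x y : R) : 0 <= x <= 1 -> inv_wt j x * (c j x * y) = y.
Proof. by move=> x01; rewrite mulrA mulVf ?mul1r// gt_eqF// c_gt0. Qed.

Lemma wtK j (x y : R) : 0 <= x <= 1 -> c j x * (inv_wt j x * y) = y.
Proof. by move=> x01; rewrite mulrA divff ?mul1r// gt_eqF// c_gt0. Qed.

Lemma ae01_01 (f g : R -> R) : (forall x, 0 <= x <= 1 -> f x = g x) -> ae01 f g.
Proof. by move=> fg; apply: ae01_in => x /andP[/ltW x0 /ltW x1]; rewrite fg// x0. Qed.

Lemma ae01_mull (k u v : R -> R) : ae01 u v -> ae01 (fun x => k x * u x) (fun x => k x * v x).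
Proof. by apply: filterS => x Hx /Hx ->. Qed.

Lemma part_crep b (f : R -> R[i]) x : part b (ccrep f x) = crep (fun y => part b (f y)) x.
Proof. by case: b. Qed.

Lemma part_cwderiv b (f : R -> R[i]) x : part b (cwderiv f x) = wderiv (fun y => part b (f y)) x.
Proof. by case: b. Qed.

Lemma pf_opA b w j : pf b (opA c w) j = wderiv (fun x => c j x * wderiv (pf b w j) x).
Proof.
apply/funext => x; rewrite /pf /opA part_cwderiv; congr (wderiv _ x).
by apply/funext => y; rewrite partZ part_cwderiv.
Qed.

Lemma cH_part (Q : (R -> R) -> Prop) (f : R -> R[i]) :
  reim_prop Q f <-> forall b, Q (fun x => part b (f x)).
Proof. by split=> [[? ?] []|Hf] //; split; [exact: Hf false|exact: Hf true]. Qed.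

Lemma Phi_plusE (d : 'cV[R[i]]_n) w (x : R) : (Phi_plus R G)^T *m d = trace w x <->
  forall b j, part b (d (e0 G j) 0) = crep (pf b w j) x.
Proof.
have E j : ((Phi_plus R G)^T *m d) j 0 = d (e0 G j) 0.
  rewrite mxE (bigD1 (e0 G j))//= !mxE eqxx mul1r big1 ?addr0// => i /negPf ne.
  by rewrite !mxE eq_sym ne mul0r.
split=> [/matrixP Ed b j|Ed].
  by have := Ed j 0; rewrite E => ->; rewrite mxE part_crep.
apply/matrixP => j k; rewrite (ord1 k) E mxE; apply: part_eq => b.
by rewrite part_crep; exact: Ed.
Qed.

Lemma Phi_minusE (d : 'cV[R[i]]_n) w (x : R) : (Phi_minus R G)^T *m d = trace w x <->
  forall b j, part b (d (e1 G j) 0) = crep (pf b w j) x.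
Proof.
have E j : ((Phi_minus R G)^T *m d) j 0 = d (e1 G j) 0.
  rewrite mxE (bigD1 (e1 G j))//= !mxE eqxx mul1r big1 ?addr0// => i /negPf ne.
  by rewrite !mxE eq_sym ne mul0r.
split=> [/matrixP Ed b j|Ed].
  by have := Ed j 0; rewrite E => ->; rewrite mxE part_crep.
apply/matrixP => j k; rewrite (ord1 k) E mxE; apply: part_eq => b.
by rewrite part_crep; exact: Ed.
Qed.

Lemma part_flux b (v : 'I_m -> R -> R) (e : 'I_m -> 'I_n) w (x : R) i :
  part b (\sum_j (if e j == i then (mu j * v j x)%:C else 0) * ccrep (cwderiv (w j)) x) =
  \sum_j mu j * (v j x * crep (wderiv (pf b w j)) x) * (e j == i)%:R.
Proof.
rewrite part_sum; apply: eq_bigr => j _; have -> : (if e j == i then (mu j * v j x)%:C else 0) =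
    (mu j * v j x * (e j == i)%:R)%:C.
  by case: (e j == i); rewrite ?mulr1// mulr0.
rewrite partZ part_crep mulrAC mulrA; congr (_ * crep _ x * _).
by apply/funext => y; rewrite part_cwderiv.
Qed.

Lemma Phi_wE w : Phi_w_plus G mu c *m trace (deriv_x w) 0 =
    Phi_w_minus G mu c *m trace (deriv_x w) 1 <->
  forall b i, \sum_j mu j * (c j 0 * crep (wderiv (pf b w j)) 0) * (e0 G j == i)%:R =
              \sum_j mu j * (c j 1 * crep (wderiv (pf b w j)) 1) * (e1 G j == i)%:R.
Proof.
have E0 i : (Phi_w_plus G mu c *m trace (deriv_x w) 0) i 0 =
    \sum_j (if e0 G j == i then (mu j * c j 0)%:C else 0) * ccrep (cwderiv (w j)) 0.
  by rewrite mxE; apply: eq_bigr => j _; rewrite !mxE.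
have E1 i : (Phi_w_minus G mu c *m trace (deriv_x w) 1) i 0 =
    \sum_j (if e1 G j == i then (mu j * c j 1)%:C else 0) * ccrep (cwderiv (w j)) 1.
  by rewrite mxE; apply: eq_bigr => j _; rewrite !mxE.
split=> [/matrixP Ed b i|Ed].
  by have := congr1 (part b) (Ed i 0); rewrite E0 E1 !part_flux.
apply/matrixP => i k; rewrite (ord1 k) E0 E1; apply: part_eq => b.
by rewrite !part_flux; exact: Ed.
Qed.

(** The weak derivatives have continuous representatives [W] and [Q], and the flux [c Q] is
    absolutely continuous by the product rule. *)
Lemma domA_netdom w : domA G mu c w -> forall b, exists W q r d,
  [/\ netdom G mu inv_wt W q r d,
      forall j, ae01 (pf b w j) (W j) & forall j, ae01 (pf b (opA c w) j) (r j)].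
Proof.
move=> [H2w [_ [d [/Phi_plusE d0 /Phi_minusE d1]]] /Phi_wE Kw] b.
have Hj j : exists p : ((R -> R) * (R -> R)) * ((R -> R) * (R -> R)),
    sobolev (pf b w j) p.1.1 p.1.2 /\ sobolev (wderiv (pf b w j)) p.2.1 p.2.2.
  have [H1w H1d] := (cH_part _ _).1 (H2w j) b.
  have [W [W' HW]] := H1_sobolev H1w; have [Q [Q' HQ]] := H1_sobolev H1d.
  by exists ((W, W'), (Q, Q')).
have [p Hp] := choice Hj.
pose W j := (p j).1.1; pose Q j := (p j).2.1.
have I0 : 0 <= (0 : R) <= 1 by rewrite lexx ler01.
have I1 : 0 <= (1 : R) <= 1 by rewrite lexx ler01.
pose q j x := c j x * Q j x; pose r j x := c' j x * Q j x + c j x * (p j).2.2 x.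
have AQ j : abscont (Q j) (p j).2.2 by have [_ [_ _ ?]] := Hp j.
have aQ j : ae01 (wderiv (pf b w j)) (Q j) by have [_ [_ ? _]] := Hp j.
have cQ j : {within `[0, 1], continuous (Q j)} by exact: AC_cont (AQ j).
have Aq j : abscont (q j) (r j) by exact: ACM (c_AC j) (AQ j).
have HW j : abscont (W j) (fun x => inv_wt j x * q j x).
  have [sW _] := Hp j; have [_ _ AW] := sW.
  have cl : {within `[0, 1], continuous (fun x => inv_wt j x * q j x)}.
    apply: AC_cont (ACM (AC_inv (c_AC j) (c_gt0 j)) (Aq j)).
  apply: AC_ae AW; first exact: cont01_meas.
  apply: ae01_trans (ae01_sym (sobolev_wderiv sW).2) _; apply: ae01_trans (aQ j) _.
  by apply: ae01_01 => x x01; rewrite /q inv_wtK.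
exists W, q, r, (fun i => part b (d i 0)); split.
- split=> // [j|j|i].
  + by rewrite d0; have [sW _] := Hp j; rewrite (sobolev_crep sW I0).
  + by rewrite d1; have [sW _] := Hp j; rewrite (sobolev_crep sW I1).
  have := Kw b i; congr (_ = _); apply: eq_bigr => j _; have [_ sQ] := Hp j.
    by rewrite (sobolev_crep sQ I0).
  by rewrite (sobolev_crep sQ I1).
- by move=> j; have [[_ ? _] _] := Hp j.
move=> j; rewrite pf_opA; have mc := cont01_meas (AC_cont (c_AC j)).
have [_ sQ] := Hp j; have [md _ _] := sQ.
have S : sobolev (fun x => c j x * wderiv (pf b w j) x) (q j) (r j).
  split=> //; first exact: meas01M.
  exact: ae01_mull.
exact: (sobolev_wderiv S).2.
Qed.

(** Conversely [W'] is [q / c], again absolutely continuous because [1 / c] is, so that [W]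
    has a second weak derivative. *)
Lemma netdom_domA w (W q r : bool -> 'I_m -> R -> R) (d : bool -> 'I_n -> R) : X2 w ->
  (forall b, netdom G mu inv_wt (W b) (q b) (r b) (d b)) ->
  (forall b j, ae01 (pf b w j) (W b j)) ->
  domA G mu c w /\ forall b j, ae01 (pf b (opA c w) j) (r b j).
Proof.
move=> /X2P Lw HN aW.
have I0 : 0 <= (0 : R) <= 1 by rewrite lexx ler01.
have I1 : 0 <= (1 : R) <= 1 by rewrite lexx ler01.
have sW b j : sobolev (pf b w j) (W b j) (fun x => inv_wt j x * q b j x).
  by split=> //; [exact: L2_meas|have [+ _ _ _ _] := HN b; exact].
have Aq b j : abscont (q b j) (r b j) by have [_ + _ _ _] := HN b; exact.
have sQ b j : sobolev (wderiv (pf b w j)) (fun x => inv_wt j x * q b j x)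
    (fun x => - (c' j x * (c j x)^-1 ^+ 2) * q b j x + inv_wt j x * r b j x).
  split; first by apply: L2_meas; exact: sobolev_wderiv_L2 (sW b j).
    exact: (sobolev_wderiv (sW b j)).2.
  exact: ACM (AC_inv (c_AC j) (c_gt0 j)) (Aq b j).
split; last first.
  move=> b j; rewrite pf_opA; have mc := cont01_meas (AC_cont (c_AC j)).
  have [md ad _] := sQ b j.
  have S : sobolev (fun x => c j x * wderiv (pf b w j) x) (q b j) (r b j).
    split=> //; first exact: meas01M.
    apply: ae01_trans (_ : ae01 _ (fun x => c j x * (inv_wt j x * q b j x))) _.
      exact: ae01_mull.
    by apply: ae01_01 => x x01; rewrite wtK.
  exact: (sobolev_wderiv S).2.
have H1w j : cH1 (w j) by apply/cH_part => b; exact: sobolev_H1 (sW b j).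
split.
- move=> j; apply/cH_part => b; split; first exact: sobolev_H1 (sW b j).
  exact: sobolev_H1 (sQ b j).
- split=> //; exists (\col_i (d false i +i* d true i)); split.
    apply/Phi_plusE => b j; rewrite mxE (sobolev_crep (sW b j) I0).
    by have [_ _ -> _ _] := HN b; case: b.
  apply/Phi_minusE => b j; rewrite mxE (sobolev_crep (sW b j) I1).
  by have [_ _ _ -> _] := HN b; case: b.
apply/Phi_wE => b i; have [_ _ _ _ Kq] := HN b; have := Kq i.
congr (_ = _); apply: eq_bigr => j _.
  by rewrite (sobolev_crep (sQ b j) I0) wtK.
by rewrite (sobolev_crep (sQ b j) I1) wtK.
Qed.

(** ** Mild solutions *)

Hypothesis mu_gt0 : forall j, 0 < mu j.
Hypothesis G_conn : connected_graph G.
Hypothesis m_gt0 : (0 < m)%N.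
Local Notation H := (X2hilbert mu_gt0).
Local Notation nrm := (hnrm H).
Local Notation null := (hnull H).
Local Notation ip := (ip H).
Local Notation K := (resX G mu inv_wt_cont).
Local Notation P := (@meanX R m mu).
Local Notation net_mild := (net_mild G mu_gt0 inv_wt_cont).

Lemma null_mean (x : X2r R m) : null x -> null (P x).
Proof.
move=> x0; apply: ip_null => z; rewrite (meanX_sym mu_gt0 m_gt0); exact: null_ip.
Qed.

Lemma null_res (x : X2r R m) : null x -> null (K x).
Proof.
move=> x0; apply: ip_null => z.
rewrite (resX_sym mu_gt0 inv_wt_cont inv_wt_gt0 G_conn m_gt0); exact: null_ip.
Qed.

Lemma meanXB (x y : X2r R m) : P (x - y) = P x - P y.
Proof. by rewrite -scaleN1r (meanXD mu_gt0) (meanXZ mu_gt0) scaleN1r. Qed.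

Lemma resXB (x y : X2r R m) : K (x - y) = K x - K y.
Proof. by rewrite -scaleN1r (resXD _ mu_gt0) (resXZ _ mu_gt0) scaleN1r. Qed.

Lemma null_combine (h r w W : X2r R m) : null (h - r) -> null (w - W) -> P r = 0 ->
  null (W - P W + K r) -> null (P h) /\ null (w - P w + K h).
Proof. exact: (perturb_null meanXB resXB null_mean null_res). Qed.

Lemma null_toX (u v : 'I_m -> R -> R) : (forall j, L2 (u j)) -> (forall j, L2 (v j)) ->
  null (toX u - toX v) <-> forall j, ae01 (u j) (v j).
Proof.
move=> Lu Lv; rewrite null_ae; have E j x : fn (toX u - toX v) j x = u j x - v j x.
  by rewrite -[LHS]/(fn (toX u) j x - fn (toX v) j x) !toXE.
split=> Hj j; have := Hj j; apply: filterS => x Hx x01; have := Hx x01.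
  by rewrite E => /eqP; rewrite subr_eq0 => /eqP.
by rewrite E => ->; rewrite subrr.
Qed.

Lemma opA_L2 w : domA G mu c w -> forall b, exists W q r d,
  [/\ netdom G mu inv_wt W q r d, (forall j, L2 (W j)) /\ (forall j, L2 (r j)),
      forall j, ae01 (pf b w j) (W j) & forall j, ae01 (pf b (opA c w) j) (r j)].
Proof.
move=> /domA_netdom/[swap] b /(_ b)[W [q [r [d [HN aW aA]]]]]; exists W, q, r, d; split=> //.
have [H1 H2 _ _ _] := HN; split=> j; first exact: abscont_L2 (H1 j).
exact: AC_L2 (H2 j).
Qed.

Lemma scaled_X2 (t : R) (v : edge_fun R m) : X2 v -> X2 (fun j x => t%:C * v j x).
Proof.
move=> /X2P Hv; apply/X2P => b j; apply: L2_in (L2Z t (Hv b j)) => x _.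
by rewrite /pf partZ.
Qed.

Lemma toX_scaled b (t : R) (v : edge_fun R m) : X2 v ->
  toX (pf b (fun j x => t%:C * v j x)) = t *: toX (pf b v).
Proof.
move=> Hv; have /X2P Hs := scaled_X2 t Hv; move/X2P: Hv => Hv; apply: X2r_ext => j x.
by rewrite toXE// -[RHS]/(t * fn (toX (pf b v)) j x) toXE// /pf partZ.
Qed.

Lemma integral_ext (v v' : R -> X2r R m) lo hi (w : X2r R m) : (forall s, v s = v' s) ->
  is_integral H v lo hi w -> is_integral H v' lo hi w.
Proof. by move=> /funext ->. Qed.

Lemma hcont_ext (v v' : R -> X2r R m) : (forall s, v s = v' s) -> hcont H v -> hcont H v'.
Proof. by move=> /funext ->. Qed.

Lemma mild_part f g u b : X2 f -> X2 g -> mild_solution G mu c f g u ->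
  net_mild (toX (pf b f)) (toX (pf b g)) (fun t => toX (pf b (u t))).
Proof.
move=> Hf Hg [cu Hu]; have uX := cu.1; split; first exact: X2_hcont.
move=> t; have [w [I D E]] := Hu t.
have wX : X2 w by move: I; rewrite /is_X2_integral; case: ifP => _ [] // + _;
  move=> /X2P Nw; apply/X2P => beta j; move: (L2N (Nw beta j)); apply: L2_in => x _;
  rewrite /pf partN opprK.
have [W [q [r [d [HN [LW Lr] aW aA]]]]] := opA_L2 D b.
exists (toX (pf b w)).
have Ib : is_integral H (fun s => (t - s) *: toX (pf b (u s))) 0 t (toX (pf b w)).
  have := (integral_part mu_gt0 0 t (fun s => scaled_X2 (t - s) (uX s)) wX).1 I b.
  by apply: integral_ext => s; exact: toX_scaled.
have fL := (X2P f).1 Hf b; have gL := (X2P g).1 Hg b; have uL := (X2P (u t)).1 (uX t) b.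
have wL := (X2P w).1 wX b.
set h := toX (pf b (u t)) - _ - _.
have nh : null (h - toX r).
  apply/null_ae => j; have := E j; have := aA j; apply: filterS2 => x Hx Ex x01.
  rewrite -[LHS]/(fn (toX (pf b (u t))) j x - fn (toX (pf b f)) j x - t * fn (toX (pf b g)) j x
    - fn (toX r) j x) !toXE//.
  by rewrite -(Hx x01) /pf (Ex x01) !partD partZ; ring.
have nw : null (toX (pf b w) - toX W) by apply/null_toX.
have Pr : P (toX r) = 0.
  apply: X2r_ext => j x; rewrite -[LHS]/(mean mu (fn (toX r))) toXE// /mean.
  by rewrite (netdom_mean HN) mul0r.
have nK := netdom_resX mu_gt0 inv_wt_cont inv_wt_gt0 G_conn m_gt0 LW Lr HN.
rewrite !toX_mk in nK.
have [n1 n2] := null_combine nh nw Pr nK.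
split; [exact: Ib|exact: n1|exact: n2].
Qed.

Definition join_parts (U : bool -> 'I_m -> R -> R) : edge_fun R m :=
  fun j x => U false j x +i* U true j x.

Lemma pf_join b U j x : pf b (join_parts U) j x = U b j x.
Proof. by case: b. Qed.

Lemma toX_join b (U : bool -> X2r R m) : toX (pf b (join_parts (fun b => fn (U b)))) = U b.
Proof.
apply: X2r_ext => j x; rewrite toXE ?pf_join// => k.
by apply: L2_in (fn_L2 (U b) k) => y _; rewrite pf_join.
Qed.

Lemma join_X2 (U : bool -> X2r R m) : X2 (join_parts (fun b => fn (U b))).
Proof.
by apply/X2P => b j; apply: L2_in (fn_L2 (U b) j) => y _; rewrite pf_join.
Qed.

(** The curve [w] attached to the real and imaginary parts is, by the abstract equation, a
    constant minus a resolvent, so it is in the domain. *)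
Lemma mild_join f g (U : bool -> R -> X2r R m) : X2 f -> X2 g ->
  (forall b, net_mild (toX (pf b f)) (toX (pf b g)) (U b)) ->
  mild_solution G mu c f g (fun t => join_parts (fun b => fn (U b t))).
Proof.
move=> Hf Hg HU; have uX t : X2 (join_parts (fun b => fn (U b t))) by exact: (join_X2 (U ^~ t)).
have uE b t : toX (pf b (join_parts (fun b => fn (U b t)))) = U b t by exact: (toX_join b (U ^~ t)).
split.
  apply: (@hcont_X2 R m mu mu_gt0 _ uX) => b; have [+ _] := HU b.
  by apply: hcont_ext => t; rewrite uE.
move=> t; have Hb b : exists w : X2r R m, [/\ is_integral H (fun s => (t - s) *: U b s) 0 t w,
    null (P (U b t - toX (pf b f) - t *: toX (pf b g))) &
    null (w - P w + K (U b t - toX (pf b f) - t *: toX (pf b g)))].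
  by have [_ Hb] := HU b; exact: Hb.
have [w Hw] := choice Hb; pose h b := U b t - toX (pf b f) - t *: toX (pf b g).
have wX := join_X2 w.
have DN b := netdomB (netdom_cst G mu inv_wt (mean mu (fn (w b))))
  (res_netdom mu_gt0 inv_wt_cont inv_wt_gt0 G_conn m_gt0 (h b)).
have aw b j : ae01 (pf b (join_parts (fun b => fn (w b))) j)
    (fun x => mean mu (fn (w b)) - res G mu inv_wt (h b) j x).
  have [_ _ /null_ae/(_ j)] := Hw b; apply: filterS => x Hx x01.
  have := Hx x01; rewrite pf_join -[X in X = _ -> _]/(fn (w b) j x - mean mu (fn (w b))
    + res G mu inv_wt (h b) j x) => Ex.
  by apply/eqP; rewrite -subr_eq0 opprB addrA -Ex addrAC; apply/eqP; ring.
have [Dw Aw] := netdom_domA wX DN aw.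
exists (join_parts (fun b => fn (w b))); split=> //.
  apply/(integral_part mu_gt0 0 t (fun s => scaled_X2 (t - s) (uX s)) wX) => b.
  rewrite toX_join; have [+ _ _] := Hw b; apply: integral_ext => s.
  by rewrite toX_scaled// uE.
move=> j; have := Aw false j; have := Aw true j.
have mh b : mean mu (fn (h b)) = 0.
  have [_ /null_ae/(_ (Ordinal m_gt0)) Ph _] := Hw b.
  by apply: (cont01_ae0 (AC_cont (AC_cst (mean mu (fn (h b))))) Ph (x := 0)); rewrite lexx ler01.
apply: filterS2 => x Hx1 Hx0 x01; apply: part_eq => b.
have fL := (X2P f).1 Hf b; have gL := (X2P g).1 Hg b.
have Ex : pf b (opA c (join_parts (fun b => fn (w b)))) j x = ctr mu (h b) j x.
  by case: b {fL gL}; [rewrite (Hx1 x01)|rewrite (Hx0 x01)]; rewrite sub0r opprK.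
rewrite !partD partZ -[part b (opA _ _ _ _)]/(pf b _ j x) Ex /ctr mh subr0.
rewrite -[fn (h b) j x]/(fn (U b t) j x - fn (toX (pf b f)) j x - t * fn (toX (pf b g)) j x).
by rewrite !toXE// -/(pf b f j x) -/(pf b g j x) -[LHS]/(pf b (join_parts (fun b => fn (U b t))) j x) pf_join; ring.
Qed.

End Domain.

(** * Functions with absolutely continuous derivatives *)
Section Regularity.
Variable R : realType.
Implicit Types (F G f g : R -> R) (x y d a b e : R).

(** The derivatives are the densities of successive primitives, which avoids one-sided
    derivatives at 0 and 1. *)
Fixpoint Cn (k : nat) F : Prop :=
  if k is l.+1 then exists2 F', Cn l F' & abscont F F'
  else {within `[0, 1], continuous F}.

Lemma Cn_cont k F : Cn k F -> {within `[0, 1], continuous F}.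
Proof. by case: k => //= k [F' _]; exact: AC_cont. Qed.

Lemma CnS k F : Cn k.+1 F -> Cn k F.
Proof.
elim: k F => [|k IH] F [F' CF' AF]; first exact: AC_cont AF.
by exists F' => //; exact: IH.
Qed.

Lemma Cn_eq k F G : (forall x, 0 <= x <= 1 -> F x = G x) -> Cn k F -> Cn k G.
Proof.
case: k => [|k] FG /=; last by move=> [F' CF' AF]; exists F' => //; exact: AC_eq AF.
move=> cF; have E : {in `[0, 1], F =1 G}.
  by move=> x; rewrite in_itv/=; exact: FG.
by apply/(subspace_eq_continuous (f := F)) => // x; rewrite inE/= => xI; exact: E.
Qed.

Lemma Cn_ae k F f g : abscont F f -> Cn k g -> ae01 f g -> Cn k.+1 F.
Proof.
move=> AF Cg fg; exists g => //; apply: AC_ae AF => //.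
by apply: cont01_meas; exact: Cn_cont Cg.
Qed.

Lemma Cn_cst k a : Cn k (fun=> a).
Proof.
elim: k a => [|k IH] a /=; last by exists (fun=> 0) => //; exact: AC_cst.
exact: AC_cont (AC_cst a).
Qed.

Lemma CnD k F G : Cn k F -> Cn k G -> Cn k (fun x => F x + G x).
Proof.
elim: k F G => [|k IH] F G /=; last first.
  move=> [F' CF AF] [G' CG AG]; exists (fun x => F' x + G' x); first exact: IH.
  exact: ACD.
by move=> cF cG x; apply: continuousD; [exact: cF|exact: cG].
Qed.

Lemma CnM k F G : Cn k F -> Cn k G -> Cn k (fun x => F x * G x).
Proof.
elim: k F G => [|k IH] F G; last first.
  move=> CF1 CG1; have CF := CnS CF1; have CG := CnS CG1.
  move: CF1 CG1 => [F' CF' AF] [G' CG' AG].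
  exists (fun x => F' x * G x + F x * G' x); last exact: ACM.
  by apply: CnD; exact: IH.
by move=> cF cG x; apply: continuousM; [exact: cF|exact: cG].
Qed.

Lemma CnN k F : Cn k F -> Cn k (fun x => - F x).
Proof.
by move=> /(CnM (Cn_cst k (- 1))); apply: Cn_eq => x _; rewrite mulN1r.
Qed.

Lemma Cn_inv k F : (forall x, 0 <= x <= 1 -> 0 < F x) -> Cn k F -> Cn k (fun x => (F x)^-1).
Proof.
move=> F0; elim: k => [|k IH] CF; first exact: cont01_inv.
have CI := IH (CnS CF); move: CF => [F' CF' AF].
exists (fun x => - (F' x * (F x)^-1 ^+ 2)); last exact: AC_inv.
by apply: CnN; apply: CnM => //; apply: CnM.
Qed.

Lemma smooth_Cn k F : smooth F -> Cn k F.
Proof.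
elim: k F => [|k IH] F sF; first exact: smooth_cont01.
by exists (derive1 F); [apply: IH; exact: smooth_derive|exact: smooth_abscont].
Qed.

Lemma near01 (x : R) : 0 < x < 1 -> \forall y \near x, 0 < y < 1.
Proof.
move=> /andP[x0 x1]; near=> y; apply/andP; split; near: y.
  exact: lt_nbhsr.
exact: lt_nbhsl.
Unshelve. all: by end_near. Qed.

Lemma is_derive01 F G x d : 0 < x < 1 -> (forall y, 0 < y < 1 -> F y = G y) ->
  is_derive x 1 F d -> is_derive x 1 G d.
Proof.
move=> x01 FG; apply: near_eq_is_derive.
by have := near01 x01; apply: filterS => y /FG ->.
Qed.

Lemma smooth01_Cn k F : smooth01 F -> Cn k F.
Proof.
move=> [cF SF]; suff : forall l g, {within `[0, 1], continuous g} ->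
    (forall x, x \in `]0, 1[ -> g x = derive1n l F x) -> Cn k g.
  by move=> /(_ 0%N F cF); apply.
elim: k => [|k IH] l g cg gE //.
have [_ [g' [cg' g'E]]] := SF l.+1; exists g'; first exact: IH l.+1 g' cg' g'E.
apply: is_derive_abscont => // x x01; have [Dl _] := SF l.
have xI : x \in `]0, 1[ by rewrite in_itv.
have D : is_derive x 1 (derive1n l F) (g' x).
  by rewrite g'E//= derive1E; apply/derivableP; exact: Dl.
by apply: is_derive01 D => // y y01; rewrite gE// in_itv.
Qed.

Lemma derive_eq01 F G : (forall x, 0 < x < 1 -> F x = G x) -> forall x, 0 < x < 1 ->
  derive1 F x = derive1 G x /\ (derivable F x 1 -> derivable G x 1).
Proof.
move=> FG x x01; have N : \near x, F x = G x.
  by have := near01 x01; apply: filterS => y; exact: FG.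
by split; [rewrite !derive1E; exact: near_eq_derive|exact: near_eq_derivable].
Qed.

Lemma derive1n_eq01 k F G : (forall x, 0 < x < 1 -> F x = G x) ->
  forall x, 0 < x < 1 -> derive1n k F x = derive1n k G x.
Proof.
move=> FG; elim: k => [|k IH] x x01; first exact: FG.
by have [E _] := derive_eq01 IH x01; rewrite !derive1nS.
Qed.

Lemma Cn_derive k F : Cn k.+1 F -> (forall x, 0 < x < 1 -> derivable (derive1n k F) x 1) /\
  exists g : R -> R, {within `[0, 1], continuous g} /\ forall x, 0 < x < 1 -> g x = derive1n k F x.
Proof.
elim: k F => [|k IH] F CF.
  have cF := Cn_cont CF; move: CF => [F' CF' AF]; split; last by exists F.
  move=> x x01; have := AC_is_derive AF x01 (cont01_interior CF' x01).
  by move=> [].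
move: CF => [F' CF' AF]; have [D [g [cg gE]]] := IH _ CF'.
have cF' : {within `[0, 1], continuous F'} := @Cn_cont k.+1 F' CF'.
have E x : 0 < x < 1 -> F' x = derive1 F x.
  move=> x01; have [_ <-] := AC_is_derive AF x01 (cont01_interior cF' x01).
  by rewrite derive1E.
have Ek x : 0 < x < 1 -> derive1n k F' x = derive1n k.+1 F x /\
    (derivable (derive1n k F') x 1 -> derivable (derive1n k.+1 F) x 1).
  rewrite derive1Sn => x01; split; first exact: derive1n_eq01.
  by have [] := derive_eq01 (derive1n_eq01 k E) x01.
split=> [x x01|]; first by have [_] := Ek x x01; apply; exact: D.
by exists g; split=> // x x01; rewrite gE//; have [] := Ek x x01.
Qed.

Lemma Cn_smooth01 F : (forall k, Cn k F) -> smooth01 F.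
Proof.
move=> CF; split; first exact: (CF 0%N).
move=> k; have [D [g [cg gE]]] := Cn_derive (CF k.+1); split.
  by move=> x; rewrite in_itv/=; exact: D.
by exists g; split=> // x; rewrite in_itv/=; exact: gE.
Qed.

(** The derivative provided at each order is the same continuous function. *)
Lemma Cinf_derive F : (forall k, Cn k F) ->
  exists2 F', (forall k, Cn k F') & abscont F F'.
Proof.
move=> CF; have [F' CF' AF] := CF 1%N; exists F' => // k.
have [Fk CFk AFk] := CF k.+1; apply: (Cn_eq _ CFk).
apply: cont01_ae_eq; [exact: Cn_cont CFk|exact: CF'|].
exact: abscont_deriv_unique AFk AF.
Qed.

Lemma abscont_limit0 F f (s : R) : abscont F f -> 0 <= s <= 1 ->
  (forall e : R, 0 < e -> exists2 x : R, 0 <= x <= 1 & F x = 0 /\ `|x - s| <= e) -> F s = 0.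
Proof.
move=> [Lf E] s01 Hx; apply/eqP; rewrite -sqrf_eq0 eq_le sqr_ge0 andbT.
set C := int01 (fun z => f z ^+ 2); have C0 : 0 <= C by apply: int01_ge0 => z _; exact: sqr_ge0.
apply/ler_addgt0Pr => e e0; rewrite add0r.
have e1 : 0 < e / (C + 1) by rewrite divr_gt0// ltr_wpDl.
have [x x01 [Fx xs]] := Hx _ e1.
have := prim_holder Lf x01 s01; have Es := E _ s01; have Ex := E _ x01.
have -> : prim f s - prim f x = F s by rewrite Ex in Fx; rewrite Es; lra.
move=> /le_trans; apply; rewrite -/C distrC.
apply: (@le_trans _ _ ((C + 1) * (e / (C + 1)))); last by rewrite mulrC divfK// gt_eqF// ltr_wpDl.
by apply: ler_pM => //; rewrite lerDl.
Qed.

(** Contrary to test functions, only the values on [0, 1] matter: the weights, which are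
    smooth on [0, 1] only, can be multiplied in. *)
Definition Cinf0 F := (forall k, Cn k F) /\
  exists2 a : R, 0 < a & forall x, 0 <= x <= 1 -> (x < a) || (1 - a < x) -> F x = 0.

Lemma Cinf0M c F : (forall k, Cn k c) -> Cinf0 F -> Cinf0 (fun x => c x * F x).
Proof.
move=> Cc [CF [a a0 Fa]]; split=> [k|]; first exact: CnM.
by exists a => // x x01 xa; rewrite Fa ?mulr0.
Qed.

Lemma Cinf0N F : Cinf0 F -> Cinf0 (fun x => - F x).
Proof.
move=> [CF [a a0 Fa]]; split=> [k|]; first exact: CnN.
by exists a => // x x01 xa; rewrite Fa ?oppr0.
Qed.

Lemma Cinf0_ends F : Cinf0 F -> F 0 = 0 /\ F 1 = 0.
Proof.
move=> [_ [a a0 Fa]]; split; apply: Fa; rewrite ?lexx ?ler01 ?a0//.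
by rewrite gtrBl a0 orbT.
Qed.

(** The derivative vanishes near the end points inside the interval, and at the end points
    themselves by continuity. *)
Lemma Cinf0_derive F : Cinf0 F -> exists2 F', Cinf0 F' & abscont F F'.
Proof.
move=> [CF [a a0 Fa]]; have [F' CF' AF] := Cinf_derive CF; exists F' => //.
have in0 x : 0 < x < 1 -> (x < a) || (1 - a < x) -> F' x = 0.
  move=> x01 xa; have [_ <-] := AC_is_derive AF x01 (cont01_interior (Cn_cont (CF' 0%N)) x01).
  rewrite -(derive_cst (0 : R) x (1 : R)); apply: near_eq_derive => //.
  have N : \forall y \near x, (y < a) || (1 - a < y).
    case/orP: xa => xa; near=> y; apply/orP; [left|right]; near: y; [exact: lt_nbhsl|exact: lt_nbhsr].
  have N1 := near01 x01; near=> y; apply: Fa; last by near: y.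
  have /andP[/ltW -> /ltW ->] // : 0 < y < 1 by near: y.
split=> //; exists a => // x x01 xa.
have [F'' _ AF''] := CF' 1%N.
have [/andP[x0 x1]|xe] := boolP (0 < x < 1); first by apply: in0 => //; rewrite x0.
apply: (abscont_limit0 AF'' x01) => e e0.
pose h := Num.min (e / 2) (Num.min (a / 2) (1 / 2)).
have h0 : 0 < h by rewrite !lt_min !divr_gt0.
have h1 : h <= e / 2 by rewrite ge_min lexx.
have h2 : h <= a / 2 by rewrite !ge_min lexx orbT.
have h3 : h <= 1 / 2 by rewrite !ge_min lexx !orbT.
have [x0|x0] := ltP 0 x.
  have x1 : x = 1.
    by move: xe x01; rewrite x0/= -leNgt => x1 /andP[_ x1']; apply/eqP; rewrite eq_le x1 x1'.
  exists (1 - h); first by apply/andP; split; lra.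
  split; first by apply: in0; [apply/andP; split; lra|apply/orP; right; lra].
  by rewrite x1 addrAC subrr add0r normrN gtr0_norm//; lra.
have x1 : x = 0 by apply/eqP; rewrite eq_le x0; case/andP: x01.
exists h; first by apply/andP; split; lra.
split; first by apply: in0; [apply/andP; split; lra|apply/orP; left; lra].
by rewrite x1 subr0 gtr0_norm//; lra.
Unshelve. all: by end_near. Qed.

Lemma test_fun_Cinf0 F : test_fun F -> Cinf0 F.
Proof.
move=> tF; split=> [k|]; first by apply: smooth_Cn; exact: test_fun_smooth.
have [_ [a [b [a0 b1 Fab]]]] := tF; exists (Num.min a (1 - b)).
  by rewrite lt_min a0 subr_gt0.
move=> x _ xa; apply: Fab; rewrite in_itv/= negb_and -!ltNge; case/orP: xa.
  by rewrite lt_min => /andP[-> _].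
move=> xb; apply/orP; right; apply: le_lt_trans xb.
have : Num.min a (1 - b) <= 1 - b by rewrite ge_min lexx orbT.
lra.
Qed.

End Regularity.

Lemma null_chain (R : realType) (E : lmodType R) (H : hilbert E) (P K : E -> E) x y z :
  (forall x y, K (x - y) = K x - K y) -> (forall x, hnull H x -> hnull H (K x)) ->
  hnull H (x - P x - K y) -> P y = 0 -> hnull H (y - P y - z) -> hnull H (x - P x - K z).
Proof.
move=> KB nK nx Py; rewrite Py subr0 => /nK ny.
by have := nullD nx ny; rewrite KB addrA subrK.
Qed.

(** * Regularity on the network *)
Section NetworkRegularity.
Variables (R : realType) (n m : nat) (G : graph n m).
Variables (mu : 'I_m -> R) (c c' : 'I_m -> R -> R).
Hypothesis c_AC : forall j, abscont (c j) (c' j).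
Hypothesis c_gt0 : forall j (x : R), 0 <= x <= 1 -> 0 < c j x.
Hypothesis mu_gt0 : forall j, 0 < mu j.
Hypothesis G_conn : connected_graph G.
Hypothesis m_gt0 : (0 < m)%N.
Hypothesis c_Cn : forall j k, Cn k (c j).
Local Notation H := (X2hilbert mu_gt0).
Local Notation null := (hnull H).
Local Notation ci_cont := (inv_wt_cont c_AC c_gt0).
Local Notation K := (resX G mu ci_cont).
Local Notation P := (@meanX R m mu).
Implicit Types (f y : X2r R m).

Lemma res_netdomE f j : abscont (res G mu (inv_wt c) f j)
    (fun x => inv_wt c j x * flux G mu (inv_wt c) f j x) /\
  abscont (flux G mu (inv_wt c) f j) (fun x => - ctr mu f j x).
Proof.
by have [H1 H2 _ _ _] := res_netdom mu_gt0 ci_cont (inv_wt_gt0 c_gt0) G_conn m_gt0 f.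
Qed.

(** The flux is a primitive of [mean f - f] and the resolvent is a primitive of the flux over
    the weight. *)
Lemma res_Cn k f j (h : R -> R) : Cn k h -> ae01 (fn f j) h -> Cn k.+2 (res G mu (inv_wt c) f j).
Proof.
move=> Ch fh; have [Hr Hf] := res_netdomE f j.
have CF : Cn k.+1 (flux G mu (inv_wt c) f j).
  have Cg : Cn k (fun x => - (h x + - mean mu (fn f))).
    by apply: CnN; apply: CnD => //; exact: Cn_cst.
  by apply: Cn_ae Hf Cg _; move: fh; apply: filterS => x Hx /Hx; rewrite /ctr => ->.
exists (fun x => inv_wt c j x * flux G mu (inv_wt c) f j x) => //.
by apply: CnM => //; apply: Cn_inv; [exact: c_gt0|exact: c_Cn].
Qed.

Lemma iter_res_Cn k y j : Cn k (fn (iter k.+1 K y) j).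
Proof.
elim: k => [|k IH]; first by have [Hr _] := res_netdomE y j; exact: AC_cont Hr.
rewrite iterS; apply: CnS; apply: (@res_Cn k _ _ (fn (iter k.+1 K y) j)) => //.
exact: ae01_refl.
Qed.

(** Functions vanishing near the vertices satisfy the vertex conditions trivially, so [phi]
    is in the domain, and [psi = - A phi] is again of the same kind. *)
Lemma Cinf0_preimage (phi : 'I_m -> R -> R) : (forall j, Cinf0 (phi j)) ->
  exists psi : 'I_m -> R -> R, [/\ forall j, Cinf0 (psi j), P (toX psi) = 0 &
    null (toX phi - P (toX phi) - K (toX psi))].
Proof.
move=> Tphi.
have D (F : 'I_m -> R -> R) : (forall j, Cinf0 (F j)) ->
    exists F' : 'I_m -> R -> R, forall j, Cinf0 (F' j) /\ abscont (F j) (F' j).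
  move=> TF; have ex j : exists F', Cinf0 F' /\ abscont (F j) F'.
    by have [F' ? ?] := Cinf0_derive (TF j); exists F'.
  by have [F' HF'] := choice ex; exists F'.
have [phi' Hphi'] := D _ Tphi; pose q j x := c j x * phi' j x.
have Tq j : Cinf0 (q j) by apply: Cinf0M; [exact: c_Cn|have [] := Hphi' j].
have [r Hr] := D _ Tq.
have cL (F : R -> R) : Cinf0 F -> L2 F by move=> [CF _]; apply: cont01_L2; exact: CF 0%N.
have HN : netdom G mu (inv_wt c) phi q r (fun=> 0).
  split=> [j|j|j|j|i].
  - have [_ A] := Hphi' j; apply: AC_ae A.
      apply: cont01_meas; apply: (Cn_cont (k := 0)); apply: CnM; last by have [] := Tq j.
      by apply: Cn_inv; [exact: c_gt0|exact: c_Cn].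
    by apply: ae01_01 => x x01; rewrite /q inv_wtK.
  - by have [] := Hr j.
  - by have [] := Cinf0_ends (Tphi j).
  - by have [] := Cinf0_ends (Tphi j).
  by apply: eq_bigr => j _; have [-> ->] := Cinf0_ends (Tq j); rewrite !mulr0 !mul0r.
have Lr j : L2 (r j) by apply: cL; have [] := Hr j.
have Lphi j : L2 (phi j) by exact: cL.
have Tpsi j : Cinf0 (fun x => - r j x) by apply: Cinf0N; have [] := Hr j.
have Lpsi j : L2 (fun x => - r j x) by exact: cL.
have psiE : toX (fun j x => - r j x) = - toX r.
  by apply: X2r_ext => j x; rewrite -[RHS]/(- fn (toX r) j x) !toXE.
exists (fun j x => - r j x); split=> //.
  apply: X2r_ext => j x; rewrite -[LHS]/(mean mu (fn (toX _))) toXE// /mean.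
  rewrite (_ : \sum_j0 _ = - \sum_j0 mu j0 * int01 (r j0)); last first.
    by rewrite -sumrN; apply: eq_bigr => k _; rewrite int01N ?mulrN//; exact: L2_int1.
  by rewrite (netdom_mean HN) oppr0 mul0r.
have := netdom_resX mu_gt0 ci_cont (inv_wt_gt0 c_gt0) G_conn m_gt0 Lphi Lr HN.
by rewrite !toX_mk psiE -[- toX r]scaleN1r (resXZ _ mu_gt0) scaleN1r opprK.
Qed.

Lemma Cinf0_range k (phi : 'I_m -> R -> R) : (forall j, Cinf0 (phi j)) ->
  exists y, P y = 0 /\ null (toX phi - P (toX phi) - iter k.+1 K y).
Proof.
elim: k phi => [|k IH] phi /Cinf0_preimage[psi [Tpsi Ppsi Hpsi]].
  by exists (toX psi); split; [exact: Ppsi|exact: Hpsi].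
have [y [Py Hy]] := IH _ Tpsi; exists y; split; first exact: Py.
rewrite iterS; apply: (null_chain _ _ Hpsi Ppsi Hy).
  exact: (resXB G c_AC c_gt0 mu_gt0).
exact: (null_res c_AC c_gt0 G_conn m_gt0).
Qed.

(** For each [k] the solution agrees almost everywhere with a function of class [Cn k]; all
    these functions are continuous, so they coincide. *)
Lemma net_mild_smooth (phi psi : 'I_m -> R -> R) (u : R -> X2r R m) :
  (forall j, Cinf0 (phi j)) -> (forall j, Cinf0 (psi j)) ->
  net_mild G mu_gt0 ci_cont (toX phi) (toX psi) u ->
  forall t j, exists2 h : R -> R, smooth01 h & ae01 (fn (u t) j) h.
Proof.
move=> Tphi Tpsi Hu t j.
have Hk k : exists h : R -> R, Cn k h /\ ae01 (fn (u t) j) h.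
  have [y [Py Hy]] := Cinf0_range k Tphi; have [z [Pz Hz]] := Cinf0_range k Tpsi.
  have [x [w]] := net_mild_range (inv_wt_gt0 c_gt0) G_conn m_gt0 t Hu Py Pz Hy Hz.
  move=> /null_ae/(_ j) E; exists (fun s => mean mu (fn x) + fn (iter k.+1 K w) j s); split.
    by apply: CnD; [exact: Cn_cst|exact: iter_res_Cn].
  by move: E; apply: filterS => s Hs /Hs /eqP; rewrite subr_eq0 => /eqP.
have [h Hh] := choice Hk; exists (h 0%N); last by have [] := Hh 0%N.
apply: Cn_smooth01 => k; have [Ck ak] := Hh k; have [C0 a0] := Hh 0%N.
apply: (Cn_eq _ Ck); apply: cont01_ae_eq => //; first exact: Cn_cont Ck.
exact: ae01_trans (ae01_sym ak) a0.
Qed.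

End NetworkRegularity.

(** * Well-posedness *)
Section WellPosedness.
Variables (R : realType) (n m : nat) (G : graph n m).
Variables (mu : 'I_m -> R) (c c' : 'I_m -> R -> R).
Hypothesis c_AC : forall j, abscont (c j) (c' j).
Hypothesis c_gt0 : forall j (x : R), 0 <= x <= 1 -> 0 < c j x.
Hypothesis mu_gt0 : forall j, 0 < mu j.
Hypothesis G_conn : connected_graph G.
Hypothesis m_gt0 : (0 < m)%N.
Local Notation H := (X2hilbert mu_gt0).
Local Notation nrm := (hnrm H).
Local Notation ci_cont := (inv_wt_cont c_AC c_gt0).
Implicit Types (f g w : edge_fun R m).

Lemma V_X2 f : V G f -> X2 f.
Proof. by move=> [Hf _] j; have [[? _] [? _]] := Hf j. Qed.

Lemma wave_exists f g : X2 f -> X2 g -> exists u, mild_solution G mu c f g u.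
Proof.
move=> Hf Hg.
have HU b : exists U, net_mild G mu_gt0 ci_cont (toX (pf b f)) (toX (pf b g)) U.
  by have [U HU _] := net_mild_ex mu_gt0 ci_cont (inv_wt_gt0 c_gt0) G_conn m_gt0
    (toX (pf b f)) (toX (pf b g)); exists U.
have [U HU'] := choice HU; exists (fun t => join_parts (fun b => fn (U b t))).
exact: (mild_join G_conn m_gt0 Hf Hg HU').
Qed.

Lemma wave_unique f g u v : X2 f -> X2 g -> mild_solution G mu c f g u ->
  mild_solution G mu c f g v -> forall t, X2_eq (u t) (v t).
Proof.
move=> Hf Hg Hu Hv t j; have uX := Hu.1.1 t; have vX := Hv.1.1 t.
have E b : ae01 (pf b (u t) j) (pf b (v t) j).
  have N := net_mild_unique (inv_wt_gt0 c_gt0) G_conn m_gt0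
    (mild_part c_AC c_gt0 mu_gt0 G_conn m_gt0 b Hf Hg Hu)
    (mild_part c_AC c_gt0 mu_gt0 G_conn m_gt0 b Hf Hg Hv) t.
  by move: j; apply/(null_toX mu_gt0) => //; [move/X2P: uX; exact|move/X2P: vX; exact].
have := E true; have := E false; apply: filterS2 => x E0 E1 x01; apply: part_eq => b.
by case: b; [exact: E1|exact: E0].
Qed.

Let one_gt0 (j : 'I_m) : 0 < (fun=> 1 : R) j. Proof. exact: ltr01. Qed.

Lemma nrm_le_tot (x : X2r R m) :
  nrm x <= Num.sqrt (tot mu) * hnrm (X2hilbert one_gt0) x.
Proof.
have t0 := tot_gt0 mu_gt0 m_gt0.
rewrite nrm_le ?mulr_ge0// exprMn sqr_sqrtr ?(ltW t0)// nrm_sqr.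
rewrite -[ip _ _ _]/(X2ip mu x x) -[ip _ _ _]/(X2ip (fun=> 1) x x) /X2ip mulr_sumr.
apply: ler_sum => j _; rewrite mul1r ler_wpM2r//.
  by apply: int01_ge0 => y _; rewrite -expr2 sqr_ge0.
by rewrite /tot (bigD1 j)//= lerDl; apply: sumr_ge0 => k _; exact: ltW.
Qed.

Lemma X2_norm_le_V f : X2_norm (fun=> 1) f <= V_norm f.
Proof.
rewrite /V_norm -{1}[X2_norm _ f]ger0_norm ?sqrtr_ge0// -sqrtr_sqr ler_sqrt.
  by rewrite lerDl sqr_ge0.
by rewrite addr_ge0// sqr_ge0.
Qed.

Lemma wave_sub_le f g u f0 g0 u0 t : X2 f -> X2 g -> X2 f0 -> X2 g0 ->
  mild_solution G mu c f g u -> mild_solution G mu c f0 g0 u0 ->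
  X2_norm mu (X2_sub (u t) (u0 t)) <=
    6 * (Num.sqrt (tot mu) * V_norm (X2_sub f f0)) + 6 * `|t| * X2_norm mu (X2_sub g g0).
Proof.
move=> Hf Hg Hf0 Hg0 Hu Hu0; have uX := Hu.1.1 t; have u0X := Hu0.1.1 t.
have E b : nrm (toX (pf b (X2_sub (u t) (u0 t)))) <=
    3 * (Num.sqrt (tot mu) * V_norm (X2_sub f f0)) + 3 * `|t| * X2_norm mu (X2_sub g g0).
  rewrite toX_sub//.
  apply: le_trans (net_mild_le (inv_wt_gt0 c_gt0) G_conn m_gt0 t
    (mild_part c_AC c_gt0 mu_gt0 G_conn m_gt0 b Hf Hg Hu)
    (mild_part c_AC c_gt0 mu_gt0 G_conn m_gt0 b Hf0 Hg0 Hu0)) _.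
  rewrite -(toX_sub b Hf Hf0) -(toX_sub b Hg Hg0); apply: lerD.
    rewrite ler_wpM2l//; apply: le_trans (nrm_le_tot _) _; rewrite ler_wpM2l//.
    by apply: le_trans (nrm_le_X2 one_gt0 b (X2_sub_X2 Hf Hf0)) _; exact: X2_norm_le_V.
  by rewrite ler_wpM2l ?mulr_ge0//; exact: nrm_le_X2 (X2_sub_X2 Hg Hg0).
apply: le_trans (X2_le_nrm mu_gt0 (X2_sub_X2 uX u0X)) _.
rewrite (_ : 6 * _ + _ = (3 * (Num.sqrt (tot mu) * V_norm (X2_sub f f0)) + 3 * `|t| * X2_norm mu (X2_sub g g0)) +
  (3 * (Num.sqrt (tot mu) * V_norm (X2_sub f f0)) + 3 * `|t| * X2_norm mu (X2_sub g g0))).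
  by apply: lerD; exact: E.
move: (_ * V_norm _) (X2_norm _ _) => p q; ring.
Qed.

Lemma wave_continuous (T : R) : 0 < T ->
  forall f0 g0, V G f0 -> X2 g0 ->
  forall eps : R, 0 < eps -> exists2 delta : R, 0 < delta &
    forall f g, V G f -> X2 g ->
      V_norm (X2_sub f f0) < delta -> X2_norm mu (X2_sub g g0) < delta ->
    forall u u0, mild_solution G mu c f g u -> mild_solution G mu c f0 g0 u0 ->
      (CX2_norm mu T (fun t => X2_sub (u t) (u0 t)) < eps%:E)%E.
Proof.
move=> T0 f0 g0 /V_X2 Hf0 Hg0 eps eps0; pose S := Num.sqrt (tot mu).
have S0 : 0 <= S by exact: sqrtr_ge0.
pose D := 12 * (S + T + 1); have D0 : 0 < D by rewrite /D; lra.
exists (eps / D); first exact: divr_gt0.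
move=> f g /V_X2 Hf Hg Vf Xg u u0 Hu Hu0.
have bnd t : t \in `[- T, T] -> X2_norm mu (X2_sub (u t) (u0 t)) <= eps / 2.
  rewrite in_itv/= -ler_norml => tT.
  apply: le_trans (wave_sub_le t Hf Hg Hf0 Hg0 Hu Hu0) _.
  have dD : eps = eps / D * D by rewrite divfK// gt_eqF.
  have e0 : 0 < eps / D by exact: divr_gt0.
  set e := eps / D in Vf Xg dD e0 *; rewrite [X in _ <= X / _]dD /D.
  have H1 : S * V_norm (X2_sub f f0) <= S * e by rewrite ler_wpM2l// ltW.
  have H2 : `|t| * X2_norm mu (X2_sub g g0) <= T * e.
    by apply: ler_pM => //; [exact: sqrtr_ge0|exact: ltW].
  rewrite -/S; nra.
apply: (@le_lt_trans _ _ (eps / 2)%:E); last by rewrite lte_fin ltr_pdivrMr// ltr_pMr// ltr1n.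
by apply: ge_ereal_sup => _ [t tT <-]; rewrite lee_fin; exact: bnd.
Qed.

Lemma mild_solution_ae f g f' g' u : X2_eq f f' -> X2_eq g g' ->
  mild_solution G mu c f g u -> mild_solution G mu c f' g' u.
Proof.
move=> ff gg [cu Hu]; split=> // t; have [w [Iw Dw Ew]] := Hu t; exists w; split=> // j.
have := ff j; have := gg j; have := Ew j; apply: filterS3 => x E1 E2 E3 x01.
by rewrite E1// E2// E3.
Qed.

Lemma wave_smooth f g u : (forall j, smooth01 (c j)) ->
  (forall j, exists2 phi, ctest_fun phi & ae01 (f j) phi) ->
  (forall j, exists2 phi, ctest_fun phi & ae01 (g j) phi) ->
  mild_solution G mu c f g u ->
  forall t j, exists2 h, csmooth01 h & ae01 (u t j) h.
Proof.
move=> sc Hf Hg Hu t j.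
have pick (w : edge_fun R m) : (forall j, exists2 phi, ctest_fun phi & ae01 (w j) phi) ->
    exists phi : edge_fun R m, (forall j, ctest_fun (phi j)) /\ X2_eq w phi.
  move=> Hw; have /choice[phi Hphi] : forall j, exists phi, ctest_fun phi /\ ae01 (w j) phi.
    by move=> k; have [phi ? ?] := Hw k; exists phi.
  by exists phi; split=> k; have [] := Hphi k.
have [phi [Tphi fphi]] := pick f Hf; have [psi [Tpsi gpsi]] := pick g Hg.
have Hu' := mild_solution_ae fphi gpsi Hu.
have TC (w : edge_fun R m) : (forall j, ctest_fun (w j)) -> forall b j, test_fun (pf b w j).
  by move=> Tw b k; exact: ((cH_part _ _).1 (Tw k) b).
have TX (w : edge_fun R m) : (forall j, ctest_fun (w j)) -> X2 w.
  by move=> Tw; apply/X2P => b k; apply: test_fun_L2; exact: TC.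
have Sb b : exists h : R -> R, smooth01 h /\ ae01 (pf b (u t) j) h.
  have Cc k l : Cn l (c k) by exact: smooth01_Cn.
  have [h sh ah] := net_mild_smooth G_conn m_gt0 Cc
    (fun k => test_fun_Cinf0 (TC _ Tphi b k)) (fun k => test_fun_Cinf0 (TC _ Tpsi b k))
    (mild_part c_AC c_gt0 mu_gt0 G_conn m_gt0 b (TX _ Tphi) (TX _ Tpsi) Hu') t j.
  exists h; split=> //; move: ah; rewrite toXE//; move/X2P: (Hu.1.1 t); exact.
have [h Hh] := choice Sb; exists (fun x => (h false x +i* h true x)%C).
  by split; [have [] := Hh false|have [] := Hh true].
have [_ a0] := Hh false; have [_ a1] := Hh true.
move: a0 a1; apply: filterS2 => x E0 E1 x01; apply: part_eq => b.
by case: b; [exact: E1|exact: E0].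
Qed.

End WellPosedness.

Theorem theorem2p5 (R : realType) (n m : nat) (G : graph n m)
    (mu : 'I_m -> R) (c : 'I_m -> R -> R)
    (G_simple : simple_graph G) (G_connected : connected_graph G)
    (G_degree : forall i, (2 <= degree G i)%N)
    (mu_gt0 : forall j, 0 < mu j)
    (c_H1 : forall j, H1 (c j))
    (c_cont : forall j, {within `[0, 1], continuous (c j)})
    (c_gt0 : forall j x, x \in `[0, 1] -> 0 < c j x) :
  (* existence and uniqueness *)
  (forall f g : edge_fun R m, V G f -> X2 g ->
     exists u, mild_solution G mu c f g u /\
       forall v, mild_solution G mu c f g v -> forall t, X2_eq (u t) (v t)) /\
  (* continuous dependence *)
  (forall T : R, 0 < T ->
   forall f0 g0 : edge_fun R m, V G f0 -> X2 g0 ->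
   forall eps : R, 0 < eps -> exists2 delta : R, 0 < delta &
     forall f g : edge_fun R m, V G f -> X2 g ->
       V_norm (X2_sub f f0) < delta -> X2_norm mu (X2_sub g g0) < delta ->
     forall u u0, mild_solution G mu c f g u -> mild_solution G mu c f0 g0 u0 ->
       (CX2_norm mu T (fun t => X2_sub (u t) (u0 t)) < eps%:E)%E) /\
  (* regularity *)
  ((forall j, smooth01 (c j)) ->
   forall f g : edge_fun R m,
     (forall j, exists2 phi, ctest_fun phi & ae01 (f j) phi) ->
     (forall j, exists2 phi, ctest_fun phi & ae01 (g j) phi) ->
   forall u, mild_solution G mu c f g u ->
   forall t j, exists2 h, csmooth01 h & ae01 (u t j) h).
Proof.
(* the weights are themselves their continuous representatives *)
have /choice[c' c_AC] : forall j, exists d, abscont (c j) d.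
  move=> j; have [F [d [_ cF AF]]] := H1_sobolev (c_H1 j); exists d.
  have cE := cont01_ae_eq (c_cont j) (AC_cont AF) cF.
  by apply: (AC_eq _ AF) => x x01; rewrite cE.
have c0 j (x : R) : 0 <= x <= 1 -> 0 < c j x.
  by move=> x01; apply: c_gt0; rewrite in_itv.
have m0 : (0 < m)%N.
  have := leq_trans (ltnW (G_degree (Ordinal G_connected.1))) (max_card _).
  by rewrite card_ord.
split.
  move=> f g /V_X2 Hf Hg; have [u Hu] := wave_exists c_AC c0 mu_gt0 G_connected m0 Hf Hg.
  exists u; split=> // v; exact: (wave_unique c_AC c0 mu_gt0 G_connected m0 Hf Hg Hu).
split.
  exact: (wave_continuous c_AC c0 mu_gt0 G_connected m0).
by move=> sc f g Hf Hg u; exact: (wave_smooth c_AC c0 mu_gt0 G_connected m0 sc Hf Hg).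
Qed.
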